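(* Let $B=\{B_t,t\in[0,1]\}$ be a standard Brownian motion with natural filtration $(\mathcal{F}_t)$. Let $(\phi_n)_{n\ge1}$ be a sequence of bounded nonnegative functions on $[0,1]$ such that: (1) there are a sequence $\alpha_n\uparrow1$ and a constant $L>0$ with $$\lim_{n\to\infty}\int_{\alpha_n}^1\phi_n^2(t)\,dt=\lim_{n\to\infty}\int_0^1\phi_n^2(t)\,dt=L;$$ (2) for any $\delta\in[0,1)$, $\left(\sup_{0\le t\le\delta}\phi_n(t)\right)\left(\sup_{0\le t\le1}\phi_n(t)\right)\to0$ as $n\to\infty$. Let $u=\{u_{s,t},0\le s\le t\le1\}$ be a two-parameter process satisfying: (i) $u_{s,t}$ is $\mathcal{F}_s$-measurable for $s\le t$; (ii) $\int_0^1\int_0^tE(u_{s,t}^2)\,ds\,dt<\infty$; (iii) $u_{s,t}$ is continuous at $(1,1)$ in the $L^2(\Omega)$ sense. Consider the sequence of iterated Itô integrals $$F_n=\int_0^1\int_0^t\phi_n(s)\phi_n(t)u_{s,t}\,dB_s\,dB_t,\qquad n\ge1.$$ Then $F_n$ converges stably, as $n\to\infty$, to $\frac12L\,u_{1,1}H_2(Z)$, where $Z\sim N(0,1)$ is independent of the process $B$, and $H_2(x)=x^2-1$ is the second Hermite polynomial.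
   Context: The Brownian motion $B$ is defined on a probability space $(\Omega,\mathcal{F},P)$, where $\mathcal{F}$ is the $P$-completion of the $\sigma$-field generated by $B$. Stable convergence: random variables $F_n$ on $(\Omega,\mathcal{F},P)$ with values in $\mathbb{R}^d$ converge stably to an $\mathbb{R}^d$-valued random variable $F$, defined on some extended probability space $(\Omega',\mathcal{F}',P')$, if $$\lim_{n\to\infty}E\left[Ye^{i\langle\lambda,F_n\rangle_{\mathbb{R}^d}}\right]=E'\left[Ye^{i\langle\lambda,F\rangle_{\mathbb{R}^d}}\right]$$ for every $\lambda\in\mathbb{R}^d$ and every bounded $\mathcal{F}$-measurable random variable $Y$. The variable $Z$ lives on such an extension. *)

(* Defs.v *)
From HB Require Import structures.
From mathcomp Require Import all_boot all_order all_algebra.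
From mathcomp Require Import all_classical all_reals all_analysis.
From mathcomp Require Import complex.

Set Implicit Arguments.
Unset Strict Implicit.
Unset Printing Implicit Defensive.

Import Order.TTheory GRing.Theory Num.Theory.
Import numFieldNormedType.Exports.
Local Open Scope classical_set_scope.
Local Open Scope ring_scope.

Section SigmaFields.
Context {R : realType} {d : measure_display} {Omega : measurableType d}.
Implicit Types (B : R -> Omega -> R) (X : Omega -> R).
Implicit Types (G H : set_system Omega).

(* The sigma-field generated by (B s), 0 <= s <= t. *)
Definition sigma_upto B (t : R) : set_system Omega :=
  <<s \bigcup_(s in `[0, t]) preimage_set_system setT (B s) measurable >>.

(* The sets that differ from a set of H by a subset of a P-null set of G.
   When H is a sub-sigma-field of G, this is the sigma-field generated by H and
   the null sets of the P-completion of G. *)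
Definition augmentation (P : set Omega -> \bar R) G H : set_system Omega :=
  [set A | exists2 A', H A' &
     exists N, [/\ G N, P N = 0%E & A `+` A' `<=` N]].

Definition measurable_wrt G X : Prop :=
  forall C : set R, measurable C -> G (X @^-1` C).

Definition independent_of (P : set Omega -> \bar R) X G : Prop :=
  forall (C : set R) (A : set Omega), measurable C -> G A ->
    P (X @^-1` C `&` A) = (P (X @^-1` C) * P A)%E.

(* m is the mean and s > 0 the standard deviation, as in normal_prob. *)
Definition has_normal_law (P : set Omega -> \bar R) X (m s : R) : Prop :=
  measurable_fun setT X /\
  forall C : set R, measurable C -> P (X @^-1` C) = normal_prob m s C.

End SigmaFields.

Section Brownian.
Context {R : realType} {d : measure_display} {Omega : measurableType d}.
Variables (P : probability Omega R) (B : R -> Omega -> R).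

(* Only the times t in [0, 1] matter. *)
Definition standard_brownian_motion : Prop :=
  [/\ forall t : R, 0 <= t <= 1 -> measurable_fun setT (B t),
      {ae P, forall w, B 0 w = 0},
      {ae P, forall w, {within `[0, 1], continuous (fun t : R => B t w)}},
      forall s t : R, 0 <= s -> s < t -> t <= 1 ->
        has_normal_law P (fun w => B t w - B s w) 0 (Num.sqrt (t - s)) &
      forall s t : R, 0 <= s -> s < t -> t <= 1 ->
        independent_of P (fun w => B t w - B s w) (sigma_upto B s)].

(* The sigma-field of Omega is the P-completion of the one generated by B. *)
Definition brownian_space : Prop :=
  @measurable _ Omega = augmentation P (sigma_upto B 1) (sigma_upto B 1).

(* The natural filtration of B, augmented with the P-null sets. *)
Definition natural_filtration (t : R) : set_system Omega :=
  augmentation P (sigma_upto B 1) (sigma_upto B t).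

(* The process  sum_(i < k) xi_i 1_(]t_i, t_{i+1}]). *)
Record simple_process := SimpleProcess {
  sp_size : nat;
  sp_time : nat -> R;
  sp_coef : nat -> Omega -> R;
  sp_time_ge0 : 0 <= sp_time 0;
  sp_time_le1 : sp_time sp_size <= 1;
  sp_time_homo : forall i, (i < sp_size)%N -> sp_time i <= sp_time i.+1;
  sp_coef_adapted : forall i, (i < sp_size)%N ->
    measurable_wrt (natural_filtration (sp_time i)) (sp_coef i);
  sp_coef_bounded : forall i, (i < sp_size)%N ->
    exists M : R, forall w, `|sp_coef i w| <= M }.

Definition simple_value (S : simple_process) (s : R) (w : Omega) : R :=
  \sum_(i < sp_size S)
     sp_coef S i w * \1_(`]sp_time S i, sp_time S i.+1]) s.

Definition simple_integral (S : simple_process) (w : Omega) : R :=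
  \sum_(i < sp_size S)
     sp_coef S i w * (B (sp_time S i.+1) w - B (sp_time S i) w).

(* I is (a version of) the Ito integral of X over [0, 1]: the L^2(Omega)-limit
   of the integrals of simple processes that converge to X in
   L^2([0, 1] x Omega).  The closure of the simple processes in that space
   consists of the square integrable processes with an adapted version, so
   adaptedness of X need not be repeated.  By the Ito isometry, I is determined
   up to a P-null set by X. *)
Definition is_ito_integral (X : R -> Omega -> R) (I : Omega -> R) : Prop :=
  [/\ measurable_fun [set p : R * Omega | 0 <= p.1 <= 1]
        (fun p => X p.1 p.2),
      measurable_fun setT I &
      exists S : nat -> simple_process,
        (fun m => \int[lebesgue_measure]_(s in `[0%R, 1%R])
             'E_P[fun w => ((X s w - simple_value (S m) s w) ^+ 2)%R])%E
          @ \oo --> 0%E /\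
        (fun m => 'E_P[fun w => ((I w - simple_integral (S m) w) ^+ 2)%R])%E
          @ \oo --> 0%E].

(* F is (a version of) int_0^1 (int_0^t K(s, t) dB_s) dB_t.  The inner
   integral is only required to exist for almost every t, as square
   integrability of K on {s <= t} x Omega guarantees no more. *)
Definition is_iterated_ito_integral (K : R -> R -> Omega -> R)
    (F : Omega -> R) : Prop :=
  exists V : R -> Omega -> R,
    {ae lebesgue_measure, forall t : R, 0 <= t <= 1 ->
       is_ito_integral (fun s w => K s t w * \1_(`[0, t]) s) (V t)} /\
    is_ito_integral V F.

End Brownian.

Section StableConvergence.
Context {R : realType}.

Definition expi (x : R) : R[i] := (cos x +i* sin x)%C.

Definition cexpectation d (T : measurableType d) (P : probability T R)
    (f : T -> R[i]) : R[i] :=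
  (fine 'E_P[fun w => complex.Re (f w)] +i*
   fine 'E_P[fun w => complex.Im (f w)])%C.

(* The measure-preserving map pr carries the random variables of Omega to the
   extension Omega'. *)
Definition is_extension d (Omega : measurableType d) (P : probability Omega R)
    d' (Omega' : measurableType d') (P' : probability Omega' R)
    (pr : Omega' -> Omega) : Prop :=
  measurable_fun setT pr /\
  forall A, measurable A -> P' (pr @^-1` A) = P A.

Definition stable_cvg d (Omega : measurableType d) (P : probability Omega R)
    (F_ : nat -> Omega -> R)
    d' (Omega' : measurableType d') (P' : probability Omega' R)
    (pr : Omega' -> Omega) (F : Omega' -> R) : Prop :=
  forall (lambda : R) (Y : Omega -> R),
    measurable_fun setT Y -> (exists M : R, forall w, `|Y w| <= M) ->
    (fun n => cexpectation P
       (fun w => (Y w)%:C%C * expi (lambda * F_ n w)) : R[i]^o) @ \oo -->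
    (cexpectation P'
       (fun w' => (Y (pr w'))%:C%C * expi (lambda * F w')) : R[i]^o).

Definition hermite2 (x : R) : R := x ^+ 2 - 1.

End StableConvergence.

(* Main.v *)
(* Fix delta < 1.  As phi_n is small on [0, delta] and u is L^2-continuous at (1, 1),
   F_n is L^2-close to the double integral of
   u_{delta,delta} phi_n(s) phi_n(t) over delta < s < t <= 1.  With a step function
   sum_i c_i 1_]t_i, t_i+1] in place of phi_n, this integral is
   u_{delta,delta} (X^2 - v - D) / 2, where X = sum_i c_i (B_{t_i+1} - B_{t_i}) is
   N(0, v) and independent of F_delta, v tends to L, and
   D = sum_i c_i^2 ((B_{t_i+1} - B_{t_i})^2 - (t_i+1 - t_i)) is small in L^2 when the
   mesh is fine.  A bounded Y is L^1-close to a bounded F_delta-measurable Y', so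
   E[Y e^{i lambda F_n}] is close to
   E'[Y' e^{i lambda v u_{delta,delta} (Z^2 - 1) / 2}], and then to the announced
   limit.  The real and imaginary parts of e^{ix} only enter as bounded 1-Lipschitz
   functions. *)
Require Import Defs.
From HB Require Import structures.
From mathcomp Require Import all_boot all_order all_algebra.
From mathcomp Require Import all_classical all_reals all_analysis.
From mathcomp Require Import complex.
From mathcomp Require Import measurable_realfun ring lra.

Set Implicit Arguments.
Unset Strict Implicit.
Unset Printing Implicit Defensive.

Import Order.TTheory GRing.Theory Num.Theory.
Import numFieldNormedType.Exports.
Local Open Scope classical_set_scope.
Local Open Scope ring_scope.

(** * Gaussian moments *)

(** No limit theorem is invoked: with a step function in place of [phi n], the variable X is exactly
    Gaussian and independent of the past of delta, so one identity in law carries the result and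
    everything else is error control. Two constraints shape that control. Ito integrals are given
    only as L^2 limits of simple integrals, the inner one only at almost every outer time; so none
    is constructed, and F_n is compared directly with an elementary double sum, through a bound
    valid for every version. Moreover delta has to be fixed before n grows, and delta depends on the
    accuracy k. The final bound is therefore a constant times k, the constant depending on none of
    n, delta, k. Since cos and sin are Lipschitz, differences of their arguments matter only in L^1;
    each is written as a product of a factor bounded in L^2 and a factor of order k in L^2, so that
    no moment of u beyond the second is ever needed. *)

Section integral_density.
Local Open Scope ereal_scope.
Context d (T : measurableType d) (R : realType).
Variables (mu nu : {measure set T -> \bar R}) (g : T -> R).
Hypothesis mg : measurable_fun setT g.
Hypothesis g0 : forall x, (0 <= g x)%R.
Hypothesis nuE : forall A, measurable A -> nu A = \int[mu]_(x in A) (g x)%:E.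

Import HBNNSimple.

Let density_indic A : measurable A ->
  \int[nu]_x (\1_A x)%:E = \int[mu]_x ((\1_A x)%:E * (g x)%:E).
Proof.
move=> mA; rewrite integral_indic// setIT nuE// integral_mkcond.
apply: eq_integral => x _; rewrite patchE indicE.
by case: ifPn => xA; rewrite ?(negbTE xA) ?mul1e ?mul0e.
Qed.

Let density_nnsfun (f : {nnsfun T >-> R}) :
  \int[nu]_x (f x)%:E = \int[mu]_x ((f x)%:E * (g x)%:E).
Proof.
under [LHS]eq_integral do rewrite fimfunE -fsumEFin//.
rewrite [LHS]ge0_integral_fsum//; last 2 first.
  - by move=> r; exact/measurable_EFinP/measurableT_comp.
  - by move=> n x _; rewrite EFinM nnfun_muleindic_ge0.
under [RHS]eq_integral.
  move=> x xD; rewrite fimfunE -fsumEFin// ge0_mule_fsuml; last first.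
    by move=> r; rewrite EFinM nnfun_muleindic_ge0.
  over.
rewrite [RHS]ge0_integral_fsum//; last 2 first.
  - by move=> r; apply: emeasurable_funM;
      apply/measurable_EFinP => //; apply/measurableT_comp.
  - move=> n x _; rewrite EFinM mule_ge0 ?lee_fin//.
    exact: nnfun_muleindic_ge0.
apply: eq_fsbigr => r rf; rewrite integralZl_indic_nnsfun//=.
rewrite density_indic//.
have r0 : (0 <= r)%R by move: rf; rewrite inE => -[x _ <-].
rewrite -ge0_integralZl//; last 2 first.
- by apply: emeasurable_funM; apply/measurable_EFinP.
- by move=> x _; rewrite mule_ge0 ?lee_fin.
by apply: eq_integral => x _; rewrite EFinM muleA.
Qed.

(** The density formula passes from indicators to simple functions by linearity, then to [f] by
    monotone convergence on both sides. It turns Gaussian integrals into Lebesgue integrals. *)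
Lemma ge0_integral_density (f : T -> \bar R) :
  measurable_fun setT f -> (forall x, 0 <= f x) ->
  \int[nu]_x f x = \int[mu]_x (f x * (g x)%:E).
Proof.
move=> mf f0; pose f_ := nnsfun_approx measurableT mf.
have fE x : f x = lim ((f_ n x)%:E @[n --> \oo]).
  by apply/esym/cvg_lim => //; exact: cvg_nnsfun_approx.
transitivity (lim (\int[nu]_x (f_ n x)%:E @[n --> \oo])).
  rewrite -monotone_convergence//=.
  - by apply: eq_integral => x _; exact: fE.
  - by move=> n; exact/measurable_EFinP/measurable_funTS.
  - by move=> n ? _; rewrite lee_fin.
  - by move=> ? _ ? ? mn; rewrite lee_fin; exact/lefP/nd_nnsfun_approx.
transitivity (lim (\int[mu]_x ((f_ n x)%:E * (g x)%:E) @[n --> \oo])).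
  by apply: congr_lim; apply/funext => n /=; exact: density_nnsfun.
rewrite -monotone_convergence//=.
- apply: eq_integral => x _; rewrite fE -limeMr//.
  apply: ereal_nondecreasing_is_cvgn => m n mn.
  by rewrite lee_fin; exact/lefP/nd_nnsfun_approx.
- by move=> n; apply: emeasurable_funM; exact/measurable_EFinP.
- by move=> n x _; rewrite mule_ge0 ?lee_fin.
- move=> x _ m n mn; rewrite lee_wpmul2r ?lee_fin//.
  exact/lefP/nd_nnsfun_approx.
Qed.

End integral_density.

Section integral_monotone.
Local Open Scope ereal_scope.
Context d (T : measurableType d) (R : realType) (mu : {measure set T -> \bar R}).

(** The integral of a nonnegative function is a supremum over the simple functions below it, so
    monotonicity holds for arbitrary functions. This spares measurability proofs for the many
    pointwise bounds on inner integrals. *)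
Lemma ge0_le_integral_nomeas (D : set T) (f g : T -> \bar R) :
  (forall x, D x -> 0 <= f x) -> (forall x, D x -> f x <= g x) ->
  \int[mu]_(x in D) f x <= \int[mu]_(x in D) g x.
Proof.
move=> f0 fg; have g0 x : D x -> 0 <= g x by move=> Dx; rewrite (le_trans (f0 _ Dx)) ?fg.
rewrite !ge0_integralE//; apply: le_ereal_sup => _ /= [h hf <-]; exists h => // x.
by apply: le_trans (hf x) _; rewrite !patchE; case: ifPn => // /[!inE] /fg.
Qed.

End integral_monotone.

Section normal_law.
Local Open Scope ereal_scope.
Context {R : realType}.
Local Notation mu := (@lebesgue_measure R).
Local Notation gamma := (@normal_prob R 0 1).

(** The rescaled image measure agrees with [mu] on half-open intervals, and these determine Lebesgue
    measure. *)
Lemma lebesgue_measure_scale (s : R) (A : set R) : (0 < s)%R -> measurable A ->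
  mu A = s%:E * mu ((fun x : R => s * x)%R @^-1` A).
Proof.
move=> s0 mA.
have ms : measurable_fun setT ((fun x => s * x)%R : measurableTypeR R -> measurableTypeR R).
  exact: mulrl_measurable.
have s0' : (0 <= s)%R by exact: ltW.
pose f : {mfun measurableTypeR R >-> measurableTypeR R} :=
  HB.pack ((fun x => s * x)%R : measurableTypeR R -> measurableTypeR R)
   (isMeasurableFun.Build _ _ _ _ _ ms).
rewrite (@lebesgue_measure_unique R (mscale (NngNum s0') (pushforward mu f)))//.
move=> _ [[a b] _ <-]; rewrite /= /mscale /pushforward/=.
rewrite /pushforward (_ : [eta *%R s] @^-1` `]a, b] = `](a / s)%R, (b / s)%R]%classic); last first.
  apply/seteqP; split => x /=; rewrite !in_itv/= ltr_pdivrMr// ler_pdivlMr//;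
  by rewrite (mulrC x).
rewrite !lebesgue_measure_itv/= !lte_fin ltr_pM2r ?invr_gt0//.
case: ifPn => _; rewrite ?mule0// -!EFinD -EFinM; congr (_%:E).
by rewrite mulrBr !(mulrC s) !divfK// gt_eqF.
Qed.

Lemma normal_peak_scale (s : R) : (0 < s)%R ->
  (normal_peak 1 = s * normal_peak s :> R)%R.
Proof.
move=> s0; rewrite /normal_peak.
rewrite expr1n mul1r -mulrnAr sqrtrM ?sqr_ge0// sqrtr_sqr gtr0_norm// invfM.
by rewrite mulrA divff ?gt_eqF// mul1r.
Qed.

Lemma normal_pdf_scale (s x : R) : (0 < s)%R ->
  (s * normal_pdf 0 s (s * x) = normal_pdf 0 1 x)%R.
Proof.
move=> s0; rewrite !normal_pdfE ?gt_eqF// (normal_peak_scale s0) mulrA.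
congr (_ * expR _)%R.
rewrite !subr0 expr1n exprMn -mulr_natr -[in RHS]mulr_natr.
by field; rewrite gt_eqF.
Qed.

Lemma normal_prob_scale (s : R) (A : set R) : (0 < s)%R -> measurable A ->
  normal_prob 0 s A = gamma ((fun x : R => s * x)%R @^-1` A).
Proof.
move=> s0 mA; have s0' := ltW s0.
have ms : measurable_fun setT ((fun x => s * x)%R : measurableTypeR R -> measurableTypeR R).
  exact: mulrl_measurable.
pose f : {mfun measurableTypeR R >-> measurableTypeR R} :=
  HB.pack ((fun x => s * x)%R : measurableTypeR R -> measurableTypeR R)
   (isMeasurableFun.Build _ _ _ _ _ ms).
have mpdf t D : measurable_fun D (fun x : R => (normal_pdf 0 t x)%:E).
  by apply/measurable_EFinP/measurable_funTS; exact: measurable_normal_pdf.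
rewrite /normal_prob.
rewrite (eq_measure_integral (mscale (NngNum s0') (pushforward mu f))); last first.
  by move=> C mC _; rewrite [LHS](lebesgue_measure_scale s0 mC).
rewrite ge0_integral_mscale//=; last 2 first.
- exact: mpdf.
- by move=> x _; rewrite lee_fin normal_pdf_ge0.
rewrite ge0_integral_pushforward//=; last 2 first.
- exact: mpdf.
- by move=> x _; rewrite lee_fin normal_pdf_ge0.
have mfA : measurable (f @^-1` A) by rewrite -[X in measurable X]setTI; exact (ms measurableT _ mA).
transitivity (\int[mu]_(x in (fun x => s * x)%R @^-1` A) (s%:E * (normal_pdf 0 s (s * x))%:E)).
  rewrite ge0_integralZl//.
  - apply/measurable_EFinP/measurable_funTS.
    apply: (@measurableT_comp _ _ _ _ _ _ (normal_pdf 0 s)).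
      exact: measurable_normal_pdf.
    exact: mulrl_measurable.
  - by move=> x _; rewrite lee_fin normal_pdf_ge0.
by apply: eq_integral => x _; rewrite -EFinM normal_pdf_scale.
Qed.

Lemma normal_prob_sym (A : set R) : measurable A ->
  gamma A = gamma (-%R @^-1` A).
Proof.
move=> mA.
have ms : measurable_fun setT (-%R : measurableTypeR R -> measurableTypeR R).
  exact: oppr_measurable.
have mpdf t D : measurable_fun D (fun x : R => (normal_pdf 0 t x)%:E).
  by apply/measurable_EFinP/measurable_funTS; exact: measurable_normal_pdf.
rewrite /normal_prob.
rewrite (eq_measure_integral (pushforward mu (-%R : _ -> measurableTypeR R))); last first.
  by move=> C mC _; symmetry; exact: lebesgue_measureN.
rewrite ge0_integral_pushforward//=; last 2 first.
- exact: mpdf.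
- by move=> x _; rewrite lee_fin normal_pdf_ge0.
apply: eq_integral => x _ /=; congr (_%:E).
by rewrite !normal_pdfE ?oner_eq0// /normal_fun !subr0 sqrrN.
Qed.

Lemma ge0_integral_gamma (f : R -> \bar R) :
  measurable_fun setT f -> (forall x, 0 <= f x) ->
  \int[gamma]_x f x = \int[mu]_x (f x * (normal_pdf 0 1 x)%:E).
Proof.
move=> mf f0.
apply: (@ge0_integral_density _ (measurableTypeR R) R mu gamma (normal_pdf 0 1)) => //.
- exact: measurable_normal_pdf.
- by move=> x; exact: normal_pdf_ge0.
Qed.

(* exp(b x^2) tilts N(0, 1) into N(0, s^2), up to the factor s. *)
Lemma integral_gamma_expR_sqr (s : R) : (0 < s)%R ->
  \int[gamma]_x (expR ((1 - s ^- 2) / 2 * x ^+ 2))%:E = s%:E.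
Proof.
move=> s0; rewrite ge0_integral_gamma; last 2 first.
- apply/measurable_EFinP; apply: measurableT_comp => //.
  by apply: measurable_funM => //; exact: exprn_measurable.
- by move=> x; rewrite lee_fin expR_ge0.
transitivity (\int[mu]_x (s%:E * (normal_pdf 0 s x)%:E)).
  apply: eq_integral => x _; rewrite -!EFinM; congr (_%:E).
  rewrite !normal_pdfE ?gt_eqF// /normal_fun mulrCA -expRD [RHS]mulrA.
  rewrite -normal_peak_scale//; congr (_ * expR _)%R.
  by rewrite !subr0; field; rewrite gt_eqF.
rewrite ge0_integralZl//.
- by rewrite integral_normal_pdf mule1.
- by apply/measurable_EFinP; exact: measurable_normal_pdf.
- by move=> x _; rewrite lee_fin normal_pdf_ge0.
- by rewrite lee_fin ltW.
Qed.

Lemma integral_gamma_cst c : \int[gamma]_x c = c.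
Proof.
rewrite integral_cst// -[RHS]mule1; congr (_ * _).
exact: (@probability_setT _ _ _ gamma).
Qed.

(** Integrating 1 + y <= e^y at y = b x^2, with the exact exponential moment s, gives b E[z^2] <= s
    - 1. The bound is (s - 1) / b, which tends to 1 as s decreases to 1: the second moment is found
    by squeezing, without integration by parts. *)
Lemma normal_sqr_ub (s : R) : (1 < s)%R ->
  \int[gamma]_x (x ^+ 2)%:E <= (2 * s ^+ 2 / (1 + s))%:E.
Proof.
move=> s1; have s0 : (0 < s)%R by apply: lt_trans s1.
set b := ((1 - s ^- 2) / 2)%R.
have b0 : (0 < b)%R by rewrite divr_gt0// subr_gt0 invf_lt1 ?exprn_gt0// exprn_egt1.
have mX : measurable_fun setT (fun x : R => (b * x ^+ 2)%:E).
  by apply/measurable_EFinP/measurable_funM => //; exact: exprn_measurable.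
have : 1 + \int[gamma]_x (b * x ^+ 2)%:E <= s%:E.
  rewrite -(integral_gamma_expR_sqr s0) -/b.
  rewrite -[X in X + _](integral_gamma_cst 1) -ge0_integralD//; last by move=> x _; rewrite lee_fin mulr_ge0 ?sqr_ge0// ltW.
  apply: ge0_le_integral_nomeas => x _.
    by rewrite -EFinD lee_fin addr_ge0// mulr_ge0 ?sqr_ge0// ltW.
  by rewrite -EFinD lee_fin expR_ge1Dx.
under eq_integral do rewrite EFinM.
rewrite ge0_integralZl//; last 3 first.
- by apply/measurable_EFinP; exact: exprn_measurable.
- by move=> x _; rewrite lee_fin sqr_ge0.
- by rewrite lee_fin ltW.
have : 0 <= \int[gamma]_x (x ^+ 2)%:E.
  by apply: integral_ge0 => x _; rewrite lee_fin sqr_ge0.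
case: (\int[gamma]_x (x ^+ 2)%:E) => [r| |]//; last first.
  by rewrite gt0_muley ?lte_fin.
rewrite !lee_fin => r0 h.
have h2 : (b * r <= s - 1)%R by lra.
rewrite -(ler_pM2l b0); apply: le_trans h2 _.
rewrite le_eqVlt; apply/orP; left; apply/eqP; rewrite /b.
by field; apply/andP; split; rewrite gt_eqF// addr_gt0.
Qed.

(** The same inequality 1 + y <= e^y with s < 1, where b is negative: moving - b x^2 to the other
    side keeps both integrands nonnegative. *)
Lemma normal_sqr_lb (s : R) : (0 < s < 1)%R ->
  (2 * s ^+ 2 / (1 + s))%:E <= \int[gamma]_x (x ^+ 2)%:E.
Proof.
move=> /andP[s0 s1].
set b := ((1 - s ^- 2) / 2)%R.
have b0 : (0 < - b)%R.
  rewrite oppr_gt0 /b pmulr_llt0// subr_lt0 invf_gt1 ?exprn_gt0//.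
  by rewrite exprn_ilt1 ?ltW.
have mX : measurable_fun setT (fun x : R => (- b * x ^+ 2)%:E).
  by apply/measurable_EFinP/measurable_funM => //; exact: exprn_measurable.
have mE : measurable_fun setT (fun x : R => (expR (b * x ^+ 2))%:E).
  apply/measurable_EFinP; apply: measurableT_comp => //.
  by apply: measurable_funM => //; exact: exprn_measurable.
have : 1 <= s%:E + \int[gamma]_x (- b * x ^+ 2)%:E.
  rewrite -(integral_gamma_expR_sqr s0) -/b.
  rewrite -[leLHS](integral_gamma_cst 1) -ge0_integralD//; last first.
  - by move=> x _; rewrite lee_fin mulr_ge0 ?sqr_ge0// ltW.
  apply: ge0_le_integral_nomeas => x _; first by rewrite lee_fin.
  rewrite -EFinD lee_fin; have := expR_ge1Dx (b * x ^+ 2)%R; lra.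
under eq_integral do rewrite EFinM.
rewrite ge0_integralZl//; last 3 first.
- by apply/measurable_EFinP; exact: exprn_measurable.
- by move=> x _; rewrite lee_fin sqr_ge0.
- by rewrite lee_fin ltW.
have : 0 <= \int[gamma]_x (x ^+ 2)%:E.
  by apply: integral_ge0 => x _; rewrite lee_fin sqr_ge0.
case: (\int[gamma]_x (x ^+ 2)%:E) => [r| |]//; last by move=> *; rewrite leey.
rewrite !lee_fin => r0 h.
have h2 : (1 - s <= - b * r)%R by lra.
rewrite -(ler_pM2l b0); apply: le_trans h2.
rewrite le_eqVlt; apply/orP; left; apply/eqP; rewrite /b.
by field; apply/andP; split; rewrite gt_eqF// addr_gt0.
Qed.

Lemma normal_sqr : \int[gamma]_x (x ^+ 2)%:E = 1.
Proof.
have h0 : 0 <= \int[gamma]_x (x ^+ 2)%:E.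
  by apply: integral_ge0 => x _; rewrite lee_fin sqr_ge0.
(* The instance s = 2 serves only to rule out the value +oo. *)
have := @normal_sqr_ub 2 ltac:(lra); have := normal_sqr_lb; have := normal_sqr_ub.
case: (\int[gamma]_x (x ^+ 2)%:E) h0 => [r| |]// _ hub hlb _.
congr (_%:E); apply/eqP; rewrite eq_le; apply/andP; split; apply/ler_addgt0Pl => e e0.
- pose s := (1 + e / 2)%R.
  have s1 : (1 < s)%R by rewrite /s; lra.
  have := hub s s1; rewrite lee_fin => /le_trans; apply.
  rewrite ler_pdivrMr; last by lra.
  rewrite /s; nra.
(* The minimum with 1 keeps s = 1 - t / 2 in the interval where the lower bound applies. *)
- pose t := (Num.min e 1)%R.
  have [t0 te t1] : [/\ (0 < t)%R, (t <= e)%R & (t <= 1)%R].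
    by rewrite /t lt_min e0 ltr01 !ge_min !lexx orbT.
  pose s := (1 - t / 2)%R.
  have s1 : (0 < s < 1)%R by rewrite /s; apply/andP; split; lra.
  have := hlb s s1; rewrite lee_fin => h.
  have : (1 - t <= 2 * s ^+ 2 / (1 + s))%R.
    rewrite ler_pdivlMr; last by rewrite /s; lra.
    rewrite /s; nra.
  lra.
Qed.

(** The inequality y^2 / 2 <= e^y at y = b x^2 bounds x^4 by a multiple of an exponential whose
    integral is known, taking s = 2. *)
Lemma normal_pow4 : \int[gamma]_x (x ^+ 4)%:E < +oo.
Proof.
have s0 : (0 < 2 :> R)%R by [].
have := integral_gamma_expR_sqr s0.
set b := ((1 - 2 ^- 2) / 2)%R => hb.
have b0 : (0 < b)%R by rewrite /b; lra.
apply: (@le_lt_trans _ _ (\int[gamma]_x ((2 / b ^+ 2)%:E * (expR (b * x ^+ 2))%:E))).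
  apply: ge0_le_integral_nomeas => x _.
    by rewrite lee_fin exprn_even_ge0.
  rewrite -EFinM lee_fin.
  have bx0 : (0 <= b * x ^+ 2)%R by rewrite mulr_ge0 ?sqr_ge0// ltW.
  have h := expR_ge1Dxn 1 bx0.
  rewrite (_ : (x ^+ 4 = 2 / b ^+ 2 * ((b * x ^+ 2) ^+ 2 / 2))%R); last first.
    by field; rewrite gt_eqF.
  apply: ler_wpM2l; first by rewrite divr_ge0// exprn_ge0// ltW.
  by apply: le_trans h; rewrite (_ : 2`!%N = 2%N)// lerDr.
rewrite ge0_integralZl//.
- by rewrite hb -EFinM ltry.
- apply/measurable_EFinP; apply: measurableT_comp => //.
  by apply: measurable_funM => //; exact: exprn_measurable.
- by rewrite lee_fin divr_ge0 ?exprn_ge0 ?ltW.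
Qed.

Lemma gamma_sqr_integrable :
  gamma.-integrable setT (fun x => (x ^+ 2)%:E).
Proof.
apply/integrableP; split; first by apply/measurable_EFinP; exact: exprn_measurable.
under eq_integral do rewrite gee0_abs ?lee_fin ?sqr_ge0//.
by rewrite normal_sqr ltry.
Qed.

Lemma gamma_pow4_integrable :
  gamma.-integrable setT (fun x => (x ^+ 4)%:E).
Proof.
apply/integrableP; split; first by apply/measurable_EFinP; exact: exprn_measurable.
under eq_integral do rewrite gee0_abs ?lee_fin ?exprn_even_ge0//.
exact: normal_pow4.
Qed.

Lemma gamma_id_integrable : gamma.-integrable setT (fun x => x%:E).
Proof.
have i1 : gamma.-integrable setT (fun x => 1%:E + (x ^+ 2)%:E).
  apply: (@integrableD _ _ _ gamma _ _ (cst 1%:E)) => //; last exact: gamma_sqr_integrable.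
  exact: finite_measure_integrable_cst.
apply: (le_integrable _ _ _ i1) => //; first by apply/measurable_EFinP.
move=> x _; rewrite -EFinD !abse_EFin lee_fin [leRHS]ger0_norm ?addr_ge0 ?sqr_ge0//.
by rewrite ler_norml; apply/andP; split; nra.
Qed.

(** By symmetry the integral equals its opposite, and it is finite. *)
Lemma normal_mean : \int[gamma]_x x%:E = 0.
Proof.
have i1 := gamma_id_integrable.
have ms : measurable_fun setT (-%R : measurableTypeR R -> measurableTypeR R).
  exact: oppr_measurable.
have fin := integrable_fin_num measurableT i1.
have : \int[gamma]_x x%:E = - \int[gamma]_x x%:E.
  rewrite -[RHS]mulN1e -EFinN -integralZl//.
  transitivity (\int[pushforward gamma (-%R : measurableTypeR R -> measurableTypeR R)]_x x%:E).
    by apply: eq_measure_integral => A mA _; exact: normal_prob_sym.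
  rewrite (@integral_pushforward _ _ _ _ _ _ ms gamma setT EFin)//.
    by apply: eq_integral => x _; rewrite /= mulN1e.
  by rewrite preimage_setT; exact: (integrableN i1).
rewrite -(fineK fin) -EFinN => -[h]; congr (_%:E); lra.
Qed.

End normal_law.

(** * Independence *)

Section joint_law.
Local Open Scope ereal_scope.
Context {R : realType} {d0 d1 d2 d3 : measure_display}.
Context (T : measurableType d0) (T1 : measurableType d1) (T2 : measurableType d2)
  (T3 : measurableType d3).
Variables (P : probability T R) (P1 : probability T1 R) (P3 : probability T3 R).
Variables (X : T -> T1) (Y : T -> T2) (g : T3 -> T2).
Hypotheses (mX : measurable_fun setT X) (mY : measurable_fun setT Y)
  (mg : measurable_fun setT g).
Hypothesis XY : forall A C, measurable A -> measurable C ->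
  P (X @^-1` A `&` Y @^-1` C) = P1 A * P3 (g @^-1` C).

Let XYfun : T -> T1 * T2 := fun w => (X w, Y w).
Let gfun : T1 * T3 -> T1 * T2 := fun p => (p.1, g p.2).

Let mXY : measurable_fun setT XYfun.
Proof. exact: measurable_fun_pair. Qed.

Let mgfun : measurable_fun setT gfun.
Proof.
apply: measurable_fun_pair; first exact: measurable_fst.
by apply: measurableT_comp => //; exact: measurable_snd.
Qed.

Let Yg := mfun_Sub (mem_set mg).

(** Both measures give a rectangle the product of [P1] and the law of [g], and rectangles determine
    the product measure. Keeping [g] explicit lets the second factor be integrated under a fixed
    reference law: s z under N(0, 1) for a Gaussian increment, the identity for [Z]. *)
Let lawXY (A : set (T1 * T2)) : measurable A ->
  pushforward P XYfun A = pushforward (P1 \x P3) gfun A.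
Proof.
move=> mA.
pose m2 := distribution P3 Yg.
pose lP : {measure set (T1 * T2) -> \bar R} := distribution P (mfun_Sub (mem_set mXY)).
pose lQ : {measure set (T1 * T2) -> \bar R} :=
  distribution (P1 \x P3)%E (mfun_Sub (mem_set mgfun)).
transitivity ((P1 \x m2) A).
  by symmetry; apply: (@product_measure_unique _ _ _ _ _ P1 m2 lP).
apply: (@product_measure_unique _ _ _ _ _ P1 m2 lQ) => // A1 A2 mA1 mA2.
rewrite /lQ /= /pushforward.
rewrite (_ : _ @^-1` _ = A1 `*` (g @^-1` A2)); last by apply/seteqP; split.
rewrite product_measure1E// -[X in measurable X]setTI; exact: mg.
Qed.

Lemma ge0_integral_joint_law (f : T1 * T2 -> \bar R) :
  measurable_fun setT f -> (forall x, 0 <= f x) ->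
  \int[P]_w f (X w, Y w) = \int[P1]_x \int[P3]_y f (x, g y).
Proof.
move=> mf f0.
transitivity (\int[pushforward P XYfun]_p f p).
  by rewrite ge0_integral_pushforward.
rewrite (eq_measure_integral (pushforward (P1 \x P3) gfun)); last first.
  by move=> A mA _; exact: lawXY.
rewrite ge0_integral_pushforward//= preimage_setT.
by rewrite fubini_tonelli1//; exact: measurableT_comp.
Qed.

Lemma integrable_joint_law (f : T1 * T2 -> \bar R) :
  measurable_fun setT f -> \int[P1]_x \int[P3]_y `|f (x, g y)| < +oo ->
  P.-integrable setT (fun w => f (X w, Y w)).
Proof.
move=> mf foo; apply/integrableP; split; first exact: measurableT_comp.
rewrite (ge0_integral_joint_law (f := abse \o f))//.
  exact: measurableT_comp.
by move=> x; exact: abse_ge0.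
Qed.

Lemma integral_joint_law (f : T1 * T2 -> \bar R) :
  measurable_fun setT f -> \int[P1]_x \int[P3]_y `|f (x, g y)| < +oo ->
  \int[P]_w f (X w, Y w) = \int[P1]_x \int[P3]_y f (x, g y).
Proof.
move=> mf foo.
have intf : (P1 \x P3).-integrable setT (f \o gfun).
  apply/integrable12ltyP => //; exact: measurableT_comp.
transitivity (\int[pushforward P XYfun]_p f p).
  by rewrite integral_pushforward//=; exact: integrable_joint_law.
rewrite (eq_measure_integral (pushforward (P1 \x P3) gfun)); last first.
  by move=> A mA _; exact: lawXY.
by rewrite integral_pushforward//= -integral12_prod_meas1.
Qed.

Lemma measurable_fun_joint_law (f : T1 * T2 -> \bar R) :
  measurable_fun setT f -> (forall x, 0 <= f x) ->
  measurable_fun setT (fun x => \int[P3]_y f (x, g y)).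
Proof.
move=> mf f0; apply: (measurable_fun_fubini_tonelli_F (f \o gfun)) => [|p].
  exact: measurableT_comp.
exact: f0.
Qed.

Lemma integrable_fun_joint_law (f : T1 * T2 -> \bar R) :
  measurable_fun setT f -> \int[P1]_x \int[P3]_y `|f (x, g y)| < +oo ->
  P1.-integrable setT (fun x => \int[P3]_y f (x, g y)).
Proof.
move=> mf foo; apply: (integrable_fubini_F (f := f \o gfun)).
apply/integrable12ltyP => //; exact: measurableT_comp.
Qed.

End joint_law.

Section independent_gaussian.
Local Open Scope ereal_scope.
Context {R : realType} {d : measure_display} {Omega : measurableType d}.
Variable P : probability Omega R.
Local Notation gamma := (@normal_prob R 0 1).

(* Writing the law as that of s * z under N(0, 1) makes s = 0 the Dirac mass at 0,
   whereas normal_prob 0 0 is a junk value. *)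
Definition gaussian_indep (G : set_system Omega) (X : Omega -> R) (s : R) : Prop :=
  measurable_fun setT X /\
  forall A C, G A -> measurable C ->
    P (A `&` X @^-1` C) = P A * gamma ((fun z => s * z)%R @^-1` C).

Variable G : set_system Omega.
Hypotheses (sG : sigma_algebra setT G) (Gm : G `<=` measurable).

Let GE : <<s G >> = G. Proof. exact: sigma_algebra_id. Qed.

Let id_measurable : measurable_fun setT (id : Omega -> g_sigma_algebraType G).
Proof.
by move=> _ A; rewrite /measurable/= GE => GA; rewrite setTI; exact: Gm.
Qed.

Lemma measurable_wrtP (X : Omega -> R) :
  measurable_wrt G X <-> measurable_fun setT (X : g_sigma_algebraType G -> R).
Proof.
split=> [GX _ C mC|mX C mC]; first by rewrite setTI /measurable/= GE; exact: GX.
by have := mX measurableT C mC; rewrite setTI /measurable/= GE.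
Qed.

Lemma measurable_wrt_measurable (X : Omega -> R) :
  measurable_wrt G X -> measurable_fun setT X.
Proof. by move=> GX _ C mC; rewrite setTI; exact/Gm/GX. Qed.

(** The restriction of [P] to [G], obtained as the law of the identity map. Independence of [X] from
    [G] then becomes the product form of the joint law of (id, X). *)
Let PG : probability (g_sigma_algebraType G) R :=
  distribution P (mfun_Sub (mem_set id_measurable)).

Variables (X : Omega -> R) (s : R).
Hypothesis XG : gaussian_indep G X s.

Let mX : measurable_fun setT X. Proof. by case: XG. Qed.

Let law (A : set (g_sigma_algebraType G)) (C : set R) : measurable A -> measurable C ->
  P (id @^-1` A `&` X @^-1` C) = PG A * gamma ((fun z => s * z)%R @^-1` C).
Proof.
move=> mA mC; have GA : G A by rewrite -GE; exact: mA.
exact: (XG.2 _ _ GA mC).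
Qed.

Let ms : measurable_fun setT (fun z : R => (s * z)%R).
Proof. exact: mulrl_measurable. Qed.

Let ge0J := @ge0_integral_joint_law R d _ _ _ Omega (g_sigma_algebraType G)
  (measurableTypeR R) (measurableTypeR R) P PG gamma id X (fun z => s * z)%R
  id_measurable mX ms law.
Let iJ := @integrable_joint_law R d _ _ _ Omega (g_sigma_algebraType G)
  (measurableTypeR R) (measurableTypeR R) P PG gamma id X (fun z => s * z)%R
  id_measurable mX ms law.
Let J := @integral_joint_law R d _ _ _ Omega (g_sigma_algebraType G)
  (measurableTypeR R) (measurableTypeR R) P PG gamma id X (fun z => s * z)%R
  id_measurable mX ms law.
Let mJ := @measurable_fun_joint_law R _ _ _ (g_sigma_algebraType G)
  (measurableTypeR R) (measurableTypeR R) gamma (fun z => s * z)%R ms.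
Let iJ1 := @integrable_fun_joint_law R _ _ _ (g_sigma_algebraType G)
  (measurableTypeR R) (measurableTypeR R) PG gamma (fun z => s * z)%R ms.

(** The freezing lemma, which replaces conditional expectations throughout. The first coordinate of
    [f] carries the sigma-field [G], so whatever is frozen has to be [G]-measurable. *)
Lemma ge0_integral_gaussian_indep (f : g_sigma_algebraType G * R -> \bar R) :
  measurable_fun setT f -> (forall p, 0 <= f p) ->
  \int[P]_w f (w, X w) = \int[P]_w \int[gamma]_z f (w, (s * z)%R).
Proof.
move=> mf f0.
have := ge0J mf f0.
move=> /= ->.
rewrite /PG ge0_integral_distribution//.
- exact: mJ.
- by move=> y; apply: integral_ge0 => z _.
Qed.

Lemma integral_gaussian_indep (f : g_sigma_algebraType G * R -> \bar R) :
  measurable_fun setT f ->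
  \int[P]_w \int[gamma]_z `|f (w, (s * z)%R)| < +oo ->
  P.-integrable setT (fun w => f (w, X w)) /\
  \int[P]_w f (w, X w) = \int[P]_w \int[gamma]_z f (w, (s * z)%R).
Proof.
move=> mf foo.
have foo' : \int[PG]_w \int[gamma]_z `|f (w, (s * z)%R)| < +oo.
  rewrite /PG ge0_integral_distribution//.
  - apply: (mJ (f := abse \o f)) => [|p]; last exact: abse_ge0.
    exact: measurableT_comp.
  - by move=> y; apply: integral_ge0 => z _.
split; first exact: (iJ mf foo').
have := J mf foo'; move=> /= ->.
have /integrableP[mF h] := iJ1 mf foo'.
rewrite /PG integral_distribution//; apply/integrableP; split.
  exact: (measurableT_comp mF id_measurable).
move: h; rewrite /PG ge0_integral_distribution//.
exact: measurableT_comp.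
Qed.

Lemma integral_gaussian_indepM (xi : Omega -> R) (k : R -> R) :
  measurable_wrt G xi -> P.-integrable setT (EFin \o xi) ->
  measurable_fun setT k -> gamma.-integrable setT (fun z => (k (s * z)%R)%:E) ->
  P.-integrable setT (fun w => (xi w * k (X w))%:E) /\
  \int[P]_w (xi w * k (X w))%:E =
    (\int[P]_w (xi w)%:E) * (\int[gamma]_z (k (s * z)%R)%:E).
Proof.
move=> Gxi ixi mk ik.
pose f (p : g_sigma_algebraType G * R) := (xi p.1 * k p.2)%:E.
have mf : measurable_fun setT f.
  apply/measurable_EFinP/measurable_funM; apply: measurableT_comp => //.
  exact/measurable_wrtP.
have mxi := measurable_wrt_measurable Gxi.
have kint w : \int[gamma]_z `|f (w, (s * z)%R)| =
    `|(xi w)%:E| * \int[gamma]_z `|(k (s * z)%R)%:E|.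
  rewrite -ge0_integralZl//.
  - by apply: eq_integral => z _; rewrite /f/= normrM EFinM.
  - by apply: measurableT_comp => //; exact: (measurable_int _ ik).
have [|i1 i2] := @integral_gaussian_indep f mf.
  under eq_integral do rewrite kint.
  rewrite ge0_integralZr//.
  - have x0 : 0 <= \int[P]_w `|(xi w)%:E| by exact: integral_ge0.
    apply: lte_mul_pinfty => //; last by have /integrableP[] := ik.
    by rewrite ge0_fin_numE//; have /integrableP[] := ixi.
  - by apply: measurableT_comp => //; exact/measurable_EFinP.
  - exact: integral_ge0.
split=> //; rewrite i2 /f/=.
have kfin := integrable_fin_num measurableT ik.
under eq_integral.
  move=> w _; under eq_integral do rewrite EFinM; rewrite integralZl//=.
  rewrite -(fineK kfin); over.
by rewrite integralZr// fineK.
Qed.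

End independent_gaussian.

(** * The Brownian filtration *)

Section augmentation.
Local Open Scope ereal_scope.
Context {R : realType} {d : measure_display} {Omega : measurableType d}.
Variable P : probability Omega R.

Lemma eq_measure_mod_null (A A' N E : set Omega) :
  measurable A -> measurable A' -> measurable N -> measurable E ->
  P N = 0 -> A `+` A' `<=` N -> P (A `&` E) = P (A' `&` E).
Proof.
have le C C' : measurable C -> measurable C' -> measurable N -> measurable E ->
    P N = 0 -> C `\` C' `<=` N -> P (C `&` E) <= P (C' `&` E).
  move=> mC mC' mN mE N0 CN; rewrite -(@measureU0 _ _ _ P (C' `&` E) N)//; last first.
    exact: measurableI.
  apply: le_measure; rewrite ?inE; [exact: measurableI| |].
    by apply: measurableU => //; exact: measurableI.
  move=> w [Cw Ew]; have [C'w|C'w] := pselect (C' w); first by left.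
  by right; exact: CN.
move=> mA mA' mN mE N0 AN; apply/eqP; rewrite eq_le; apply/andP; split;
  apply: le => //; apply: subset_trans AN; [exact: subsetUl|exact: subsetUr].
Qed.

Variables (G H : set_system Omega).
Hypotheses (sG : sigma_algebra setT G) (Gm : G `<=` measurable)
  (sH : sigma_algebra setT H).

Lemma sub_augmentation : H `<=` augmentation P G H.
Proof.
move=> A HA; exists A => //; exists set0; split; first by case: sG.
  exact: measure0.
by rewrite setYK.
Qed.

(** For countable unions, the exceptional null sets of [G] are united into one null set of [G]. *)
Lemma sigma_algebra_augmentation : sigma_algebra setT (augmentation P G H).
Proof.
split; first by apply: sub_augmentation; case: sH.
- move=> A [A' HA' [N [GN PN AN]]]; exists (setT `\` A'); first by case: sH => _ + _; exact.
  exists N; split => // w; rewrite /setY/= => Aw; apply: AN.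
  by move: Aw => [[[_ nA] h]|[[_ nA'] h]]; [right|left]; split => //;
    apply: contrapT => k; apply: h.
- move=> A hA.
  have /choice[A' hA'] : forall n, exists A', H A' /\
      exists N, [/\ G N, P N = 0%E & A n `+` A' `<=` N].
    by move=> n; have [A' HA' hN] := hA n; exists A'.
  have /choice[N hN] : forall n, exists N, [/\ G N, P N = 0%E & A n `+` A' n `<=` N].
    by move=> n; have [_] := hA' n.
  exists (\bigcup_n A' n).
    by case: sH => _ _; apply => n; have [] := hA' n.
  exists (\bigcup_n N n); split.
  + by case: sG => _ _; apply => n; have [] := hN n.
  + apply: measure_negligible.
      by apply: bigcupT_measurable => n; apply: Gm; have [] := hN n.
    apply: negligible_bigcup => n; have [GN N0 _] := hN n.
    by exists (N n); split => //; exact: Gm.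
  + move=> w [[[n _ Anw] nA']|[[n _ A'nw] nA]]; exists n => //;
      have [_ _] := hN n; apply; [left|right]; split => // h; [apply: nA'|apply: nA];
      by exists n.
Qed.

End augmentation.

Section gaussian_indep_theory.
Local Open Scope ereal_scope.
Context {R : realType} {d : measure_display} {Omega : measurableType d}.
Variable P : probability Omega R.
Local Notation gamma := (@normal_prob R 0 1).

Lemma measurable_integral_gamma d' (T : measurableType d') (f : T * R -> \bar R) :
  measurable_fun setT f -> (forall p, 0 <= f p) ->
  measurable_fun setT (fun x => \int[gamma]_z f (x, z)).
Proof.
exact: (@measurable_fun_fubini_tonelli_F _ _ T (measurableTypeR R) R gamma f).
Qed.

Lemma gaussian_indepZ (G : set_system Omega) (X : Omega -> R) (c s : R) :
  gaussian_indep P G X s -> gaussian_indep P G (fun w => c * X w)%R (c * s)%R.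
Proof.
move=> [mX XG]; split; first exact: measurable_funM.
move=> A C GA mC.
have mC' : measurable ((fun x => c * x)%R @^-1` C).
  by rewrite -[X in measurable X]setTI; exact: mulrl_measurable.
rewrite [LHS](XG _ _ GA mC'); congr (_ * gamma _).
by apply/seteqP; split => z /=; rewrite mulrA.
Qed.

Lemma ge0_integral_gaussian (G : set_system Omega) (X : Omega -> R) (s : R)
  (f : R -> \bar R) : sigma_algebra setT G -> gaussian_indep P G X s ->
  measurable_fun setT f -> (forall x, 0 <= f x) ->
  \int[P]_w f (X w) = \int[gamma]_z f (s * z)%R.
Proof.
move=> sG [mX XG] mf f0.
have ms : measurable_fun setT ((fun z => s * z)%R : measurableTypeR R -> measurableTypeR R).
  exact: mulrl_measurable.
have -> : \int[P]_w f (X w) =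
    \int[pushforward P (X : Omega -> measurableTypeR R)]_x f x.
  by rewrite (@ge0_integral_pushforward _ _ _ (measurableTypeR R) R X mX P setT f).
have -> : \int[gamma]_z f (s * z)%R =
    \int[pushforward gamma ((fun z => s * z)%R : measurableTypeR R -> measurableTypeR R)]_x f x.
  by rewrite (@ge0_integral_pushforward _ _ _ _ _ _ ms gamma setT f).
apply: eq_measure_integral => A mA _ /=.
rewrite /pushforward/=.
have [_ /(_ setT A)] := conj mX XG; rewrite setTI probability_setT mul1e; apply => //.
by case: sG => G0 /(_ _ G0); rewrite setD0.
Qed.

End gaussian_indep_theory.

Section brownian.
Local Open Scope ereal_scope.
Context {R : realType} {d : measure_display} {Omega : measurableType d}.
Variables (P : probability Omega R) (B : R -> Omega -> R).
Hypotheses (hB : standard_brownian_motion P B) (hOmega : brownian_space P B).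
Local Notation gamma := (@normal_prob R 0 1).
Local Notation Fil := (natural_filtration P B).

Lemma sigma_algebra_sigma_upto t : sigma_algebra setT (sigma_upto B t).
Proof. exact: smallest_sigma_algebra. Qed.

Lemma sub_sigma_upto s t : (s <= t)%R -> sigma_upto B s `<=` sigma_upto B t.
Proof.
move=> st; apply: sub_sigma_algebra2 => A [r /= + BA]; rewrite in_itv/= => /andP[r0 rs].
by exists r => //=; rewrite in_itv/= r0 (le_trans rs).
Qed.

Lemma sigma_upto_measurable t : (t <= 1)%R -> sigma_upto B t `<=` measurable.
Proof.
move=> t1; apply: smallest_sub => [|A [r /= + [C mC <-]]].
  split; [exact: measurable0|by move=> A mA; rewrite setTD; exact: measurableC|].
  by move=> A mA; exact: bigcupT_measurable.
rewrite in_itv/= => /andP[r0 rt]; case: hB => mB _ _ _ _.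
by apply: mB => //; rewrite r0 (le_trans rt).
Qed.

Lemma sigma_algebra_filtration t : sigma_algebra setT (Fil t).
Proof.
apply: sigma_algebra_augmentation; [exact: sigma_algebra_sigma_upto| |exact: sigma_algebra_sigma_upto].
exact: sigma_upto_measurable.
Qed.

Lemma sub_filtration s t : (s <= t)%R -> Fil s `<=` Fil t.
Proof. by move=> st A [A' /(sub_sigma_upto st)]; exists A'. Qed.

Lemma sigma_upto_filtration t : sigma_upto B t `<=` Fil t.
Proof. exact/sub_augmentation/sigma_algebra_sigma_upto. Qed.

(** By [brownian_space] the measurable sets are exactly those of [Fil 1]. *)
Lemma filtration_measurable t : (t <= 1)%R -> Fil t `<=` measurable.
Proof. by move=> t1; rewrite hOmega; exact: sub_filtration. Qed.

Lemma brownian_adapted s t : (0 <= s)%R -> (s <= t)%R -> measurable_wrt (Fil t) (B s).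
Proof.
move=> s0 st C mC; apply: sigma_upto_filtration; apply: sub_sigma_algebra.
by exists s; [rewrite /= in_itv/= s0|exists C => //; rewrite setTI].
Qed.

Lemma brownian_measurable t : (0 <= t <= 1)%R -> measurable_fun setT (B t).
Proof. by case: hB => mB _ _ _ _; exact: mB. Qed.

(** Changing an event by a null set does not change probabilities, so independence passes from
    [sigma_upto B s] to its augmentation. The case s = t is included, with scale 0, so that
    subdivisions may have repeated points. *)
Lemma brownian_increment s t : (0 <= s)%R -> (s <= t)%R -> (t <= 1)%R ->
  gaussian_indep P (Fil s) (fun w => B t w - B s w)%R (Num.sqrt (t - s)).
Proof.
move=> s0; rewrite le_eqVlt => /predU1P[<- s1|st t1]; last first.
  case: hB => mB _ _ nB iB.
  have [mX lX] := nB _ _ s0 st t1; split => // A C [A' HA' [N [GN PN AN]]] mC.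
  have st' : (0 < Num.sqrt (t - s))%R by rewrite sqrtr_gt0 subr_gt0.
  rewrite -normal_prob_scale// -lX//.
  have s1 : (s <= 1)%R by rewrite (le_trans (ltW st)).
  have mXC : measurable ((fun w => B t w - B s w)%R @^-1` C).
    by rewrite -[X in measurable X]setTI; exact: mX.
  have mA' := sigma_upto_measurable s1 HA'.
  have mN : measurable N by apply: (sigma_upto_measurable (lexx 1%R)).
  have mA : measurable A.
    by apply: (filtration_measurable s1); exists A' => //; exists N.
  rewrite (eq_measure_mod_null mA mA' mN mXC PN AN) setIC (iB s t)// muleC.
  congr (_ * _); symmetry.
  by have := eq_measure_mod_null mA mA' mN measurableT PN AN; rewrite !setIT.
have mXC : measurable_fun setT (fun w => B s w - B s w)%R.
  by apply: measurable_funB; apply: brownian_measurable; rewrite s0.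
split => // A C FA mC; have mA := filtration_measurable s1 FA.
have -> : (fun w => B s w - B s w)%R = cst 0%R by apply/funext => w; rewrite subrr.
have -> : (fun z => Num.sqrt (s - s) * z)%R = cst 0%R.
  by apply/funext => z; rewrite subrr sqrtr0 mul0r.
rewrite !preimage_cst; case: ifPn => _; last by rewrite setI0 !measure0 mule0.
by rewrite setIT [X in _ * X](@probability_setT _ _ _ gamma) mule1.
Qed.

(* The convolution identity is read off the decomposition of an increment of B
   as a sum of two independent increments. *)
Let gamma_convolution1 (a b : R) (f : R -> \bar R) :
  (0 <= a)%R -> (0 <= b)%R -> (a ^+ 2 + b ^+ 2 = 1)%R ->
  measurable_fun setT f -> (forall x, 0 <= f x) ->
  \int[gamma]_x \int[gamma]_z f (a * x + b * z)%R = \int[gamma]_z f z.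
Proof.
move=> a0 b0 ab1 mf f0.
have c01 : (0 <= a ^+ 2 <= 1)%R by rewrite sqr_ge0 -ab1 lerDl sqr_ge0.
case/andP: (c01) => c0 c1.
have sa : Num.sqrt (a ^+ 2 - 0) = a by rewrite subr0 sqrtr_sqr ger0_norm.
have sb : Num.sqrt (1 - a ^+ 2) = b.
  by rewrite -ab1 addrC addKr sqrtr_sqr ger0_norm.
have := brownian_increment (lexx 0%R) c0 c1; rewrite sa => B1.
have := brownian_increment c0 c1 (lexx 1%R); rewrite sb => B2.
have := brownian_increment (lexx 0%R) ler01 (lexx 1%R); rewrite subr0 sqrtr1 => B3.
have sF t := sigma_algebra_filtration t.
have mD : measurable_fun setT (fun p : R * R => f (a * p.1 + b * p.2)%R).
  by apply: measurableT_comp => //; apply: measurable_funD; apply: measurable_funM.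
transitivity (\int[gamma]_z f (1 * z)%R); last first.
  by apply: eq_integral => z _; rewrite mul1r.
rewrite -(ge0_integral_gaussian (sF _) B3 mf f0).
pose D1 w := (B (a ^+ 2) w - B 0 w)%R.
pose D2 w := (B 1 w - B (a ^+ 2) w)%R.
transitivity (\int[P]_w f (D1 w + D2 w)%R); last first.
  by apply: eq_integral => w _; rewrite /D1 /D2 addrC subrKA.
have mD1 : measurable_fun setT (D1 : g_sigma_algebraType (Fil (a ^+ 2)) -> R).
  apply: measurable_funB; apply/(measurable_wrtP (sF _)).
  - exact: brownian_adapted.
  - exact: brownian_adapted.
have mf2 : measurable_fun setT
    (fun p : g_sigma_algebraType (Fil (a ^+ 2)) * R => f (D1 p.1 + p.2)%R).
  by apply: measurableT_comp => //; apply: measurable_funD => //; exact: measurableT_comp.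
rewrite [RHS](ge0_integral_gaussian_indep (sF _) (filtration_measurable c1) B2 mf2)//.
pose k x := \int[gamma]_z f (x + b * z)%R.
rewrite -[LHS](@ge0_integral_gaussian _ _ _ _ _ _ _ k (sF _) B1)//.
- apply: (@measurable_integral_gamma _ _ _ (fun p : R * R => f (p.1 + b * p.2)%R)) => //.
  by apply: measurableT_comp => //; apply: measurable_funD => //; exact: measurable_funM.
- by move=> x; exact: integral_ge0.
Qed.

(** Dividing a and b by r reduces to a^2 + b^2 = 1; if r = 0, both sides are f(0). *)
Lemma gamma_convolution (a b : R) (f : R -> \bar R) :
  (0 <= a)%R -> (0 <= b)%R -> measurable_fun setT f -> (forall x, 0 <= f x) ->
  \int[gamma]_x \int[gamma]_z f (a * x + b * z)%R =
  \int[gamma]_z f (Num.sqrt (a ^+ 2 + b ^+ 2) * z)%R.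
Proof.
move=> a0 b0 mf f0; set r := Num.sqrt _.
have r2 : (r ^+ 2 = a ^+ 2 + b ^+ 2)%R by rewrite sqr_sqrtr// addr_ge0 ?sqr_ge0.
have : (0 <= r)%R by exact: sqrtr_ge0.
rewrite le_eqVlt => /predU1P[r0|r0].
  have : (a ^+ 2 + b ^+ 2 == 0)%R by rewrite -r2 -r0 expr0n.
  rewrite paddr_eq0 ?sqr_ge0// !sqrf_eq0 => /andP[/eqP -> /eqP ->].
  rewrite -r0; under eq_integral do under eq_integral do rewrite !mul0r addr0.
  under [RHS]eq_integral do rewrite mul0r.
  by rewrite !integral_gamma_cst.
have rN0 : r != 0%R by rewrite gt_eqF.
rewrite -(@gamma_convolution1 (a / r) (b / r) (fun x => f (r * x)%R)); last first.
- by move=> x; exact: f0.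
- by apply: measurableT_comp => //; exact: mulrl_measurable.
- by rewrite !expr_div_n -mulrDl -r2 divff// expf_neq0.
- by rewrite divr_ge0// ltW.
- by rewrite divr_ge0// ltW.
apply: eq_integral => x _; apply: eq_integral => z _; congr (f _).
by field.
Qed.

(** Freezing twice: given [H], the event and [X] are fixed and [Y] is integrated out; given [G], the
    same is done to [X]. What remains is the convolution of two centred Gaussian laws. *)
Lemma gaussian_indepD (G H : set_system Omega) (X Y : Omega -> R) (a b : R) :
  sigma_algebra setT G -> sigma_algebra setT H -> H `<=` measurable ->
  G `<=` H -> (0 <= a)%R -> (0 <= b)%R ->
  gaussian_indep P G X a -> measurable_wrt H X -> gaussian_indep P H Y b ->
  gaussian_indep P G (fun w => X w + Y w)%R (Num.sqrt (a ^+ 2 + b ^+ 2)).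
Proof.
move=> sG sH Hm GH a0 b0 GX HX HY.
have mX : measurable_fun setT X by case: GX.
have mY : measurable_fun setT Y by case: HY.
have Gm : G `<=` measurable by exact: subset_trans Hm.
split; first exact: measurable_funD.
move=> A C GA mC.
have mA : measurable A by exact: Gm.
have mXYC : measurable ((fun w => X w + Y w)%R @^-1` C).
  by rewrite -[X in measurable X]setTI; exact: measurable_funD.
have mI : measurable_fun setT (fun x : R => (\1_C x : R)%:E).
  by apply/measurable_EFinP; exact: measurable_indic.
have mA' (K : set_system Omega) : sigma_algebra setT K -> K A ->
   measurable_fun setT ((fun w => (\1_A w : R)) : g_sigma_algebraType K -> R).
  move=> sK KA; apply: measurable_indic; rewrite /measurable/=.
  exact: sub_sigma_algebra.
transitivity (\int[P]_w ((\1_A w : R)%:E * (\1_C (X w + Y w) : R)%:E)).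
  rewrite -[X in P X]setIT -integral_indic//; last exact: measurableI.
  by apply: eq_integral => w _; rewrite indicI /= EFinM.
rewrite [LHS](@ge0_integral_gaussian_indep _ _ _ _ _ sH Hm _ _ HY
  (fun p => (\1_A p.1 : R)%:E * (\1_C (X p.1 + p.2)%R : R)%:E)); last 2 first.
- apply: emeasurable_funM.
    apply/measurable_EFinP; apply: measurableT_comp => //; apply: mA' => //; exact: GH.
  apply: (measurableT_comp mI); apply: measurable_funD => //.
  by apply: measurableT_comp => //; exact/(measurable_wrtP sH).
- by move=> p; rewrite mule_ge0 ?lee_fin.
pose k x := \int[gamma]_z (\1_C (x + b * z)%R : R)%:E.
have mk : measurable_fun setT k.
  apply: (@measurable_integral_gamma _ _ _
    (fun p : R * R => (\1_C (p.1 + b * p.2)%R : R)%:E)) => //.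
  by apply: (measurableT_comp mI); apply: measurable_funD => //; exact: measurable_funM.
have k0 x : 0 <= k x by apply: integral_ge0 => z _; rewrite lee_fin.
transitivity (\int[P]_w ((\1_A w : R)%:E * k (X w))).
  apply: eq_integral => w _; rewrite -ge0_integralZl//.
  by apply: (measurableT_comp mI); apply: measurable_funD => //; exact: measurable_funM.
rewrite [LHS](@ge0_integral_gaussian_indep _ _ _ _ _ sG Gm _ _ GX
  (fun p => (\1_A p.1 : R)%:E * k p.2)); last 2 first.
- apply: emeasurable_funM; last exact: measurableT_comp.
  by apply/measurable_EFinP; apply: measurableT_comp => //; exact: mA'.
- by move=> p; rewrite mule_ge0 ?lee_fin.
under eq_integral.
  move=> w _ /=; rewrite (@ge0_integralZl _ _ _ gamma _ _ (fun z => k (a * z)%R))//; last first.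
    by apply: measurableT_comp => //; exact: mulrl_measurable.
  rewrite /k (@gamma_convolution a b (fun x => (\1_C x : R)%:E))//.
  over.
set c := \int[gamma]_z _.
rewrite ge0_integralZr//; last 2 first.
- by apply/measurable_EFinP; exact: measurable_indic.
- by apply: integral_ge0 => z _; rewrite lee_fin.
rewrite integral_indic// setIT; congr (_ * _).
transitivity (\int[gamma]_z (\1_((fun z => Num.sqrt (a ^+ 2 + b ^+ 2) * z)%R @^-1` C) z : R)%:E).
  by apply: eq_integral.
rewrite integral_indic ?setIT//.
by rewrite -[X in measurable X]setTI; exact: mulrl_measurable.
Qed.

End brownian.

(** * Square integrable random variables *)

Lemma sqrD_le (R : realDomainType) (x y : R) :
  (x + y) ^+ 2 <= 2 * x ^+ 2 + 2 * y ^+ 2.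
Proof.
rewrite -subr_ge0 (_ : _ - _ = (x - y) ^+ 2) ?sqr_ge0//; ring.
Qed.

Section has_integral.
Local Open Scope ereal_scope.
Context {R : realType} {d : measure_display} {T : measurableType d}.
Variables (mu : {measure set T -> \bar R}) (D : set T).
Hypothesis mD : measurable D.

(** Pairing integrability with the value lets expectations of polynomial expressions be computed by
    structural rules, without separate finiteness checks. *)
Definition has_integral (f : T -> R) (r : R) : Prop :=
  mu.-integrable D (EFin \o f) /\ \int[mu]_(x in D) (f x)%:E = r%:E.

Lemma integrable_has_integral (f : T -> R) : mu.-integrable D (EFin \o f) ->
  has_integral f (fine (\int[mu]_(x in D) (f x)%:E)).
Proof. by move=> fi; split=> //; rewrite fineK//; exact: integrable_fin_num. Qed.

Lemma eq_has_integral (f g : T -> R) r : f =1 g -> has_integral f r -> has_integral g r.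
Proof. by move=> /funext ->. Qed.

Lemma has_integralD (f g : T -> R) r s : has_integral f r -> has_integral g s ->
  has_integral (fun x => f x + g x)%R (r + s).
Proof.
move=> [fi fr] [gi gs]; split; first exact: (integrableD mD fi gi).
by rewrite EFinD -fr -gs -integralD_EFin.
Qed.

Lemma has_integralZ (f : T -> R) (c r : R) : has_integral f r ->
  has_integral (fun x => c * f x)%R (c * r).
Proof.
move=> [fi fr]; split; first exact: (integrableZl mD c fi).
by rewrite EFinM -fr -integralZl.
Qed.

Lemma has_integral0 : has_integral (fun=> 0%R) 0.
Proof. by split; [exact: integrable0|rewrite integral0]. Qed.

Lemma has_integral_sum (I : finType) (f : I -> T -> R) (r : I -> R) :
  (forall i, has_integral (f i) (r i)) ->
  has_integral (fun x => \sum_i f i x)%R (\sum_i r i)%R.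
Proof.
move=> fr; rewrite -[index_enum I]/(index_enum I).
elim: (index_enum I) => [|i s ih].
  rewrite big_nil; apply: eq_has_integral has_integral0 => x; by rewrite big_nil.
rewrite big_cons; apply: (eq_has_integral _ (has_integralD (fr i) ih)) => x.
by rewrite big_cons.
Qed.

End has_integral.

Section square_integrable.
Local Open Scope ereal_scope.
Context {R : realType} {d : measure_display} {T : measurableType d}.
Variable P : probability T R.

Definition square_integrable (X : T -> R) : Prop :=
  measurable_fun setT X /\ \int[P]_w ((X w) ^+ 2)%:E < +oo.

Lemma square_integrable_sqr X : square_integrable X ->
  P.-integrable setT (fun w => ((X w) ^+ 2)%:E).
Proof.
move=> [mX X2]; apply/integrableP; split.
  by apply/measurable_EFinP; exact: measurable_funX.
by under eq_integral do rewrite gee0_abs ?lee_fin ?sqr_ge0//.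
Qed.

Lemma square_integrableM X Y : square_integrable X -> square_integrable Y ->
  P.-integrable setT (fun w => (X w * Y w)%:E).
Proof.
move=> sX sY.
have := integrableD measurableT (square_integrable_sqr sX) (square_integrable_sqr sY).
apply: le_integrable => //.
  by apply/measurable_EFinP; apply: measurable_funM; [case: sX|case: sY].
move=> w _; rewrite /= lee_fin.
rewrite [leRHS]ger0_norm ?addr_ge0 ?sqr_ge0//.
by rewrite ler_norml; apply/andP; split; nra.
Qed.

Lemma integral_sqrD_le (f g : T -> R) : measurable_fun setT f -> measurable_fun setT g ->
  \int[P]_w ((f w + g w) ^+ 2)%:E <=
  2%:E * \int[P]_w ((f w) ^+ 2)%:E + 2%:E * \int[P]_w ((g w) ^+ 2)%:E.
Proof.
move=> mf mg.
have sqm (h : T -> R) : measurable_fun setT h ->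
    measurable_fun setT (fun w => ((h w) ^+ 2)%R%:E : \bar R).
  by move=> mh; apply/measurable_EFinP; exact: measurable_funX.
rewrite -!ge0_integralZl//; last 4 first.
- exact: sqm.
- by move=> w _; rewrite lee_fin sqr_ge0.
- exact: sqm.
- by move=> w _; rewrite lee_fin sqr_ge0.
rewrite -ge0_integralD//; last 4 first.
- by move=> w _; rewrite mule_ge0 ?lee_fin ?sqr_ge0.
- by apply: emeasurable_funM => //; exact: sqm.
- by move=> w _; rewrite mule_ge0 ?lee_fin ?sqr_ge0.
- by apply: emeasurable_funM => //; exact: sqm.
apply: ge0_le_integral_nomeas => w _; first by rewrite lee_fin sqr_ge0.
by rewrite -!EFinM -EFinD lee_fin sqrD_le.
Qed.

Lemma square_integrableD X Y : square_integrable X -> square_integrable Y ->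
  square_integrable (fun w => X w + Y w)%R.
Proof.
move=> sX sY; have [mX _] := sX; have [mY _] := sY.
split; first exact: measurable_funD.
apply: le_lt_trans (integral_sqrD_le mX mY) _.
by rewrite lte_add_pinfty// lte_mul_pinfty//; [case: sX|case: sY].
Qed.

Lemma square_integrableZ (c : R) X : square_integrable X ->
  square_integrable (fun w => c * X w)%R.
Proof.
move=> sX; have [mX _] := sX; split; first exact: measurable_funM.
under eq_integral do rewrite exprMn.
apply: integrable_lty => //.
exact: (integrableZl measurableT (c ^+ 2) (square_integrable_sqr sX)).
Qed.

Lemma bounded_square_integrable (X : T -> R) (M : R) : measurable_fun setT X ->
  (forall w, `|X w| <= M)%R -> square_integrable X.
Proof.
move=> mX XM; split => //.
apply: (@le_lt_trans _ _ (\int[P]_w (M ^+ 2)%:E)).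
  apply: ge0_le_integral_nomeas => w _; first by rewrite lee_fin sqr_ge0.
  rewrite lee_fin -[leLHS]real_normK ?num_real// ler_sqr ?nnegrE//.
  exact: le_trans (XM w).
apply: integrable_lty => //; exact: finite_measure_integrable_cst.
Qed.

Lemma square_integrable_sum (I : finType) (p : pred I) (X : I -> T -> R) :
  (forall i, p i -> square_integrable (X i)) ->
  square_integrable (fun w => \sum_(i | p i) X i w)%R.
Proof.
move=> sX; elim: (index_enum I) => [|i s ih].
  rewrite (_ : (fun w => _) = cst 0%R); last by apply/funext => w; rewrite big_nil.
  by apply: (@bounded_square_integrable _ 0%R) => // w; rewrite normr0.
rewrite (_ : (fun w => _) = (fun w => (if p i then X i w else 0) + \sum_(j <- s | p j) X j w)%R).
  apply: square_integrableD => //; case: (boolP (p i)) => [/sX//|_].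
  by apply: (@bounded_square_integrable _ 0%R) => // w; rewrite normr0.
by apply/funext => w; rewrite big_cons; case: ifPn => // _; rewrite add0r.
Qed.

Lemma square_integrable_has_integralM X Y : square_integrable X -> square_integrable Y ->
  has_integral P setT (fun w => X w * Y w)%R (fine (\int[P]_w (X w * Y w)%:E)).
Proof. by move=> sX sY; apply: integrable_has_integral => //; exact: square_integrableM. Qed.

End square_integrable.

Section gaussian_moments.
Local Open Scope ereal_scope.
Context {R : realType} {d : measure_display} {T : measurableType d}.
Variables (P : probability T R) (G : set_system T).
Hypotheses (sG : sigma_algebra setT G) (Gm : G `<=` measurable).
Variables (X : T -> R) (s : R).
Hypothesis XG : gaussian_indep P G X s.
Local Notation gamma := (@normal_prob R 0 1).

Lemma has_integral_gaussianM (xi : T -> R) r : measurable_wrt G xi ->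
  has_integral P setT xi r -> has_integral P setT (fun w => xi w * X w)%R 0.
Proof.
move=> Gxi [ixi rE].
have i1 : gamma.-integrable setT (fun z => (s * z)%R%:E).
  exact: (integrableZl measurableT s gamma_id_integrable).
have [i2 E2] := integral_gaussian_indepM sG Gm XG Gxi ixi (@measurable_id _ _ setT) i1.
split => //; rewrite [LHS]E2.
under [X in _ * X]eq_integral do rewrite EFinM.
by rewrite integralZl//; [rewrite normal_mean !mule0|exact: gamma_id_integrable].
Qed.

Lemma has_integral_gaussian_sqrM (xi : T -> R) r : measurable_wrt G xi ->
  has_integral P setT xi r -> has_integral P setT (fun w => xi w * X w ^+ 2)%R (r * s ^+ 2).
Proof.
move=> Gxi [ixi rE].
have i1 : gamma.-integrable setT (fun z => ((s * z) ^+ 2)%R%:E).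
  under [X in _.-integrable _ X]eq_fun do rewrite exprMn.
  exact: (integrableZl measurableT (s ^+ 2) gamma_sqr_integrable).
have [i2 E2] := integral_gaussian_indepM sG Gm XG Gxi ixi (@exprn_measurable _ setT 2) i1.
split => //; rewrite [LHS]E2.
under [X in _ * X]eq_integral do rewrite exprMn EFinM.
rewrite integralZl//; last exact: gamma_sqr_integrable.
by rewrite normal_sqr mule1 rE -EFinM.
Qed.

(** Independence makes the second moment factor, so [xi] may be unbounded. This admits coefficients
    such as [u delta delta] times earlier increments. *)
Lemma square_integrable_gaussianM (xi : T -> R) : measurable_wrt G xi ->
  square_integrable P xi -> square_integrable P (fun w => xi w * X w)%R.
Proof.
move=> Gxi sxi; have [mX _] := XG; have [mxi _] := sxi.
split; first exact: measurable_funM.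
have Gxi2 : measurable_wrt G (fun w => xi w ^+ 2)%R.
  by apply/(measurable_wrtP sG)/measurable_funX/(measurable_wrtP sG).
have h := integrable_has_integral measurableT (square_integrable_sqr sxi).
have [h1 _] := has_integral_gaussian_sqrM Gxi2 h.
by under eq_integral do rewrite exprMn; exact: integrable_lty h1.
Qed.

End gaussian_moments.

(** * The Ito isometry *)

Section measurable_wrt_theory.
Context {R : realType} {d : measure_display} {Omega : measurableType d}.
Variables (G : set_system Omega) (sG : sigma_algebra setT G).
Implicit Types X Y : Omega -> R.

Lemma measurable_wrtM X Y : measurable_wrt G X -> measurable_wrt G Y ->
  measurable_wrt G (fun w => X w * Y w).
Proof.
by move=> /(measurable_wrtP sG) mX /(measurable_wrtP sG) mY;
  apply/(measurable_wrtP sG)/measurable_funM.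
Qed.

Lemma measurable_wrtB X Y : measurable_wrt G X -> measurable_wrt G Y ->
  measurable_wrt G (fun w => X w - Y w).
Proof.
by move=> /(measurable_wrtP sG) mX /(measurable_wrtP sG) mY;
  apply/(measurable_wrtP sG)/measurable_funB.
Qed.

Lemma measurable_wrtZ (c : R) X : measurable_wrt G X ->
  measurable_wrt G (fun w => c * X w).
Proof.
by move=> /(measurable_wrtP sG) mX; apply/(measurable_wrtP sG)/measurable_funM.
Qed.

Lemma measurable_wrt_sum (I : finType) (p : pred I) (X : I -> Omega -> R) :
  (forall i, p i -> measurable_wrt G (X i)) ->
  measurable_wrt G (fun w => \sum_(i | p i) X i w).
Proof.
move=> mX; apply/(measurable_wrtP sG).
rewrite (_ : (fun w => _) = (fun w => \sum_i (if p i then X i w else 0))).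
  apply: measurable_sum => i; case: (boolP (p i)) => [pi|_].
    exact/(measurable_wrtP sG)/mX.
  exact: measurable_cst.
by apply/funext => w; rewrite big_mkcond.
Qed.

End measurable_wrt_theory.

Section elementary_isometry.
Local Open Scope ereal_scope.
Context {R : realType} {d : measure_display} {Omega : measurableType d}.
Variables (P : probability Omega R) (B : R -> Omega -> R).
Hypotheses (hB : standard_brownian_motion P B) (hOmega : brownian_space P B).
Local Notation Fil := (natural_filtration P B).
Local Notation mu := (@lebesgue_measure R).

(** The length of the intersection of ]a, b] and ]a', b']. *)
Definition overlap (a b a' b' : R) : R :=
  (Num.max 0 (Num.min b b' - Num.max a a'))%R.

Lemma overlapC a b a' b' : overlap a b a' b' = overlap a' b' a b.
Proof. by rewrite /overlap (minC b) (maxC a). Qed.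

Let sF t := sigma_algebra_filtration hB t.

Let mF t (t1 : (t <= 1)%R) := filtration_measurable hOmega t1.

Let incr_filtration (s t u : R) : (0 <= s)%R -> (s <= t)%R -> (t <= u)%R ->
  measurable_wrt (Fil u) (fun w => B t w - B s w)%R.
Proof.
move=> s0 st tu; apply: (measurable_wrtB (sF u)); apply: brownian_adapted => //.
- exact: le_trans st.
- exact: le_trans st tu.
Qed.

Let wrtS (s t : R) (X : Omega -> R) : (s <= t)%R -> measurable_wrt (Fil s) X -> measurable_wrt (Fil t) X.
Proof. by move=> st mX C /mX; exact: sub_filtration. Qed.

Lemma square_integrable_increment (s t : R) (xi : Omega -> R) :
  (0 <= s)%R -> (s <= t)%R -> (t <= 1)%R -> measurable_wrt (Fil s) xi ->
  square_integrable P xi ->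
  square_integrable P (fun w => xi w * (B t w - B s w))%R.
Proof.
move=> s0 st t1.
exact: (square_integrable_gaussianM (sF s) (mF (le_trans st t1))
  (brownian_increment hB hOmega s0 st t1)).
Qed.

Let incr0 (s t : R) (X : Omega -> R) : (0 <= s)%R -> (s <= t)%R -> (t <= 1)%R ->
  measurable_wrt (Fil s) X -> P.-integrable setT (EFin \o X) ->
  has_integral P setT (fun w => X w * (B t w - B s w))%R 0.
Proof.
move=> s0 st t1 FX iX.
exact: (has_integral_gaussianM (sF s) (mF (le_trans st t1))
  (brownian_increment hB hOmega s0 st t1) FX (integrable_has_integral measurableT iX)).
Qed.

Let incr_sqr (s t : R) (X : Omega -> R) e : (0 <= s)%R -> (s <= t)%R -> (t <= 1)%R ->
  measurable_wrt (Fil s) X -> has_integral P setT X e ->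
  has_integral P setT (fun w => X w * (B t w - B s w) ^+ 2)%R (e * (t - s)).
Proof.
move=> s0 st t1 FX iX.
have := has_integral_gaussian_sqrM (sF s) (mF (le_trans st t1))
  (brownian_increment hB hOmega s0 st t1) FX iX.
by rewrite sqr_sqrtr// subr_ge0.
Qed.

(** If the intervals do not overlap, the later increment is centred given everything else. Otherwise
    both are cut at a' and at m = min b b': the square over ]a', m] yields e (m - a'), and each
    other product either ends with an increment centred given its other factors or vanishes
    identically. *)
Let has_integral_increments_le (a b a' b' e : R) (xi xi' : Omega -> R) :
  (0 <= a)%R -> (a <= b)%R -> (b <= 1)%R -> (a' <= b')%R -> (b' <= 1)%R ->
  (a <= a')%R ->
  measurable_wrt (Fil a) xi -> measurable_wrt (Fil a') xi' ->
  square_integrable P xi -> square_integrable P xi' ->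
  has_integral P setT (fun w => xi w * xi' w)%R e ->
  has_integral P setT (fun w => (xi w * (B b w - B a w)) * (xi' w * (B b' w - B a' w)))%R
    (e * overlap a b a' b').
Proof.
move=> a0 ab b1 ab' b1' aa' Fxi Fxi' sxi sxi' hE.
have a0' : (0 <= a')%R by exact: le_trans aa'.
have a1' : (a' <= 1)%R by exact: le_trans b1'.
have [ba'|a'b] := leP b a'.
  have -> : (e * overlap a b a' b' = 0)%R.
    rewrite /overlap; apply/eqP; rewrite mulf_eq0; apply/orP; right.
    apply/eqP/max_idPl; rewrite subr_le0 (max_idPr aa').
    by rewrite ge_min ba'.
  apply: (eq_has_integral (f := fun w => (xi w * (B b w - B a w)) * xi' w * (B b' w - B a' w))%R).
    by move=> w; rewrite !mulrA.
  apply: incr0 => //.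
  - apply: (measurable_wrtM (sF _)) => //; apply: (measurable_wrtM (sF _)).
      exact: wrtS Fxi.
    exact: incr_filtration.
  - apply: square_integrableM => //.
    exact: square_integrable_increment.
set m := (Num.min b b')%R.
have a'm : (a' <= m)%R by rewrite /m le_min ab' ltW.
have mb : (m <= b)%R by rewrite /m ge_min lexx.
have mb' : (m <= b')%R by rewrite /m ge_min lexx orbT.
have m1 : (m <= 1)%R by exact: le_trans b1.
have m0 : (0 <= m)%R by exact: le_trans a'm.
have Fxia' := wrtS aa' Fxi.
have Fm t : (a' <= t)%R -> measurable_wrt (Fil t) (fun w => xi w * xi' w)%R.
  by move=> at_; apply: (measurable_wrtM (sF _)); apply: wrtS at_ _.
have ov : overlap a b a' b' = (m - a')%R.
  by rewrite /overlap (max_idPr aa'); apply/max_idPr; rewrite subr_ge0.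
have h1 : has_integral P setT (fun w => (xi w * (B a' w - B a w)) * xi' w * (B b' w - B a' w))%R 0.
  apply: incr0 => //.
  - apply: (measurable_wrtM (sF _)) => //; apply: (measurable_wrtM (sF _)) => //.
    exact: incr_filtration.
  - apply: square_integrableM => //.
    exact: square_integrable_increment.
have h2 : has_integral P setT (fun w => (xi w * xi' w) * (B m w - B a' w) ^+ 2)%R (e * (m - a')).
  by apply: incr_sqr => //; exact: Fm.
have Fxm : measurable_wrt (Fil m) (fun w => xi' w * (B m w - B a' w) * xi w)%R.
  apply: (measurable_wrtM (sF _)); last by apply: wrtS Fxi; exact: le_trans a'm.
  by apply: (measurable_wrtM (sF _)); [exact: wrtS Fxi'|exact: incr_filtration].
have ixm : P.-integrable setT (EFin \o (fun w => xi' w * (B m w - B a' w) * xi w)%R).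
  by apply: square_integrableM => //; exact: square_integrable_increment.
have h3 := incr0 m0 mb' b1' Fxm ixm.
have h4 := incr0 m0 mb b1 Fxm ixm.
rewrite ov (_ : (e * (m - a') = 0 + e * (m - a') + 0 + 0)%R); last by rewrite add0r !addr0.
apply: eq_has_integral (has_integralD _ (has_integralD _ (has_integralD _ h1 h2) h3) h4) => //.
move=> w.
(* As m is b or b', one of the two leftover increments is zero. *)
have mE : ((B b w - B m w) * (B b' w - B m w) = 0)%R.
  by rewrite /m minEle; case: ifPn => _; rewrite subrr ?mul0r ?mulr0.
rewrite -[RHS]subr0 -(mulr0 (xi w * xi' w)%R) -mE; ring.
Qed.

Lemma has_integral_increments (a b a' b' e : R) (xi xi' : Omega -> R) :
  (0 <= a)%R -> (a <= b)%R -> (b <= 1)%R ->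
  (0 <= a')%R -> (a' <= b')%R -> (b' <= 1)%R ->
  measurable_wrt (Fil a) xi -> measurable_wrt (Fil a') xi' ->
  square_integrable P xi -> square_integrable P xi' ->
  has_integral P setT (fun w => xi w * xi' w)%R e ->
  has_integral P setT (fun w => (xi w * (B b w - B a w)) * (xi' w * (B b' w - B a' w)))%R
    (e * overlap a b a' b').
Proof.
move=> a0 ab b1 a0' ab' b1' Fxi Fxi' sxi sxi' hE.
have [aa'|/ltW a'a] := leP a a'; first exact: has_integral_increments_le.
rewrite overlapC.
apply: (eq_has_integral (f := (fun w => (xi' w * (B b' w - B a' w)) * (xi w * (B b w - B a w)))%R)).
  by move=> w; rewrite mulrC.
apply: has_integral_increments_le => //.
by apply: eq_has_integral hE => w; rewrite mulrC.
Qed.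

Lemma has_integral_overlap (a b a' b' : R) :
  (0 <= a)%R -> (b <= 1)%R -> (0 <= a')%R -> (b' <= 1)%R ->
  has_integral mu `[0%R, 1%R] (fun s => \1_`]a, b] s * \1_`]a', b'] s)%R (overlap a b a' b').
Proof.
move=> a0 b1 a0' b1'.
have E : `]a, b] `&` `]a', b'] = `](Num.max a a'), (Num.min b b')]%classic :> set R.
  apply/seteqP; split => s /=; rewrite !in_itv/= gt_max le_min.
    by move=> [/andP[-> ->] /andP[-> ->]].
  by move=> /andP[/andP[-> ->] /andP[-> ->]].
rewrite (_ : (fun s => _) = \1_(`](Num.max a a'), (Num.min b b')] : set R)); last first.
  by apply/funext => s; rewrite -E indicI.
split.
  by apply: (integrableS measurableT) => //; exact: integrable_indic_itv.
rewrite integral_indic// setIidl; last first.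
  move=> s /=; rewrite !in_itv/= => /andP[]; rewrite gt_max le_min.
  move=> /andP[h1 h2] /andP[h3 h4]; apply/andP; split.
    exact: le_trans (ltW h1).
  exact: le_trans h3 b1.
have := @lebesgue_measure_itv R `](Num.max a a')%R, (Num.min b b')%R].
rewrite /= lte_fin => ->; rewrite /overlap; case: ltP => h.
  by rewrite -EFinB; congr (_%:E); apply/esym/max_idPr; rewrite subr_ge0 ltW.
by congr (_%:E); apply/esym/max_idPl; rewrite subr_le0.
Qed.

Variables (I : finType) (a b : I -> R) (xi : I -> Omega -> R).
Hypotheses (a0 : forall i, (0 <= a i)%R) (ab : forall i, (a i <= b i)%R)
  (b1 : forall i, (b i <= 1)%R)
  (Fxi : forall i, measurable_wrt (Fil (a i)) (xi i))
  (sxi : forall i, square_integrable P (xi i)).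

(** Both sides expand into the same double sum of e_ij times overlaps. The intervals form an
    arbitrary finite family and may overlap, so the difference of two elementary integrals is again
    of this form, with no common refinement of subdivisions. *)
Theorem elementary_isometry :
  \int[P]_w ((\sum_i xi i w * (B (b i) w - B (a i) w)) ^+ 2)%R%:E =
  \int[mu]_(s in `[0%R, 1%R])
     \int[P]_w ((\sum_i xi i w * \1_`]a i, b i] s) ^+ 2)%R%:E.
Proof.
pose e i j := fine (\int[P]_w (xi i w * xi j w)%:E).
have he i j : has_integral P setT (fun w => xi i w * xi j w)%R (e i j).
  exact: square_integrable_has_integralM.
have [_ ->] : has_integral P setT (fun w => (\sum_i xi i w * (B (b i) w - B (a i) w)) ^+ 2)%R
    (\sum_i \sum_j e i j * overlap (a i) (b i) (a j) (b j))%R.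
  apply: (eq_has_integral (f := fun w => (\sum_i \sum_j
    (xi i w * (B (b i) w - B (a i) w)) * (xi j w * (B (b j) w - B (a j) w)))%R)).
    by move=> w; rewrite expr2 mulr_suml; under [RHS]eq_bigr do rewrite mulr_sumr.
  apply: has_integral_sum => // i; apply: has_integral_sum => // j.
  exact: has_integral_increments.
symmetry.
under eq_integral => s _.
  have [_ ->] : has_integral P setT (fun w => (\sum_i xi i w * \1_`]a i, b i] s) ^+ 2)%R
      (\sum_i \sum_j e i j * (\1_`]a i, b i] s * \1_`]a j, b j] s))%R.
    apply: (eq_has_integral (f := fun w => (\sum_i \sum_j
       (\1_`]a i, b i] s * \1_`]a j, b j] s) * (xi i w * xi j w))%R)).
      move=> w; rewrite expr2 mulr_suml; apply: eq_bigr => i _.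
      by rewrite mulr_sumr; apply: eq_bigr => j _; ring.
    apply: has_integral_sum => // i; apply: has_integral_sum => // j.
    by rewrite (mulrC (e i j)); apply: has_integralZ.
  over.
suff [_ ->] : has_integral mu `[0%R, 1%R]
   (fun s => \sum_i \sum_j e i j * (\1_`]a i, b i] s * \1_`]a j, b j] s))%R
   (\sum_i \sum_j e i j * overlap (a i) (b i) (a j) (b j))%R by [].
apply: has_integral_sum => // i; apply: has_integral_sum => // j.
by apply: has_integralZ => //; exact: has_integral_overlap.
Qed.

End elementary_isometry.

Section ereal_facts.
Local Open Scope ereal_scope.
Context {R : realType}.

Lemma cvge0_near_lt (u : nat -> \bar R) (e : R) :
  u @ \oo --> 0 -> (0 < e)%R -> \forall m \near \oo, u m < e%:E.
Proof. by move=> hu e0; apply: (hu [set x | x < e%:E]); apply: open_ereal_lt'. Qed.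

End ereal_facts.

Section measurable_section.
Local Open Scope ereal_scope.
Context {R : realType} {d1 d2 : measure_display}.
Context (T1 : measurableType d1) (T2 : measurableType d2).

(** Extension by zero off the strip over [D] makes Tonelli applicable; processes are jointly
    measurable only for times in [0, 1] or in the triangle. *)
Lemma measurable_section_integral (m2 : {sigma_finite_measure set T2 -> \bar R})
    (D : set T1) (f : T1 -> T2 -> \bar R) : measurable D ->
  measurable_fun [set p : T1 * T2 | D p.1] (fun p => f p.1 p.2) ->
  (forall x y, D x -> 0 <= f x y) ->
  measurable_fun D (fun x => \int[m2]_y f x y).
Proof.
move=> mD; set E := [set p | _] => mf f0.
have mE : measurable E.
  by rewrite (_ : E = D `*` setT); [exact: measurableX|apply/seteqP; split => // p []].
pose g := (fun p => f p.1 p.2) \_ E.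
have mg : measurable_fun setT g by exact/(measurable_restrictT _ _).1.
have g0 p : 0 <= g p by rewrite /g patchE; case: ifPn => // /[!inE]; exact: f0.
apply: (eq_measurable_fun (fun x => \int[m2]_y g (x, y))).
  move=> x /[!inE] Dx; apply: eq_integral => y _.
  by rewrite /g patchE mem_set.
by apply: measurable_funTS; exact: measurable_fun_fubini_tonelli_F.
Qed.

Lemma measurable_section d3 (T3 : measurableType d3) (D : set T1) (f : T1 -> T2 -> T3) x : measurable D ->
  measurable_fun [set p : T1 * T2 | D p.1] (fun p => f p.1 p.2) -> D x ->
  measurable_fun setT (f x).
Proof.
move=> mD mf Dx _ C mC; rewrite setTI.
have mE : measurable [set p : T1 * T2 | D p.1].
  by rewrite (_ : [set _ | _] = D `*` setT); [exact: measurableX|apply/seteqP; split => // p []].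
have := mf mE C mC.
move/(measurable_xsection x); congr measurable.
by apply/seteqP; split => y; rewrite /xsection/= ?inE/=; [move=> []|split].
Qed.

End measurable_section.

(** * Distance from an Ito integral to an elementary integral *)

Section ito_bound.
Local Open Scope ereal_scope.
Context {R : realType} {d : measure_display} {Omega : measurableType d}.
Variables (P : probability Omega R) (B : R -> Omega -> R).
Hypotheses (hB : standard_brownian_motion P B) (hOmega : brownian_space P B).
Local Notation Fil := (natural_filtration P B).
Local Notation mu := (@lebesgue_measure R).

Section simple.
Variable S : simple_process P B.

Lemma sp_time_le (i j : nat) : (i <= j)%N -> (j <= sp_size S)%N ->
  (sp_time S i <= sp_time S j)%R.
Proof.
elim: j => [|j ih]; first by rewrite leqn0 => /eqP ->.
rewrite leq_eqVlt => /predU1P[-> //|]; rewrite ltnS => ij js.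
by apply: le_trans (ih ij (ltnW js)) _; exact: sp_time_homo.
Qed.

Lemma sp_time_bounds (i : nat) : (i <= sp_size S)%N -> (0 <= sp_time S i <= 1)%R.
Proof.
move=> iS; apply/andP; split.
  exact: le_trans (sp_time_ge0 S) (sp_time_le (leq0n i) iS).
exact: le_trans (sp_time_le iS (leqnn _)) (sp_time_le1 S).
Qed.

Lemma sp_coef_square_integrable (i : 'I_(sp_size S)) :
  square_integrable P (sp_coef S i).
Proof.
have [M hM] := sp_coef_bounded (ltn_ord i).
apply: (@bounded_square_integrable _ _ _ _ _ M) => //.
have /andP[_ t1] := sp_time_bounds (ltnW (ltn_ord i)).
exact: (measurable_wrt_measurable (filtration_measurable hOmega t1)
  (sp_coef_adapted (ltn_ord i))).
Qed.

End simple.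

Variables (I : finType) (a b : I -> R) (xi : I -> Omega -> R).
Hypotheses (a0 : forall i, (0 <= a i)%R) (ab : forall i, (a i <= b i)%R)
  (b1 : forall i, (b i <= 1)%R)
  (Fxi : forall i, measurable_wrt (Fil (a i)) (xi i))
  (sxi : forall i, square_integrable P (xi i)).

Let val s w := (\sum_i xi i w * \1_`]a i, b i] s)%R.
Let int w := (\sum_i xi i w * (B (b i) w - B (a i) w))%R.

(** The difference is one elementary integral indexed by the disjoint union of the two index sets,
    with the second family of coefficients negated. *)
Lemma simple_isometry (S : simple_process P B) :
  \int[P]_w ((simple_integral S w - int w) ^+ 2)%:E =
  \int[mu]_(s in `[0%R, 1%R]) \int[P]_w ((simple_value S s w - val s w) ^+ 2)%:E.
Proof.
pose a' (x : 'I_(sp_size S) + I) := match x with inl i => sp_time S i | inr i => a i end.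
pose b' (x : 'I_(sp_size S) + I) := match x with inl i => sp_time S i.+1 | inr i => b i end.
pose xi' (x : 'I_(sp_size S) + I) := match x with inl i => sp_coef S i
  | inr i => fun w => (- 1 * xi i w)%R end.
have := @elementary_isometry R d Omega P B hB hOmega _ a' b' xi'.
have -> : (fun w => ((\sum_i xi' i w * (B (b' i) w - B (a' i) w)) ^+ 2)%R%:E) =
    (fun w => ((simple_integral S w - int w) ^+ 2)%:E).
  apply/funext => w; congr ((_ ^+ 2)%:E); rewrite big_sumType/=; congr (_ + _)%R.
  by rewrite /int -sumrN; apply: eq_bigr => i _; rewrite mulN1r mulNr.
have -> : (fun s => \int[P]_w ((\sum_i xi' i w * \1_`]a' i, b' i] s) ^+ 2)%R%:E) =
    (fun s => \int[P]_w ((simple_value S s w - val s w) ^+ 2)%:E).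
  apply/funext => s; apply: eq_integral => w _; congr ((_ ^+ 2)%:E).
  rewrite big_sumType/=; congr (_ + _)%R.
  by rewrite /val -sumrN; apply: eq_bigr => i _; rewrite mulN1r mulNr.
apply; move=> [i|i] //=.
- by have /andP[] := sp_time_bounds (ltnW (ltn_ord i)).
- exact: sp_time_homo.
- by have /andP[] := sp_time_bounds (ltn_ord i).
- exact: sp_coef_adapted.
- exact: (measurable_wrtZ (sigma_algebra_filtration hB _)).
- exact: sp_coef_square_integrable.
- exact: square_integrableZ.
Qed.

Let DE : [set p : R * Omega | [set` `[0%R, 1%R]] p.1] =
  [set p : R * Omega | (0 <= p.1 <= 1)%R].
Proof. by apply/seteqP; split => p /=; rewrite in_itv. Qed.

Let mD : measurable [set p : R * Omega | (0 <= p.1 <= 1)%R].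
Proof.
rewrite (_ : mkset _ = `[0%R, 1%R] `*` setT).
  by apply: measurableX.
by apply/seteqP; split => p /=; rewrite in_itv//= => -[].
Qed.

Let measurable_step (J : finType) (a' b' : J -> R) (xi' : J -> Omega -> R) :
  (forall i, measurable_fun setT (xi' i)) ->
  measurable_fun setT (fun p : R * Omega => \sum_i xi' i p.2 * \1_`]a' i, b' i] p.1)%R.
Proof.
move=> mxi; apply: measurable_sum => i; apply: measurable_funM.
  exact: measurableT_comp.
by apply: (@measurableT_comp _ _ _ _ _ _ (\1_`]a' i, b' i] : R -> R)) => //.
Qed.

(* An isometry up to the factor 4 = 2 * 2: the sharp constant is not needed, and
   comparing with one fixed simple process costs a factor 2 on either side. *)
Theorem ito_integral_le (X : R -> Omega -> R) (V : Omega -> R) :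
  is_ito_integral P B X V ->
  \int[P]_w ((V w - int w) ^+ 2)%:E <=
  4%:E * \int[mu]_(s in `[0%R, 1%R]) \int[P]_w ((X s w - val s w) ^+ 2)%:E.
Proof.
move=> [mX mV [S [S1 S2]]].
have mxi i : measurable_fun setT (xi i) by case: (sxi i).
have mval := measurable_step a b mxi.
have mint : measurable_fun setT int.
  apply: measurable_sum => i; apply: measurable_funM => //; apply: measurable_funB;
    apply: (brownian_measurable hB); first by rewrite b1 andbT (le_trans (a0 i)).
  by rewrite a0 (le_trans (ab i)).
have msp m (i : 'I_(sp_size (S m))) : measurable_fun setT (sp_coef (S m) i).
  by case: (sp_coef_square_integrable i).
have mspv m : measurable_fun setT (fun p : R * Omega => simple_value (S m) p.1 p.2).
  exact: (@measurable_step 'I_(sp_size (S m)) (fun i => sp_time (S m) i)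
    (fun i => sp_time (S m) i.+1) (fun i => sp_coef (S m) i) (@msp m)).
have mspi m : measurable_fun setT (simple_integral (S m)).
  apply: measurable_sum => i; apply: measurable_funM => //; apply: measurable_funB;
    apply: (brownian_measurable hB); apply: sp_time_bounds => //; exact: ltnW.
apply/lee_addgt0Pr => e e0.
set C := \int[mu]_(s in _) _.
have C0 : 0 <= C by apply: integral_ge0 => s _; apply: integral_ge0 => w _; rewrite lee_fin sqr_ge0.
(* The two approximation errors enter with weights 2 and 4, so together they cost 6 e / 8. *)
have e4 : (0 < e / 8)%R by rewrite divr_gt0.
have [m [h1 h2]] : exists m,
    (\int[mu]_(s in `[0%R, 1%R]) \int[P]_w ((X s w - simple_value (S m) s w) ^+ 2)%:E < (e / 8)%:E)
    /\ \int[P]_w ((V w - simple_integral (S m) w) ^+ 2)%:E < (e / 8)%:E.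
  have [m _ hm] := filterI (cvge0_near_lt S1 e4) (cvge0_near_lt S2 e4).
  exists m; have [] := hm m (leqnn m); by rewrite unlock.
have mXs s : (0 <= s <= 1)%R -> measurable_fun setT (X s).
  move=> s01.
  have mX' : measurable_fun [set p : R * Omega | [set` `[0%R, 1%R]] p.1] (fun p => X p.1 p.2).
    by rewrite DE.
  apply: (measurable_section _ mX') => //.
have mspvs s : measurable_fun setT (simple_value (S m) s).
  exact: (measurableT_comp (mspv m) (pair1_measurable s)).
have mvals s : measurable_fun setT (val s).
  exact: (measurableT_comp mval (pair1_measurable s)).
have step2 : \int[mu]_(s in `[0%R, 1%R]) \int[P]_w ((simple_value (S m) s w - val s w) ^+ 2)%:E
   <= 2%:E * (e / 8)%:E + 2%:E * C.
  have mF (Y : R -> Omega -> R) : measurable_fun [set p : R * Omega | (0 <= p.1 <= 1)%R]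
       (fun p => Y p.1 p.2) ->
     measurable_fun (`[0%R, 1%R] : set R) (fun s => \int[P]_w ((X s w - Y s w) ^+ 2)%:E).
    move=> mY; apply: measurable_section_integral => //; last first.
      by move=> x y _; rewrite lee_fin sqr_ge0.
    by rewrite DE; apply/measurable_EFinP/measurable_funX/measurable_funB.
  apply: (@le_trans _ _ (\int[mu]_(s in `[0%R, 1%R])
    (2%:E * \int[P]_w ((X s w - simple_value (S m) s w) ^+ 2)%:E +
     2%:E * \int[P]_w ((X s w - val s w) ^+ 2)%:E))).
    apply: ge0_le_integral_nomeas => s; rewrite /= in_itv/= => s01.
      by apply: integral_ge0 => w _; rewrite lee_fin sqr_ge0.
    rewrite (_ : (fun w => _) = (fun w => ((simple_value (S m) s w - X s w +
       (X s w - val s w)) ^+ 2)%:E)); last first.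
      by apply/funext => w; rewrite subrKA.
    under [X in _ <= _ * X + _]eq_integral do rewrite -sqrrN opprB.
    by apply: integral_sqrD_le; apply: measurable_funB => //; exact: mXs.
  have m1 := mF (simple_value (S m)) (measurable_funTS (mspv m)).
  have m2 := mF val (measurable_funTS mval).
  have ge0 (Y : R -> Omega -> R) s : 0 <= \int[P]_w ((X s w - Y s w) ^+ 2)%:E.
    by apply: integral_ge0 => w _; rewrite lee_fin sqr_ge0.
  rewrite ge0_integralD//; last 4 first.
  - by move=> s _; rewrite mule_ge0.
  - by apply: emeasurable_funM.
  - by move=> s _; rewrite mule_ge0.
  - by apply: emeasurable_funM.
  rewrite !ge0_integralZl//.
  by apply: leeD => //; apply: lee_wpmul2l => //; exact: ltW.
rewrite (_ : (fun w => _) = (fun w => ((V w - simple_integral (S m) w +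
       (simple_integral (S m) w - int w)) ^+ 2)%:E)); last first.
  by apply/funext => w; rewrite subrKA.
apply: le_trans (integral_sqrD_le _ _ _) _; [exact: measurable_funB|exact: measurable_funB|].
rewrite simple_isometry.
apply: (@le_trans _ _ (2%:E * (e / 8)%:E + 2%:E * (2%:E * (e / 8)%:E + 2%:E * C))).
  by apply: leeD; apply: lee_wpmul2l => //; exact: ltW.
case: C C0 step2 => [c| |]// c0 _; last first.
  by rewrite (gt0_muley (x := 4%:E)) ?lte_fin// [leRHS]addye// leey.
rewrite -!EFinM -!EFinD lee_fin; lra.
Qed.

End ito_bound.

(** * Distance from an iterated integral to a discrete second chaos *)

Section iterated_bound.
Local Open Scope ereal_scope.
Context {R : realType} {d : measure_display} {Omega : measurableType d}.
Variables (P : probability Omega R) (B : R -> Omega -> R).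
Hypotheses (hB : standard_brownian_motion P B) (hOmega : brownian_space P B).
Local Notation Fil := (natural_filtration P B).
Local Notation mu := (@lebesgue_measure R).

Variables (delta : R) (u : Omega -> R) (N : nat) (t c : nat -> R).
Hypotheses (delta0 : (0 <= delta)%R) (t0 : (delta <= t 0)%R) (tN : (t N <= 1)%R)
  (t_homo : forall i j, (i <= j)%N -> (t i <= t j)%R).
Hypotheses (Fu : measurable_wrt (Fil delta) u) (su : square_integrable P u).

Definition increment i w := (B (t i.+1) w - B (t i) w)%R.

Definition cell i (s : R) : R := \1_(`]t i, t i.+1]) s.

(** The diagonal cells are left out so that, when r is in cell j, the integral over s involves only
    increments completed by time [t j]. The outer integrand is then adapted and elementary. *)
Definition step2 (s r : R) : R :=
  (\sum_(j < N) \sum_(i < N | (i < j)%N) c i * c j * cell i s * cell j r)%R.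

Definition chaos2 (w : Omega) : R :=
  (\sum_(j < N) \sum_(i < N | (i < j)%N) c i * c j * (increment i w * increment j w))%R.

Let tge0 i : (0 <= t i)%R.
Proof. by apply: le_trans delta0 _; apply: le_trans t0 _; exact: t_homo. Qed.

Let tle1 i : (i <= N)%N -> (t i <= 1)%R.
Proof. by move=> iN; apply: le_trans (t_homo iN) tN. Qed.

Let tdelta i : (delta <= t i)%R.
Proof. by apply: le_trans t0 _; exact: t_homo. Qed.

Let sF r := sigma_algebra_filtration hB r.

Let Fut i : measurable_wrt (Fil (t i)) u.
Proof. by move=> C /Fu; apply: sub_filtration. Qed.

Let xi (j : 'I_N) w := (\sum_(i < N | (i < j)%N) (c j * c i) * (u w * increment i w))%R.

Let Fxi (j : 'I_N) : measurable_wrt (Fil (t j)) (xi j).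
Proof.
apply: (measurable_wrt_sum (sF _)) => i ij; apply: (measurable_wrtZ (sF _)).
apply: (measurable_wrtM (sF _)); first exact: Fut.
apply: (measurable_wrtB (sF _)); apply: brownian_adapted => //; by apply: t_homo => //; exact: ltnW.
Qed.

Let sxi (j : 'I_N) : square_integrable P (xi j).
Proof.
apply: square_integrable_sum => i _; apply: square_integrableZ.
apply: (square_integrable_increment hB hOmega) => //; [exact: t_homo|exact: tle1].
Qed.

(** The factor 16 is 4 for the outer integral times 4 for the inner one at almost every r, since the
    inner elementary integral at r is the value at r of the outer elementary integrand. [G] is a
    measurable majorant, as an almost everywhere comparison of integrals demands. *)
Theorem iterated_ito_integral_le (K : R -> R -> Omega -> R) (F : Omega -> R)
    (G : R -> \bar R) :
  is_iterated_ito_integral P B K F ->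
  measurable_fun (`[0%R, 1%R] : set R) G ->
  (forall r, (0 <= r <= 1)%R ->
    \int[mu]_(s in `[0%R, 1%R])
      \int[P]_w ((K s r w * \1_(`[0%R, r]) s - step2 s r * u w) ^+ 2)%:E <= G r) ->
  \int[P]_w ((F w - u w * chaos2 w) ^+ 2)%:E <=
  16%:E * \int[mu]_(r in `[0%R, 1%R]) G r.
Proof.
move=> [V [aeV VF]] mG hG.
have G0 r : (0 <= r <= 1)%R -> 0 <= G r.
  move=> r01; apply: le_trans (hG r r01); apply: integral_ge0 => s _.
  by apply: integral_ge0 => w _; rewrite lee_fin sqr_ge0.
have := @ito_integral_le R d Omega P B hB hOmega 'I_N (fun i => t i) (fun i => t i.+1) xi
  (fun i => tge0 i) (fun i => t_homo (leqnSn i)) (fun i => tle1 (ltn_ord i)) Fxi sxi _ _ VF.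
have -> : (fun w => ((F w - (\sum_(i < N) xi i w * (B (t i.+1) w - B (t i) w))) ^+ 2)%R%:E) =
   (fun w => ((F w - u w * chaos2 w) ^+ 2)%:E).
  apply/funext => w; congr ((_ ^+ 2)%:E); congr (_ - _)%R.
  rewrite /chaos2 mulr_sumr; apply: eq_bigr => j _.
  rewrite /xi mulr_suml mulr_sumr; apply: eq_bigr => i _.
  by rewrite /increment; ring.
move/le_trans; apply.
rewrite (_ : 16%:E = 4%:E * 4%:E); last by rewrite -EFinM; congr (_%:E); lra.
rewrite -muleA; apply: lee_wpmul2l; first by rewrite lee_fin.
rewrite -ge0_integralZl//.
apply: ae_ge0_le_integral => //.
- by move=> r _; apply: integral_ge0 => w _; rewrite lee_fin sqr_ge0.
- have [mV _ _] := VF.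
  have DE : [set p : R * Omega | [set` `[0%R, 1%R]] p.1] =
    [set p : R * Omega | (0 <= p.1 <= 1)%R].
    by apply/seteqP; split => p /=; rewrite in_itv.
  apply: measurable_section_integral => //; last by move=> x y _; rewrite lee_fin sqr_ge0.
  rewrite DE; apply/measurable_EFinP/measurable_funX/measurable_funB => //.
  apply: measurable_funTS; apply: measurable_sum => i; apply: measurable_funM.
    by apply: measurableT_comp => //; case: (sxi i).
  by apply: (@measurableT_comp _ _ _ _ _ _ (\1_`]t i, t i.+1] : R -> R)).
- by move=> r; rewrite /= in_itv/= => r01; rewrite mule_ge0//; exact: G0.
- exact: emeasurable_funM.
have [Z [mZ muZ subZ]] := aeV.
exists Z; split => // r /= hr'; apply: subZ => /= hr; apply: hr'.
rewrite in_itv/= => r01.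
(* With r fixed, the step kernel times [u] is an elementary integrand in s; exchanging the two sums
   identifies its integral with the outer integrand at r. *)
pose xi' (i : 'I_N) w := ((\sum_(j < N | (i < j)%N) c i * c j * cell j r) * u w)%R.
have := @ito_integral_le R d Omega P B hB hOmega 'I_N (fun i => t i) (fun i => t i.+1) xi'
  (fun i => tge0 i) (fun i => t_homo (leqnSn i)) (fun i => tle1 (ltn_ord i)).
have Fxi' (i : 'I_N) : measurable_wrt (Fil (t i)) (xi' i) by exact/(measurable_wrtZ (sF _))/Fut.
have sxi' (i : 'I_N) : square_integrable P (xi' i) by exact: square_integrableZ.
move=> /(_ Fxi' sxi' _ _ (hr r01)).
rewrite (_ : (fun w => _) = (fun w =>
    ((V r w - (\sum_(i < N) xi i w * \1_`](t i), (t i.+1)] r)) ^+ 2)%R%:E)); last first.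
  apply/funext => w; congr ((_ ^+ 2)%:E); congr (_ - _)%R.
  rewrite /xi'; under eq_bigr do rewrite mulr_suml mulr_suml big_mkcond.
  under [RHS]eq_bigr do rewrite mulr_suml big_mkcond.
  rewrite exchange_big; apply: eq_bigr => j _; apply: eq_bigr => i _.
  by case: ifPn => // _; rewrite /cell/increment; ring.
move/le_trans; apply; apply: lee_wpmul2l; first by rewrite lee_fin.
apply: le_trans (hG r r01); rewrite le_eqVlt; apply/orP; left; apply/eqP.
apply: eq_integral => s _; apply: eq_integral => w _; congr ((_ ^+ 2)%:E).
congr (_ - _)%R; rewrite /xi' /step2 mulr_suml.
under eq_bigr do rewrite mulr_suml mulr_suml big_mkcond.
under [RHS]eq_bigr do rewrite mulr_suml big_mkcond.
rewrite exchange_big; apply: eq_bigr => j _; apply: eq_bigr => i _.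
by case: ifPn => // _; rewrite /cell; ring.
Qed.

End iterated_bound.

(** * The law of a second chaos *)

Lemma sumr_sqr_off_diagonal (R : comNzRingType) (x : nat -> R) (N : nat) :
  (\sum_(i < N) x i) ^+ 2 =
  \sum_(i < N) x i ^+ 2 + 2 * \sum_(j < N) \sum_(i < N | (i < j)%N) x i * x j.
Proof.
have E n : n = N -> \sum_(j < n) \sum_(i < N | (i < j)%N) x i * x j =
    \sum_(j < n) \sum_(i < j) x i * x j.
  move=> nN; apply: eq_bigr => j _.
  by rewrite (big_ord_widen N (fun i => x i * x j)) // -nN ltnW.
rewrite E// {E}; elim: N => [|N ih]; first by rewrite !big_ord0 mulr0 addr0 expr0n.
rewrite !big_ord_recr/= sqrrD ih -mulr_suml; ring.
Qed.

Section chaos_law.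
Local Open Scope ereal_scope.
Context {R : realType} {d : measure_display} {Omega : measurableType d}.
Variables (P : probability Omega R) (B : R -> Omega -> R).
Hypotheses (hB : standard_brownian_motion P B) (hOmega : brownian_space P B).
Local Notation Fil := (natural_filtration P B).
Local Notation gamma := (@normal_prob R 0 1).

Variables (delta : R) (N : nat) (t c : nat -> R).
Hypotheses (delta0 : (0 <= delta)%R) (t0 : (delta <= t 0)%R) (tN : (t N <= 1)%R)
  (t_homo : forall i j, (i <= j)%N -> (t i <= t j)%R).
Hypothesis c0 : forall i, (0 <= c i)%R.

Let tge0 i : (0 <= t i)%R.
Proof. by apply: le_trans delta0 _; apply: le_trans t0 _; exact: t_homo. Qed.

Let tle1 i : (i <= N)%N -> (t i <= 1)%R.
Proof. by move=> iN; apply: le_trans (t_homo iN) tN. Qed.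

Let tdelta i : (delta <= t i)%R.
Proof. by apply: le_trans t0 _; exact: t_homo. Qed.

Let sF r := sigma_algebra_filtration hB r.

Definition chaos1 n w := (\sum_(i < n) c i * increment B t i w)%R.

Definition step_variance n := (\sum_(i < n) c i ^+ 2 * (t i.+1 - t i))%R.

Definition quadratic_error w :=
  (\sum_(i < N) c i ^+ 2 * (increment B t i w ^+ 2 - (t i.+1 - t i)))%R.

(** A discrete Ito formula: twice the off-diagonal sum is the square minus the diagonal, and the
    diagonal is its mean plus a centred error. *)
Lemma chaos2E w : chaos2 B N t c w =
  (2^-1 * (chaos1 N w ^+ 2 - step_variance N - quadratic_error w))%R.
Proof.
have := @sumr_sqr_off_diagonal R (fun i => c i * increment B t i w)%R N.
rewrite -/(chaos1 N w) => ->.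
rewrite (_ : (\sum_(i < N) (c i * increment B t i w) ^+ 2)%R =
    (step_variance N + quadratic_error w)%R); last first.
  rewrite /step_variance /quadratic_error -big_split/=; apply: eq_bigr => i _; ring.
rewrite /chaos2 (_ : (\sum_(j < N) \sum_(i < N | (i < j)%N) c i * increment B t i w * (c j * increment B t j w))%R =
   (\sum_(j < N) \sum_(i < N | (i < j)%N) c i * c j * (increment B t i w * increment B t j w))%R).
  by field.
by apply: eq_bigr => j _; apply: eq_bigr => i _; ring.
Qed.

Lemma step_variance_ge0 n : (0 <= step_variance n)%R.
Proof.
by apply: sumr_ge0 => i _; rewrite mulr_ge0 ?sqr_ge0// subr_ge0 t_homo.
Qed.

Let chaos1_wrt n : measurable_wrt (Fil (t n)) (chaos1 n).
Proof.
apply: (measurable_wrt_sum (sF _)) => i _; apply: (measurable_wrtZ (sF _)).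
apply: (measurable_wrtB (sF _)); apply: brownian_adapted => //; apply: t_homo => //.
exact: ltnW.
Qed.

(** By induction: the partial sum is known at [t n], the next increment is independent of
    [Fil (t n)], and variances add. *)
Lemma gaussian_indep_chaos1 n : (n <= N)%N ->
  gaussian_indep P (Fil delta) (chaos1 n) (Num.sqrt (step_variance n)).
Proof.
elim: n => [_|n ih nN].
  (* The empty sum is obtained as 0 times a trivial increment at delta, which carries the degenerate
     Gaussian law of scale 0. *)
  have d1 : (delta <= 1)%R by apply: le_trans (tdelta N) (tle1 _).
  have := gaussian_indepZ 0 (brownian_increment hB hOmega delta0 (lexx _) d1).
  rewrite mul0r /step_variance big_ord0 sqrtr0.
  by congr gaussian_indep; apply/funext => w; rewrite mul0r /chaos1 big_ord0.
have iB := brownian_increment hB hOmega (tge0 n) (t_homo (leqnSn n)) (tle1 nN).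
have t1 := tle1 (ltnW nN).
have := gaussian_indepD hB hOmega (sF delta) (sF (t n)) (filtration_measurable hOmega t1)
  (sub_filtration (tdelta n)) (sqrtr_ge0 _) _ (ih (ltnW nN)) (@chaos1_wrt n)
  (gaussian_indepZ (c n) iB).
rewrite sqr_sqrtr ?step_variance_ge0// exprMn sqr_sqrtr ?subr_ge0 ?t_homo//.
rewrite mulr_ge0 ?sqrtr_ge0// => /(_ isT).
have -> : step_variance n.+1 = (step_variance n + c n ^+ 2 * (t n.+1 - t n))%R.
  by rewrite /step_variance big_ord_recr.
by congr gaussian_indep; apply/funext => w; rewrite /chaos1 big_ord_recr.
Qed.

(** The variance of [hermite2] under N(0, 1). Its value 2 is never computed: finiteness and sign
    suffice. *)
Definition kurtosis : R := fine (\int[gamma]_z ((z ^+ 2 - 1) ^+ 2)%:E).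

Lemma has_integral_hermite2 : has_integral gamma setT (fun z => z ^+ 2 - 1)%R 0.
Proof.
have h1 : has_integral gamma setT (fun z => z ^+ 2)%R 1.
  by split; [exact: gamma_sqr_integrable|exact: normal_sqr].
have h2 : has_integral gamma setT (fun=> -1)%R (-1).
  split; last by rewrite integral_gamma_cst.
  exact: (@finite_measure_integrable_cst _ _ _ gamma setT (-1)%R).
by have := has_integralD measurableT h1 h2; rewrite subrr.
Qed.

Lemma has_integral_kurtosis :
  has_integral gamma setT (fun z => (z ^+ 2 - 1) ^+ 2)%R kurtosis.
Proof.
apply: integrable_has_integral => //.
have i0 := @finite_measure_integrable_cst _ _ _ gamma setT 1%R measurableT.
have := integrableD measurableT gamma_pow4_integrable i0.
apply: le_integrable => //.
  apply/measurable_EFinP/measurable_funX/measurable_funB => //; exact: exprn_measurable.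
move=> z _; rewrite /= lee_fin ger0_norm ?sqr_ge0// ger0_norm; last first.
  by rewrite addr_ge0// exprn_even_ge0.
have := sqr_ge0 z; nra.
Qed.

Lemma has_integral_gaussian_indep (G : set_system Omega) (X xi : Omega -> R) (s r q : R)
    (k : R -> R) : sigma_algebra setT G -> G `<=` measurable ->
  gaussian_indep P G X s -> measurable_wrt G xi -> measurable_fun setT k ->
  has_integral P setT xi r -> has_integral gamma setT (fun z => k (s * z))%R q ->
  has_integral P setT (fun w => xi w * k (X w))%R (r * q).
Proof.
move=> sG Gm GX Gxi mk [ixi xir] [ik kq].
have [i1 i2] := integral_gaussian_indepM sG Gm GX Gxi ixi mk ik.
by split => //; rewrite i2 xir kq.
Qed.

Let D (i : nat) (w : Omega) : R := (increment B t i w ^+ 2 - (t i.+1 - t i))%R.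

Let D_wrt i n : (i < n)%N -> measurable_wrt (Fil (t n)) (D i).
Proof.
move=> i_n; apply: (measurable_wrtB (sF _)); last first.
  by apply/(measurable_wrtP (sF _)); exact: measurable_cst.
have mi : measurable_wrt (Fil (t n)) (increment B t i).
  by apply: (measurable_wrtB (sF _)); apply: brownian_adapted => //; apply: t_homo => //; exact: ltnW.
exact: (measurable_wrtM (sF _)).
Qed.

Let D_mean i r (xi : Omega -> R) : (i < N)%N -> measurable_wrt (Fil (t i)) xi ->
  has_integral P setT xi r -> has_integral P setT (fun w => xi w * D i w)%R 0.
Proof.
move=> iN Fxi hxi.
have iB := brownian_increment hB hOmega (tge0 i) (t_homo (leqnSn i)) (tle1 iN).
rewrite -(mulr0 r).
have mk : measurable_fun setT (fun x : R => x ^+ 2 - (t i.+1 - t i))%R.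
  by apply: measurable_funB => //; exact: exprn_measurable.
apply: (has_integral_gaussian_indep (sF (t i)) (filtration_measurable hOmega (tle1 (ltnW iN)))
  iB Fxi mk hxi).
have := has_integralZ measurableT (t i.+1 - t i)%R has_integral_hermite2.
rewrite mulr0; apply: eq_has_integral => z.
by rewrite exprMn sqr_sqrtr ?subr_ge0 ?t_homo//; ring.
Qed.

Let D_sqr i : (i < N)%N ->
  has_integral P setT (fun w => D i w * D i w)%R ((t i.+1 - t i) ^+ 2 * kurtosis).
Proof.
move=> iN.
have iB := brownian_increment hB hOmega (tge0 i) (t_homo (leqnSn i)) (tle1 iN).
have h1 : has_integral P setT (fun=> 1%R) 1.
  split; last by rewrite integral_cst//= probability_setT mule1.
  exact: (@finite_measure_integrable_cst _ _ _ P setT 1%R).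
have mk : measurable_fun setT (fun x : R => (x ^+ 2 - (t i.+1 - t i)) ^+ 2)%R.
  by apply: measurable_funX; apply: measurable_funB => //; exact: exprn_measurable.
have F1 : measurable_wrt (Fil (t i)) (fun=> 1%R : R).
  by apply/(measurable_wrtP (sF _)); exact: measurable_cst.
rewrite -[X in has_integral _ _ _ X]mul1r.
apply: eq_has_integral (has_integral_gaussian_indep (sF (t i))
  (filtration_measurable hOmega (tle1 (ltnW iN))) iB F1 mk h1 _).
  by move=> w; rewrite mul1r expr2.
apply: eq_has_integral (has_integralZ measurableT ((t i.+1 - t i) ^+ 2)%R has_integral_kurtosis).
by move=> z; rewrite exprMn sqr_sqrtr ?subr_ge0 ?t_homo//; ring.
Qed.

(** In a cross term the later factor is centred given the earlier one, so only the diagonal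
    survives. With bounded c_i the sum is of the order of the mesh. *)
Lemma quadratic_error_variance :
  has_integral P setT (fun w => quadratic_error w ^+ 2)%R
    (kurtosis * \sum_(i < N) c i ^+ 4 * (t i.+1 - t i) ^+ 2)%R.
Proof.
apply: (eq_has_integral (f := fun w => (\sum_(i < N) \sum_(j < N)
    (c i ^+ 2 * c j ^+ 2) * (D i w * D j w)))%R).
  move=> w; rewrite expr2 mulr_suml; apply: eq_bigr => i _.
  by rewrite mulr_sumr; apply: eq_bigr => j _; rewrite /D; ring.
rewrite mulr_sumr; apply: has_integral_sum => // i.
rewrite (_ : (kurtosis * _)%R = (\sum_(j < N) if i == j then
  (c i ^+ 2 * c j ^+ 2) * ((t i.+1 - t i) ^+ 2 * kurtosis) else 0)%R); last first.
  rewrite -big_mkcond/= (big_pred1 i) => [|j]; first by ring.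
  by rewrite /= eq_sym.
apply: has_integral_sum => // j.
have hD k : (k < N)%N -> has_integral P setT (D k) 0.
  move=> kN; have h1 : has_integral P setT (fun=> 1%R) 1.
    split; last by rewrite integral_cst//= probability_setT mule1.
    exact: (@finite_measure_integrable_cst _ _ _ P setT 1%R).
  have F1 : measurable_wrt (Fil (t k)) (fun=> 1%R : R).
    by apply/(measurable_wrtP (sF _)); exact: measurable_cst.
  by apply: eq_has_integral (D_mean kN F1 h1) => w; rewrite mul1r.
case: eqP => [<-|/eqP ij].
  by apply: has_integralZ => //; exact: D_sqr.
rewrite -(mulr0 (c i ^+ 2 * c j ^+ 2)%R); apply: has_integralZ => //.
have [ij1|ji|/val_inj ijE] := ltngtP i j; last by rewrite ijE eqxx in ij.
- exact: D_mean (D_wrt ij1) (hD _ _).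
- apply: (eq_has_integral (f := fun w => (D j w * D i w)%R)).
    by move=> w; rewrite mulrC.
  exact: D_mean (D_wrt ji) (hD _ _).
Qed.

End chaos_law.

(** * Step approximation of the kernel *)

(** Compactness in its near-covering form, with half the radius of continuity at each centre.
    Closeness is measured by 1 / (N + 1) because N later fixes the number of cells. *)
Lemma heine_cantor01 (R : realType) (g : R -> R) (e : R) : continuous g -> 0 < e ->
  \forall N \near \oo, forall x y : R, 0 <= x <= 1 -> `|x - y| < N.+1%:R^-1 ->
    `|g x - g y| < e.
Proof.
move=> cg e0.
have K : compact (`[0, 1]%classic : set R) by exact: segment_compact.
pose Q (N : nat) (x : R) := forall y : R, `|x - y| < N.+1%:R^-1 -> `|g x - g y| < e.
have /compact_near_coveringP/(_ nat \oo Q _) := K; case.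
- move=> x _.
  have e2 : 0 < e / 2 by rewrite divr_gt0.
  have /cvgrPdist_lt/(_ _ e2)[r /= r0 hr] := cg x.
  have r2 : 0 < r / 2 by rewrite divr_gt0.
  exists (ball x (r / 2), [set N | N.+1%:R^-1 < r / 2]) => /=.
    split; first exact: nbhsx_ballx.
    by have := near_infty_natSinv_lt (PosNum r2).
  move=> [y N] /= [xy Nr] z yz.
  have h1 : `|g x - g y| < e / 2.
    by apply: hr; rewrite /ball/=; apply: lt_trans xy _; lra.
  have h2 : `|g x - g z| < e / 2.
    apply: hr; rewrite /ball/=.
    have := ler_distD y x z; have : `|y - z| < r / 2 by apply: lt_trans Nr.
    have : `|x - y| < r / 2 by exact: xy.
    lra.
  have := ler_distD (g x) (g y) (g z); rewrite (distrC (g y) (g x)); lra.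
- move=> N0 _ h; exists N0 => // N /h hN x y x01 xy.
  by apply: hN => //; rewrite /= in_itv.
Qed.

Section step_approximation.
Local Open Scope ereal_scope.
Context {R : realType}.
Local Notation mu := (@lebesgue_measure R).
Local Notation I01 := (`[0%R, 1%R]%classic : set R).

Lemma lebesgue_measure01 : mu I01 = 1.
Proof.
have := @lebesgue_measure_itv R `[0%R, 1%R].
by rewrite /= lte_fin ltr01 oppr0 adde0.
Qed.

Lemma has_integral_le (D : set R) (f g : R -> R) r s : measurable D ->
  has_integral mu D f r -> has_integral mu D g s ->
  (forall x, D x -> f x <= g x)%R -> (r <= s)%R.
Proof.
move=> mD [fi fr] [gi gs] fg; rewrite -lee_fin -fr -gs.
by apply: le_integral => // x /[!inE] Dx; rewrite lee_fin fg.
Qed.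

Lemma measurable_bounded_has_integral (f : R -> R) (M : R) :
  measurable_fun I01 f -> (forall x, (0 <= x <= 1)%R -> (`|f x| <= M)%R) ->
  has_integral mu I01 f (fine (\int[mu]_(x in I01) (f x)%:E)).
Proof.
move=> mf fM; apply: integrable_has_integral => //.
apply: measurable_bounded_integrable => //.
  by rewrite [X in X < _]lebesgue_measure01 ltry.
exists M; split; first exact: num_real.
move=> x Mx y /=; rewrite in_itv/= => y01; apply: le_trans (fM y y01) _; exact: ltW.
Qed.

Lemma has_integral_cst01 (c : R) : has_integral mu I01 (fun=> c) c.
Proof.
split; last by rewrite integral_cst// [X in _ * X]lebesgue_measure01 mule1.
by have [] := @measurable_bounded_has_integral (fun=> c) `|c|.
Qed.

Variables (N : nat) (t c : nat -> R).
Hypotheses (t0 : (0 <= t 0)%R) (tN : (t N <= 1)%R)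
  (t_homo : forall i j, (i <= j)%N -> (t i <= t j)%R).

Lemma cell_sum n (s : R) :
  (\sum_(i < n) cell t i s)%R = \1_(`]t 0, t n]) s.
Proof.
elim: n => [|n ih]; first by rewrite big_ord0 set_itvoc0 indic0.
rewrite big_ord_recr/= ih /cell !indicE !mem_setE !in_itv/=.
have h1 := t_homo (leq0n n); have h2 := t_homo (leqnSn n).
have [sn|ns] := leP s (t n).
  by rewrite /= addr0 (le_trans sn h2) !andbT.
by rewrite /= andbF add0r (le_lt_trans h1 ns).
Qed.

Lemma cell_disjoint i j (s : R) : (i < j)%N -> (cell t i s * cell t j s = 0)%R.
Proof.
move=> ij; rewrite /cell !indicE !mem_setE !in_itv/=.
have h := t_homo ij.
have [sn|ns] := leP s (t i.+1); last by rewrite andbF mul0r.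
by rewrite [(t j < s)%R]ltNge (le_trans sn h)/= mulr0.
Qed.

Lemma cell_ge0 i s : (0 <= cell t i s)%R. Proof. by []. Qed.

Let tle1 i : (i <= N)%N -> (t i <= 1)%R.
Proof. by move=> iN; apply: le_trans (t_homo iN) tN. Qed.

Lemma has_integral_cell i : (i < N)%N ->
  has_integral mu I01 (cell t i) (t i.+1 - t i)%R.
Proof.
move=> iN; have ti0 := le_trans t0 (t_homo (leq0n i)).
have := has_integral_overlap ti0 (tle1 iN) ti0 (tle1 iN).
rewrite /overlap minxx maxxx (max_idPr _) ?subr_ge0 ?t_homo//.
apply: eq_has_integral => s; rewrite /cell -[RHS]mulr1 -[in RHS](mulr1 (\1__ s)).
by rewrite indicE; case: (_ \in _); rewrite ?mulr1 ?mulr0.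
Qed.

Definition step1 (s : R) : R := (\sum_(i < N) c i * cell t i s)%R.

Lemma step1_sqr s : (step1 s ^+ 2 = \sum_(i < N) c i ^+ 2 * cell t i s)%R.
Proof.
rewrite /step1 (@sumr_sqr_off_diagonal _ (fun i => c i * cell t i s)%R) [X in (_ + _ * X)%R]big1.
  rewrite mulr0 addr0; apply: eq_bigr => i _; rewrite exprMn; congr (_ * _)%R.
  by rewrite /cell indicE; case: (_ \in _); rewrite ?expr1n ?expr0n.
by move=> j _; apply: big1 => i ij; rewrite mulrACA cell_disjoint// mulr0.
Qed.

(** This identifies the variance of the first chaos with a squared L^2 norm, which is how v comes
    close to the mass of [phi n]. *)
Lemma has_integral_step1_sqr :
  has_integral mu I01 (fun s => step1 s ^+ 2)%R (step_variance t c N).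
Proof.
rewrite (_ : (fun s => _) = (fun s => \sum_(i < N) c i ^+ 2 * cell t i s)%R); last first.
  by apply/funext => s; rewrite step1_sqr.
apply: has_integral_sum => // i; apply: has_integralZ => //.
exact: has_integral_cell.
Qed.

(** For s <= r no cell of s comes after the cell of r, so only the strict part and the diagonal of
    the product remain. *)
Lemma step1M_le s r : (s <= r)%R ->
  (step1 s * step1 r = step2 N t c s r + \sum_(i < N) c i ^+ 2 * cell t i s * cell t i r)%R.
Proof.
move=> sr.
have z i j : (i < j)%N -> (cell t j s * cell t i r = 0)%R.
  move=> ij; rewrite /cell !indicE !mem_setE !in_itv/=; have h := t_homo ij.
  have [ri|] := leP r (t i.+1); last by rewrite andbF mulr0.
  by rewrite ltNge (le_trans sr (le_trans ri h))/= mul0r.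
have E : (\sum_(j < N) \sum_(i < N | (j < i)%N) c i * c j * cell t i s * cell t j r = 0)%R.
  apply: big1 => j _; apply: big1 => i ij.
  by rewrite -mulrA z// mulr0.
rewrite /step1 /step2 mulr_sumr.
transitivity (\sum_(j < N) (\sum_(i < N | (i < j)%N) c i * c j * cell t i s * cell t j r +
   \sum_(i < N | (j < i)%N) c i * c j * cell t i s * cell t j r +
   c j ^+ 2 * cell t j s * cell t j r))%R; last first.
  by rewrite 2!big_split/= E addr0.
apply: eq_bigr => j _; rewrite mulr_suml.
rewrite (bigD1 j)//= (bigID (fun i : 'I_N => (i < j)%N))/= addrC; congr (_ + _)%R.
  congr (_ + _)%R; apply: eq_big => [i|i _].
  - by rewrite -val_eqE/=; case: ltngtP.
  - by ring.
  - by rewrite -val_eqE/=; case: ltngtP.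
  - by ring.
by ring.
Qed.

Lemma step2_gt s r : (r < s)%R -> step2 N t c s r = 0%R.
Proof.
move=> rs; apply: big1 => j _; apply: big1 => i ij.
rewrite -mulrA (_ : (cell t i s * cell t j r = 0)%R) ?mulr0//.
rewrite /cell !indicE !mem_setE !in_itv/=; have h := t_homo ij.
have [si|] := leP s (t i.+1); last by rewrite andbF mul0r.
by rewrite [(t j < r)%R]ltNge (le_trans (ltW rs) (le_trans si h))/= mulr0.
Qed.

End step_approximation.

Section step_approximation_existence.
Local Open Scope ereal_scope.
Context {R : realType}.
Local Notation mu := (@lebesgue_measure R).
Local Notation I01 := (`[0%R, 1%R]%classic : set R).

(** Open at delta, like the half-open cells of a subdivision of [delta, 1]. *)
Definition tail_part (delta : R) (phi : R -> R) (s : R) : R :=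
  (phi s * \1_(`]delta, 1%R]) s)%R.

Lemma measurable_tail_part delta phi : (0 <= delta)%R -> measurable_fun I01 phi ->
  measurable_fun setT (tail_part delta phi).
Proof.
move=> delta0 mphi.
have mI : measurable I01 by [].
have m0 : measurable_fun setT (phi \_ I01).
  by apply/(measurable_restrictT phi mI).
rewrite (_ : tail_part _ _ = fun s => ((phi \_ I01) s * \1_(`]delta, 1%R]) s)%R).
  by apply: measurable_funM.
apply/funext => s; rewrite /tail_part patchE; case: ifPn => //.
rewrite notin_setE /= in_itv/= => /negP sI; rewrite indicE mem_setE in_itv/=.
have [ds|] := ltP delta s; last by rewrite !mulr0.
by move: sI; rewrite (le_trans delta0 (ltW ds))/= => /negbTE ->; rewrite !mulr0.
Qed.

(** Closeness in L^1 is enough here: later all functions are bounded by one constant, which converts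
    it into closeness in L^2. *)
Lemma continuous_approximation (phi : R -> R) (M e : R) :
  measurable_fun I01 phi -> (forall s, (0 <= s <= 1)%R -> (`|phi s| <= M)%R) ->
  (0 < e)%R -> exists g : R -> R, continuous g /\
    has_integral mu I01 (fun s => `|phi s - g s|)%R
      (fine (\int[mu]_(s in I01) (`|phi s - g s|)%R%:E)) /\
    (fine (\int[mu]_(s in I01) (`|phi s - g s|)%R%:E) < e)%R.
Proof.
move=> mphi phiM e0.
have [iphi _] := measurable_bounded_has_integral mphi phiM.
have mI : measurable I01 by [].
have fI : mu I01 < +oo by rewrite lebesgue_measure01 ltry.
have [g [cg ig hg]] := approximation_continuous_integrable mI fI iphi.
have [m _ hm] := cvge0_near_lt hg e0.
exists (g m); split; first exact: cg.
have hi : has_integral mu I01 (fun s => `|phi s - g m s|)%R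
      (fine (\int[mu]_(s in I01) (`|phi s - g m s|)%R%:E)).
  apply: integrable_has_integral => //.
  apply: (@integrable_norm _ _ _ mu I01 (fun s => phi s - g m s)%R).
  have mI' : @measurable _ (measurableTypeR R) I01 by [].
  exact: (integrableB mI' iphi (ig m)).
split => //; rewrite -lte_fin -hi.2; exact: (hm m (leqnn m)).
Qed.

(** One regular subdivision serves all the requirements: the step function is L^1-close to the tail
    of phi, everything is bounded by [M1], and a square is at most a bound times an absolute value.
    The omitted diagonal costs only the mesh. *)
Lemma step_approximation (phi : R -> R) (M delta e : R) :
  measurable_fun I01 phi -> (forall s, (0 <= s <= 1)%R -> (0 <= phi s <= M)%R) ->
  (0 <= delta < 1)%R -> (0 < e)%R ->
  exists (N : nat) (t c : nat -> R) (bnd : R -> R),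
    [/\ (delta <= t 0)%R, (t N <= 1)%R, (forall i j, (i <= j)%N -> (t i <= t j)%R),
        (forall i, (0 <= c i)%R) &
    [/\ (`|step_variance t c N -
           fine (\int[mu]_(s in I01) (tail_part delta phi s ^+ 2)%:E)| <= e)%R,
        measurable_fun setT bnd /\ (forall r, 0 <= bnd r)%R,
        (forall r, (0 <= r <= 1)%R -> \int[mu]_(s in I01)
          ((tail_part delta phi s * tail_part delta phi r * \1_(`[0%R, r]) s
            - step2 N t c s r) ^+ 2)%:E <= (bnd r)%:E),
        \int[mu]_(r in I01) (bnd r)%:E <= e%:E &
        (\sum_(i < N) c i ^+ 4 * (t i.+1 - t i) ^+ 2 <= e)%R]].
Proof.
move=> mphi phiM /andP[delta0 delta1] e0.
set q := tail_part delta phi.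
have mI' : @measurable _ (measurableTypeR R) I01 by [].
have mq : measurable_fun setT q by exact: measurable_tail_part.
(* A bound that is at least 1, so that every lower power of [M1] is at most M1^4. *)
pose M1 := (M + 1)%R.
have M0 : (0 <= M)%R by have := phiM 0%R; rewrite lexx ler01 => /(_ isT)/andP[]; exact: le_trans.
have M11 : (1 <= M1)%R by rewrite /M1; lra.
have M10 : (0 <= M1)%R by lra.
(* Each error term is at most M1^4 eta = e / 4; the variance estimate uses two of them and the
   integral of [bnd] three. *)
pose eta := (e / (4 * M1 ^+ 4))%R.
have M14 : (1 <= M1 ^+ 4)%R by rewrite exprn_ege1.
have eta0 : (0 < eta)%R by rewrite divr_gt0// mulr_gt0//; lra.
have etaE : (M1 ^+ 4 * eta = e / 4)%R.
  by rewrite /eta; field; rewrite gt_eqF//; lra.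
have eta2 : (0 < eta / 2)%R by rewrite divr_gt0.
have phiM' s : (0 <= s <= 1)%R -> (`|phi s| <= M1)%R.
  move=> /phiM /andP[p0 pM]; rewrite ger0_norm//; rewrite /M1; lra.
have [g [cg [hg0 hge]]] := continuous_approximation mphi phiM' eta2.
set rg := fine _ in hg0 hge.
have [N0 [hN0 hN1]] : exists N0 : nat,
    (forall x y : R, (0 <= x <= 1)%R -> (`|x - y| < N0.+1%:R^-1)%R -> (`|g x - g y| < eta / 2)%R)
    /\ (N0.+1%:R^-1 < eta)%R.
  have [m _ hm] := filterI (heine_cantor01 cg eta2) (near_infty_natSinv_lt (PosNum eta0)).
  by exists m; have := hm m (leqnn m).
(* One cell more than N0 + 1 makes the mesh strictly smaller than 1 / (N0 + 1) even if delta = 0. *)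
pose N := N0.+2.
have Np : (0 < N%:R :> R)%R by rewrite ltr0n.
pose t (i : nat) : R := (delta + i%:R * ((1 - delta) / N%:R))%R.
(* The continuous approximation may leave [0, M1]. Clipping its values keeps the c_i nonnegative and
   bounded, and never moves them away from a point of [0, M1]. *)
pose clip (x : R) : R := Num.max 0%R (Num.min x M1).
pose c (i : nat) := clip (g (t i.+1)).
have clip0 x : (0 <= clip x)%R by rewrite /clip le_max lexx.
have clipM x : (clip x <= M1)%R by rewrite /clip ge_max M10 ge_min lexx orbT.
have clip1 x y : (0 <= x <= M1)%R -> (`|x - clip y| <= `|x - y|)%R.
  move=> /andP[x0 xM]; rewrite /clip; case: (leP y M1) => yM.
    case: (leP 0%R y) => y0 //.
    by rewrite subr0 !ger0_norm//; lra.
  rewrite (max_idPr M10) distrC [leRHS]distrC !ger0_norm; lra.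
have dt i : (t i.+1 - t i = (1 - delta) / N%:R)%R.
  by rewrite /t opprD addrACA subrr add0r -mulrBl -natrB// subSnn mul1r.
have step0 : (0 <= (1 - delta) / N%:R)%R by rewrite divr_ge0//; lra.
have t_homo i j : (i <= j)%N -> (t i <= t j)%R.
  by move=> ij; rewrite /t lerD2l ler_wpM2r// ler_nat.
have t00 : t 0%N = delta by rewrite /t mul0r addr0.
have tN1 : t N = 1%R by rewrite /t mulrCA divff ?gt_eqF// mulr1; lra.
have t0 : (0 <= t 0%N)%R by rewrite t00.
have tN : (t N <= 1)%R by rewrite tN1.
have stepN : ((1 - delta) / N%:R < N0.+1%:R^-1)%R.
  rewrite ltr_pdivrMr// (@le_lt_trans _ _ 1%R)//; first by lra.
  by rewrite mulrC ltr_pdivlMr ?ltr0n// mul1r ltr_nat.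
pose psi := step1 N t c.
pose rho s := (`|q s - psi s|)%R.
have cellE s : (\sum_(i < N) cell t i s)%R = \1_(`]delta, 1%R]) s.
  by rewrite cell_sum// t00 tN1.
(* On ]delta, 1] exactly one cell contains s, and there c_i is the clipped value of g at the right
   endpoint, closer to s than the modulus of continuity allows. *)
have rho_le s : (0 <= s <= 1)%R -> (rho s <= `|phi s - g s| + eta / 2)%R.
  move=> s01.
  have -> : rho s = (`|\sum_(i < N) (phi s - c i) * cell t i s|)%R.
    congr (`|_|)%R; rewrite /q /tail_part -cellE mulr_sumr -sumrB.
    by apply: eq_bigr => i _; rewrite mulrBl.
  apply: le_trans (ler_norm_sum _ _ _) _.
  apply: (@le_trans _ _ (\sum_(i < N) (`|phi s - g s| + eta / 2) * cell t i s)%R).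
    apply: ler_sum => i _; rewrite normrM (ger0_norm (cell_ge0 t i s)).
    rewrite /cell indicE mem_setE in_itv/=.
    have [/andP[s1 s2]|_] := boolP (t i < s <= t i.+1)%R; last by rewrite !mulr0.
    rewrite !mulr1; apply: le_trans (clip1 _ _ _) _.
      by have /andP[-> pM] := phiM s s01; rewrite /M1; lra.
    apply: le_trans (ler_distD (g s) _ _) _; rewrite lerD2l ltW//.
    apply: hN0 => //; apply: le_lt_trans stepN; rewrite -(dt i) distrC ger0_norm; lra.
  rewrite -mulr_sumr cellE indicE; case: (_ \in _); rewrite ?mulr1 ?mulr0//.
  by rewrite addr_ge0// ltW.
have q0 s : (0 <= s <= 1)%R -> (0 <= q s <= M1)%R.
  move=> s01; rewrite /q /tail_part indicE; have /andP[p0 pM] := phiM s s01.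
  by case: (_ \in _); rewrite ?mulr1 ?mulr0 ?lexx ?p0//=; rewrite /M1; lra.
have psi0 s : (0 <= psi s <= M1)%R.
  apply/andP; split; first by apply: sumr_ge0 => i _; rewrite mulr_ge0 ?cell_ge0 //; exact: clip0.
  apply: (@le_trans _ _ (\sum_(i < N) M1 * cell t i s)%R).
    by apply: ler_sum => i _; apply: ler_wpM2r; [exact: cell_ge0|exact: clipM].
  rewrite -mulr_sumr cellE indicE; case: (_ \in _); rewrite ?mulr1 ?mulr0//.
have mcell i : measurable_fun setT (cell t i) by exact: measurable_indic.
have mpsi : measurable_fun setT psi.
  by apply: measurable_sum => i; apply: measurable_funM.
have mrho : measurable_fun setT rho.
  by apply: measurableT_comp => //; exact: measurable_funB.
have [hrho rho_eta] : has_integral mu I01 rho (fine (\int[mu]_(s in I01) (rho s)%:E)) /\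
    (fine (\int[mu]_(s in I01) (rho s)%:E) <= eta)%R.
  have h : has_integral mu I01 rho (fine (\int[mu]_(s in I01) (rho s)%:E)).
    apply: (@measurable_bounded_has_integral _ _ M1); first exact: measurable_funTS.
    move=> x x01; rewrite /rho normr_id ler_norml.
    have /andP[? ?] := q0 x x01; have /andP[? ?] := psi0 x.
    by apply/andP; split; lra.
  split => //.
  have h2 := has_integralD mI' hg0 (has_integral_cst01 (eta / 2)%R).
  have := has_integral_le mI' h h2; move=> H; apply: le_trans (H _) _; last by lra.
  by move=> x; rewrite /= in_itv/=; exact: rho_le.
set r0 := fine _ in hrho rho_eta.
have r00 : (0 <= r0)%R by apply: fine_ge0; apply: integral_ge0 => x _; rewrite lee_fin normr_ge0.
have sum_dt : (\sum_(i < N) (t i.+1 - t i) ^+ 2 <= eta)%R.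
  under eq_bigr do rewrite dt.
  rewrite sumr_const card_ord -[X in (X <= _)%R]mulr_natr exprMn.
  rewrite (_ : (_ * _)%R = ((1 - delta) ^+ 2 * N%:R^-1)%R); last first.
    have NN : (N%:R != 0 :> R)%R by rewrite gt_eqF.
    by move: NN; move: (N%:R : R)%R => n NN; field.
  apply: (@le_trans _ _ N%:R^-1%R).
    apply: ler_piMl; first by rewrite invr_ge0 ltW.
    by rewrite expr_le1 ?subr_ge0 ?(ltW delta1)//; lra.
  apply: le_trans (ltW hN1); rewrite lef_pV2 ?posrE ?ltr0n//.
  by rewrite ler_nat.
(* The integral in s of the pointwise bound proved below; its last term is the diagonal cell
   containing r. *)
pose bnd r : R := (M1 ^+ 3 * r0 + M1 ^+ 3 * rho r +
     M1 ^+ 4 * \sum_(i < N) (t i.+1 - t i) * cell t i r)%R.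
have M30 : (0 <= M1 ^+ 3)%R by rewrite exprn_ge0.
exists N, t, c, bnd; split; [by rewrite t00|exact: tN|exact: t_homo|by move=> i; exact: clip0|].
split.
- set w := fine _.
  have hw : has_integral mu I01 (fun s => q s ^+ 2)%R w.
    apply: (@measurable_bounded_has_integral _ _ (M1 ^+ 2)%R).
      by apply: measurable_funTS; exact: measurable_funX.
    move=> x /q0 /andP[h1 h2]; rewrite ger0_norm ?sqr_ge0// ler_sqr ?nnegrE//.
  have hv := has_integral_step1_sqr c t0 tN t_homo.
  have h2M := has_integralZ mI' (2 * M1)%R hrho.
  have hB : (2 * M1 * r0 <= e)%R.
    apply: (@le_trans _ _ (2 * (M1 ^+ 4 * eta)))%R; last by rewrite etaE; lra.
    rewrite -mulrA ler_pM2l//; apply: ler_pM => //.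
    by rewrite -[leLHS]expr1 ler_weXn2l.
  have key x : (0 <= x <= 1)%R ->
      (`|psi x ^+ 2 - q x ^+ 2| <= 2 * M1 * rho x)%R.
    move=> x01; rewrite subr_sqr normrM mulrC [in X in (_ <= X)%R]/rho distrC.
    rewrite ler_wpM2r// ler_norml.
    have /andP[? ?] := q0 x x01; have /andP[? ?] := psi0 x.
    by apply/andP; split; lra.
  rewrite ler_norml; apply/andP; split.
    have := has_integral_le mI' hw (has_integralD mI' hv h2M).
    move=> H; suff : (w <= step_variance t c N + 2 * M1 * r0)%R by lra.
    apply: H => x; rewrite /= in_itv/= => x01.
    have := key x x01; rewrite ler_norml => /andP[]; rewrite -/psi; lra.
  have := has_integral_le mI' hv (has_integralD mI' hw h2M).
  move=> H; suff : (step_variance t c N <= w + 2 * M1 * r0)%R by lra.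
  apply: H => x; rewrite /= in_itv/= => x01.
  have := key x x01; rewrite ler_norml => /andP[]; rewrite -/psi; lra.
- split.
    apply: measurable_funD; first by apply: measurable_funD => //; apply: measurable_funM.
    by apply: measurable_funM => //; apply: measurable_sum => i; apply: measurable_funM.
  move=> r; rewrite !addr_ge0// ?mulr_ge0 ?exprn_ge0 ?normr_ge0//.
  by apply: sumr_ge0 => i _; rewrite mulr_ge0 ?cell_ge0// subr_ge0 t_homo.
- pose dg s r : R := (\sum_(i < N) cell t i s * cell t i r)%R.
  have key s r : (0 <= s <= 1)%R -> (0 <= r <= 1)%R ->
      ((q s * q r * \1_(`[0%R, r]) s - step2 N t c s r) ^+ 2 <=
       M1 ^+ 3 * rho s + M1 ^+ 3 * rho r + M1 ^+ 4 * dg s r)%R.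
    move=> s01 r01.
    have dg0 : (0 <= dg s r)%R by apply: sumr_ge0 => i _; rewrite mulr_ge0.
    have /andP[qs0 qsM] := q0 s s01; have /andP[qr0 qrM] := q0 r r01.
    have /andP[ps0 psM] := psi0 s; have /andP[pr0 prM] := psi0 r.
    have rs0 : (0 <= rho s)%R by exact: normr_ge0.
    have rr0 : (0 <= rho r)%R by exact: normr_ge0.
    have [sr|rs] := leP s r; last first.
      rewrite (@step2_gt _ N t c)// subr0 indicE mem_setE in_itv/= [(s <= r)%R]leNgt rs andbF mulr0 expr0n.
      by rewrite !addr_ge0 ?mulr_ge0 ?exprn_ge0.
    rewrite indicE mem_setE in_itv/= sr andbT; have /andP[-> _] := s01; rewrite mulr1.
    have := @step1M_le _ N t c t_homo s r sr; rewrite -/psi.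
    set S := step2 N t c s r; set d2 := (\sum_(i < N) _)%R => hS.
    have S0 : (0 <= S)%R.
      apply: sumr_ge0 => j _; apply: sumr_ge0 => i _.
      by rewrite !mulr_ge0 ?cell_ge0//; exact: clip0.
    have d20 : (0 <= d2)%R.
      by apply: sumr_ge0 => i _; rewrite !mulr_ge0 ?cell_ge0 ?exprn_ge0//; exact: clip0.
    have d2le : (d2 <= M1 ^+ 2 * dg s r)%R.
      rewrite /dg mulr_sumr; apply: ler_sum => i _; rewrite -mulrA.
      apply: ler_wpM2r; first by rewrite mulr_ge0.
      by rewrite ler_sqr ?nnegrE//; [exact: clipM|exact: clip0].
    have pp : (psi s * psi r <= M1 ^+ 2)%R by rewrite expr2; apply: ler_pM.
    have qq : (q s * q r <= M1 ^+ 2)%R by rewrite expr2; apply: ler_pM.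
    have qq0 : (0 <= q s * q r)%R by rewrite mulr_ge0.
    have dqq : (`|q s * q r - psi s * psi r| <= M1 * rho s + M1 * rho r)%R.
      rewrite (_ : (_ - _ = (q s - psi s) * q r + psi s * (q r - psi r))%R); last by ring.
      apply: le_trans (ler_normD _ _) _; apply: lerD.
        by rewrite normrM (ger0_norm qr0) (mulrC M1); apply: (ler_wpM2l rs0).
      by rewrite normrM (ger0_norm ps0); apply: (ler_wpM2r rr0).
    have dA : (`|q s * q r - S| <= M1 * rho s + M1 * rho r + M1 ^+ 2 * dg s r)%R.
      move: dqq; rewrite !ler_norml => /andP[h1 h2]; apply/andP; split; lra.
    (* Of the two factors of the square, one is bounded by this constant and the other by the small
       quantity [dA]. *)
    have dA2 : (`|q s * q r - S| <= M1 ^+ 2)%R.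
      by rewrite ler_norml; apply/andP; split; lra.
    rewrite -real_normK ?num_real// expr2.
    apply: (@le_trans _ _ (M1 ^+ 2 * (M1 * rho s + M1 * rho r + M1 ^+ 2 * dg s r)))%R.
      by apply: ler_pM.
    by rewrite le_eqVlt; apply/orP; left; apply/eqP; ring.
  move=> r r01.
    have [_ <-] : has_integral mu I01
        (fun s => M1 ^+ 3 * rho s + M1 ^+ 3 * rho r + M1 ^+ 4 * dg s r)%R (bnd r).
      apply: (has_integralD mI').
        by apply: (has_integralD mI'); [exact: has_integralZ|exact: has_integral_cst01].
      apply: (has_integralZ mI'); rewrite /dg.
      apply: (has_integral_sum mI') => i.
      rewrite mulrC (_ : (fun x => _) = (fun x => cell t i r * cell t i x)%R); last first.
        by apply/funext => x; rewrite mulrC.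
      by apply: (has_integralZ mI'); exact: (has_integral_cell t0 tN t_homo).
    apply: ge0_le_integral_nomeas => s; rewrite /= in_itv/= => s01.
      by rewrite lee_fin sqr_ge0.
    by rewrite lee_fin; exact: key.
- have [_ ->] : has_integral mu I01 bnd (M1 ^+ 3 * r0 + M1 ^+ 3 * r0 +
     M1 ^+ 4 * \sum_(i < N) (t i.+1 - t i) * (t i.+1 - t i))%R.
    apply: (has_integralD mI').
      by apply: (has_integralD mI'); [exact: has_integral_cst01|exact: has_integralZ].
    apply: (has_integralZ mI'); apply: (has_integral_sum mI') => i.
    by apply: (has_integralZ mI'); exact: (has_integral_cell t0 tN t_homo).
  rewrite lee_fin.
  have h3 : (M1 ^+ 3 * r0 <= M1 ^+ 4 * eta)%R by apply: ler_pM => //; rewrite ler_weXn2l.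
  have h4 : (M1 ^+ 4 * \sum_(i < N) (t i.+1 - t i) * (t i.+1 - t i) <= M1 ^+ 4 * eta)%R.
    by rewrite ler_wpM2l//; lra.
  move: h3 h4; rewrite etaE; lra.
- apply: (@le_trans _ _ (M1 ^+ 4 * eta))%R; last by rewrite etaE; lra.
  apply: (@le_trans _ _ (\sum_(i < N) M1 ^+ 4 * (t i.+1 - t i) ^+ 2))%R.
    apply: ler_sum => i _; apply: ler_wpM2r; first exact: sqr_ge0.
    by rewrite lerXn2r ?nnegrE//; [exact: clip0|exact: clipM].
  by rewrite -mulr_sumr ler_wpM2l//; lra.
Qed.

End step_approximation_existence.

(** * Random variables known before time 1 *)

Section filtration_density.
Local Open Scope ereal_scope.
Context {R : realType} {d : measure_display} {Omega : measurableType d}.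
Variables (P : probability Omega R) (B : R -> Omega -> R).
Hypotheses (hB : standard_brownian_motion P B) (hOmega : brownian_space P B).
Local Notation Fil := (natural_filtration P B).

Let sF r := sigma_algebra_filtration hB r.
Let mF r (r1 : (r <= 1)%R) := filtration_measurable hOmega r1.

(** The events approximable in probability by events known strictly before time 1. They are shown to
    form a sigma-algebra making every B_s measurable, so they exhaust the measurable sets. *)
Definition approximable : set_system Omega := [set A | measurable A /\
  forall e : R, (0 < e)%R -> exists delta A',
    [/\ (0 <= delta < 1)%R, Fil delta A' & P (A `+` A') <= e%:E]].

Let measurable_setY (A C : set Omega) : measurable A -> measurable C -> measurable (A `+` C).
Proof. by move=> mA mC; apply: measurableU; apply: measurableD. Qed.

Let setY_triangle (A C E : set Omega) : A `+` E `<=` (A `+` C) `|` (C `+` E).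
Proof.
move=> w; rewrite /setY/=.
by case: (pselect (A w)); case: (pselect (C w)); case: (pselect (E w)); tauto.
Qed.

Let PsetY_triangle (A C E : set Omega) : measurable A -> measurable C -> measurable E ->
  P (A `+` E) <= P (A `+` C) + P (C `+` E).
Proof.
move=> mA mC mE; apply: (@le_trans _ _ (P ((A `+` C) `|` (C `+` E)))).
  by apply: le_measure; rewrite ?inE; [exact: measurable_setY|
    by apply: measurableU; exact: measurable_setY|exact: setY_triangle].
by apply: measureU2; exact: measurable_setY.
Qed.

Let approximable_filtration (delta : R) A : (0 <= delta < 1)%R -> Fil delta A -> approximable A.
Proof.
move=> d01 FA; have /andP[d0 d1] := d01; split; first exact: (mF (ltW d1)).
by move=> e e0; exists delta, A; split => //; rewrite setYK measure0 lee_fin ltW.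
Qed.

Let approximable_null A C : approximable A -> measurable C -> P (C `+` A) = 0 -> approximable C.
Proof.
move=> [mA hA] mC CA; split => // e e0; have [delta [A' [d01 FA' h]]] := hA e e0.
have /andP[_ d1] := d01.
exists delta, A'; split => //; apply: le_trans h; rewrite -[leRHS]add0e -CA.
exact: PsetY_triangle (mF (ltW d1) FA').
Qed.

Let approximableU A C : approximable A -> approximable C -> approximable (A `|` C).
Proof.
move=> [mA hA] [mC hC]; split; first exact: measurableU.
move=> e e0; have e2 : (0 < e / 2)%R by rewrite divr_gt0.
have [d1 [A' [/andP[d10 d11] FA' h1]]] := hA _ e2.
have [d2 [C' [/andP[d20 d21] FC' h2]]] := hC _ e2.
exists (Num.max d1 d2), (A' `|` C'); split.
- by rewrite le_max d10 gt_max d11 d21.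
- have F1 : Fil (Num.max d1 d2) A' by apply: sub_filtration FA'; rewrite le_max lexx.
  have F2 : Fil (Num.max d1 d2) C' by apply: sub_filtration FC'; rewrite le_max lexx orbT.
  rewrite -bigcup2E; have [_ _] := sF (Num.max d1 d2); apply => n.
  rewrite /bigcup2; case: n => [|[|n]] //=; by case: (sF (Num.max d1 d2)).
have mA' := mF (ltW d11) FA'; have mC' := mF (ltW d21) FC'.
rewrite [e in leRHS]splitr EFinD; apply: le_trans (leeD h1 h2).
apply: (@le_trans _ _ (P ((A `+` A') `|` (C `+` C')))).
  apply: le_measure; rewrite ?inE.
  - by apply: measurable_setY; exact: measurableU.
  - by apply: measurableU; exact: measurable_setY.
  - move=> w; rewrite /setY/=.
    by case: (pselect (A w)); case: (pselect (C w)); case: (pselect (A' w));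
      case: (pselect (C' w)); tauto.
by apply: measureU2; exact: measurable_setY.
Qed.

(** A countable union is approached in probability by its finite sub-unions, and finitely many
    events can be approximated at a common time, the largest of theirs. *)
Lemma sigma_algebra_approximable : sigma_algebra setT approximable.
Proof.
have A0 : approximable set0.
  apply: (@approximable_filtration 0%R); first by rewrite lexx ltr01.
  by case: (sF 0%R).
split => //.
- move=> A [mA hA]; split; first by rewrite setTD; exact: measurableC.
  move=> e e0; have [delta [A' [d01 FA' h]]] := hA e e0.
  exists delta, (setT `\` A'); split => //; first by case: (sF delta) => _ + _; exact.
  rewrite (_ : _ `+` _ = A `+` A')//; apply/seteqP; split => w; rewrite /setY/=;
    by case: (pselect (A w)); case: (pselect (A' w)); tauto.
- move=> A hA; pose U n := \big[setU/set0]_(i < n) A i.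
  have mA n : measurable (A n) by case: (hA n).
  have UU n : approximable (U n).
    elim: n => [|n ih]; first by rewrite /U big_ord0.
    by rewrite /U big_ord_recr/=; exact: approximableU.
  have mU n : measurable (U n) by case: (UU n).
  have mUA : measurable (\bigcup_k A k) by exact: bigcupT_measurable.
  have UE : \bigcup_n U n = \bigcup_k A k.
    apply/seteqP; split => [w [n _]|w [n _ Anw]].
      by rewrite /U -bigcup_mkord => -[i _ Aiw]; exists i.
    by exists n.+1 => //; rewrite /U -bigcup_mkord; exists n => /=.
  have ndU : nondecreasing_seq U.
    apply/nondecreasing_seqP => n; rewrite /U big_ord_recr/=; apply/subsetPset.
    exact: subsetUl.
  split => // e e0; have e2 : (0 < e / 2)%R by rewrite divr_gt0.
  have cU : P (U n) @[n --> \oo] --> P (\bigcup_k A k).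
    rewrite -UE; apply: (nondecreasing_cvg_mu mU) => //.
    by rewrite UE.
  have [n hn] : exists n, P (\bigcup_k A k) - P (U n) < (e / 2)%:E.
    have finA : P (\bigcup_k A k) \is a fin_num by exact: fin_num_measure.
    have : P (\bigcup_k A k) - (e / 2)%:E < P (\bigcup_k A k).
      by rewrite lteBlDr// lteDl.
    move=> /(@open_ereal_gt' _ _ _) h; have [n _ hn] := cU _ h.
    exists n; have : P (\bigcup_k A k) - (e / 2)%:E < P (U n) := hn n (leqnn n).
    by rewrite !lteBlDr ?fin_num_measure// addeC.
  have [delta [A' [d01 FA' h]]] := (UU n).2 _ e2.
  have /andP[_ d1] := d01.
  exists delta, A'; split => //.
  rewrite [e in leRHS]splitr EFinD; apply: le_trans (leeD (ltW hn) h).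
  apply: le_trans (PsetY_triangle mUA (mU n) (mF (ltW d1) FA')) _.
  rewrite leeD2r//.
  have UA : U n `<=` \bigcup_k A k by rewrite -UE; exact: bigcup_sup.
  rewrite [X in P X](_ : _ = (\bigcup_k A k) `\` U n); last first.
    by rewrite /setY (_ : U n `\` _ = set0) ?setU0//; rewrite setD_eq0.
  rewrite measureD//; last by rewrite -ge0_fin_numE// fin_num_measure.
  by rewrite setIidr.
Qed.

(** Only s = 1 needs an argument: by continuity of paths B_1 is almost surely the limit of B at the
    times 1 - 1 / (n + 1), and measurability for the sigma-algebra [approximable] survives
    limits. *)
Let B_approximable s C : (0 <= s <= 1)%R -> measurable C -> approximable (B s @^-1` C).
Proof.
move=> /andP[s0]; rewrite le_eqVlt => /predU1P[->|s1] mC; last first.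
  apply: (@approximable_filtration s); first by rewrite s0.
  exact: brownian_adapted.
have [mB _ [N0 [mN0 N00 hN0]] _ _] := hB.
have sN n : (0 <= (1 - n.+1%:R^-1 : R) < 1)%R.
  rewrite subr_ge0; apply/andP; split; last by rewrite ltrBlDr ltrDl invr_gt0 ltr0n.
  by rewrite invf_le1 ?ltr0n// ler1n.
have aN0 : approximable N0.
  apply: (@approximable_null set0) => //; last by rewrite setY0.
  by case: sigma_algebra_approximable.
have sA := sigma_algebra_approximable.
have aM : approximable `<=` measurable by move=> A [].
have aCN : approximable (~` N0) by case: sA => _ + _; rewrite -setTD; exact.
(* Killing the process on the null set of discontinuous paths makes the convergence hold
   everywhere. *)
pose X n (w : Omega) := (B (1 - n.+1%:R^-1) w * \1_(~` N0) w)%R.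
pose Y (w : Omega) := (B 1 w * \1_(~` N0) w)%R.
have mI : measurable_fun setT ((\1_(~` N0) : Omega -> R) : g_sigma_algebraType approximable -> R).
  by apply: measurable_indic; apply: sub_sigma_algebra.
have mX n : measurable_fun setT (X n : g_sigma_algebraType approximable -> R).
  apply: measurable_funM => //; apply/(measurable_wrtP sA) => E mE.
  apply: approximable_filtration (sN n) _; apply: brownian_adapted => //.
  by case/andP: (sN n).
have XY w : X n w @[n --> \oo] --> Y w.
  rewrite /X /Y; have [wN|wN] := pselect (N0 w).
    rewrite indicE memNset ?mulr0; last by move=> h; exact: h.
    by under eq_fun do rewrite mulr0; exact: cvg_cst.
  have cB : {within `[0%R, 1%R], continuous (fun t : R => B t w)}.
    by apply: contrapT => h; apply: wN; exact: hN0.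
  have c1 : (1 - n.+1%:R^-1 : R)%R @[n --> \oo] --> (1 : R)%R.
    rewrite -[X in _ --> X]subr0; apply: cvgB; first exact: cvg_cst.
    exact: cvg_harmonic.
  apply: cvgMl; move/subspace_continuousP : cB => /(_ 1%R).
  rewrite /= in_itv/= ler01 lexx => /(_ isT) cB E /cB hE.
  have [k _ hk] := c1 _ hE; exists k => // n /hk /=; apply.
  by rewrite in_itv/=; have /andP[-> /ltW ->] := sN n.
have mY : measurable_fun setT (Y : g_sigma_algebraType approximable -> R).
  by apply: (@measurable_fun_cvg _ (g_sigma_algebraType approximable) R setT X Y) => [m|w _]; [exact: mX|exact: XY].
have aY : approximable (Y @^-1` C).
  by have := mY measurableT C mC; rewrite setTI /measurable/= sigma_algebra_id.
have mBC : measurable (B 1 @^-1` C).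
  by rewrite -[X in measurable X]setTI; apply: mB => //; rewrite ler01 lexx.
apply: (approximable_null aY) => //.
apply: (@subset_measure0 _ _ _ P _ N0) => //.
  by apply: measurable_setY => //; case: aY.
move=> w; rewrite /setY/= => h; apply: contrapT => wN.
have E : Y w = B 1 w by rewrite /Y indicE mem_set// mulr1.
by move: h; rewrite E => -[[]|[]].
Qed.

Lemma measurable_approximable : measurable `<=` approximable.
Proof.
rewrite hOmega => A [A' HA' [N [GN N0 AN]]].
have mA' := sigma_upto_measurable hB (lexx 1%R) HA'.
have mN := sigma_upto_measurable hB (lexx 1%R) GN.
have mA : measurable A by rewrite hOmega; exists A' => //; exists N.
apply: (@approximable_null A') => //; last first.
  by apply: (@subset_measure0 _ _ _ P _ N) => //; exact: measurable_setY.
move: HA'; apply: smallest_sub; first exact: sigma_algebra_approximable.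
move=> E [s /= + [C mC <-]]; rewrite in_itv/= setTI => s01.
exact: B_approximable.
Qed.

(** The sum counts the positive multiples of eta up to y, so eta times it is y rounded down to a
    multiple of eta. *)
Lemma level_sum (eta : R) (y : R) K : (0 < eta)%R -> (0 <= y <= K%:R * eta)%R ->
  (0 <= y - eta * \sum_(k < K) (k.+1%:R * eta <= y)%R%:R <= eta)%R.
Proof.
move=> eta0; elim: K => [|K ih].
  rewrite mul0r => /andP[y0 y1]; rewrite big_ord0 mulr0 subr0 y0; apply: le_trans y1 _.
  exact: ltW.
move=> /andP[y0 yK]; rewrite big_ord_recr/=; have [yK'|Ky] := leP y (K%:R * eta)%R.
  have -> : (K.+1%:R * eta <= y)%R = false.
    by apply/negbTE; rewrite -ltNge; apply: le_lt_trans yK' _; rewrite ltr_pM2r// ltr_nat.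
  by rewrite addr0; apply: ih; rewrite y0.
rewrite (eq_bigr (fun=> 1%R)); last first.
  move=> k _; suff -> : (k.+1%:R * eta <= y)%R by [].
  by apply: le_trans (ltW Ky); rewrite ler_pM2r// ler_nat.
rewrite sumr_const card_ord.
have KE : (K.+1%:R = K%:R + 1 :> R)%R by rewrite natr1.
case: (leP (K.+1%:R * eta)%R y) => h.
  have yE : (y = K.+1%:R * eta)%R by apply/eqP; rewrite eq_le yK h.
  by rewrite yE KE /= mulrDr mulrDl mulr1 mul1r mulrC subrr lexx ltW.
rewrite /= addr0 mulrC; move: yK Ky; rewrite KE mulrDl mul1r => yK Ky.
by apply/andP; split; [rewrite subr_ge0 ltW|rewrite lerBlDl].
Qed.

(** Y + M is rounded down to multiples of eta = e / 2, which writes it through K level sets, and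
    each level set is replaced by an event known before time 1. Rounding costs eta, and K
    replacements of accuracy 1 / (K + 1) cost at most eta more. *)
Theorem filtration_dense (Y : Omega -> R) (M e : R) : measurable_fun setT Y ->
  (forall w, `|Y w| <= M)%R -> (0 < e)%R ->
  exists delta Y' (M' : R), [/\ (0 <= delta < 1)%R, measurable_wrt (Fil delta) Y',
    (forall w, `|Y' w| <= M')%R & \int[P]_w (`|Y w - Y' w|)%R%:E <= e%:E].
Proof.
move=> mY YM e0.
have M0 : (0 <= M)%R by apply: le_trans (YM point).
pose eta := (e / 2)%R; have eta0 : (0 < eta)%R by rewrite divr_gt0.
have q0 : (0 <= 2 * M / eta)%R by rewrite divr_ge0 ?mulr_ge0// ltW.
pose K := Num.bound (2 * M / eta)%R.
have KM : (2 * M <= K%:R * eta)%R.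
  by rewrite -ler_pdivrMr// ltW//; exact: archi_boundP.
pose A (k : nat) := [set w | (k.+1%:R * eta <= Y w + M)%R].
have mA k : measurable (A k).
  rewrite (_ : A k = setT `&` (fun w => Y w + M)%R @^-1` `[(k.+1%:R * eta)%R, +oo[).
    by apply: measurable_funD.
  by rewrite setTI; apply/seteqP; split => w; rewrite /A/= in_itv/= andbT.
have K0 : (0 < K.+1%:R^-1 :> R)%R by rewrite invr_gt0 ltr0n.
have [delta [A' [d01 hA']]] : exists delta (A' : nat -> set Omega), (0 <= delta < 1)%R /\
    forall k, (k < K)%N -> Fil delta (A' k) /\ P (A k `+` A' k) <= (K.+1%:R^-1)%:E.
  (* Only the number of replaced sets varies in the induction; the accuracy stays at 1 / (K + 1). *)
  elim: {-2}K => [|J [d1 [A' [d101 hA']]]].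
    by exists 0%R, (fun=> set0); rewrite lexx ltr01.
  have [_ /(_ _ K0)[d2 [C [d201 FC hC]]]] := measurable_approximable (mA J).
  have /andP[d10 d11] := d101; have /andP[d20 d21] := d201.
  exists (Num.max d1 d2), (fun k => if k == J then C else A' k); split.
    by rewrite le_max d10 gt_max d11 d21.
  move=> k; rewrite ltnS leq_eqVlt => /predU1P[->|kJ].
    rewrite eqxx; split => //; apply: sub_filtration FC; rewrite le_max lexx orbT//.
  have [F1 P1] := hA' k kJ; rewrite ltn_eqF//; split => //.
  by apply: sub_filtration F1; rewrite le_max lexx.
have /andP[_ d1] := d01.
have mA' k : (k < K)%N -> measurable (A' k).
  by move=> /hA'[FA' _]; exact: (mF (ltW d1) FA').
pose Y' w : R := (- M + eta * \sum_(k < K) \1_(A' k) w)%R.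
exists delta, Y', (M + eta * K%:R)%R; split => //.
- apply/(measurable_wrtP (sF _)); apply: measurable_funD => //; apply: measurable_funM => //.
  apply: measurable_sum => k; apply: measurable_indic; apply: sub_sigma_algebra.
  by have [] := hA' k (ltn_ord k).
- move=> w; rewrite /Y'; apply: le_trans (ler_normD _ _) _.
  rewrite normrN (ger0_norm M0) lerD2l ger0_norm; last first.
    by apply: mulr_ge0; [exact: ltW|apply: sumr_ge0].
  rewrite ler_pM2l// -[leRHS]mulr_natl mulr1 -[K in leRHS]card_ord -sumr_const.
  by apply: ler_sum => k _; rewrite indicE; case: (_ \in _).
have mAA' (k : 'I_K) : measurable (A k `+` A' k).
  by apply: measurable_setY => //; exact: mA'.
have mI (k : 'I_K) : measurable_fun setT (fun w => (\1_(A k `+` A' k) w : R)%:E).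
  by apply/measurable_EFinP; exact: measurable_indic.
apply: (@le_trans _ _ (\int[P]_w (eta%:E + eta%:E * \sum_(k < K) (\1_(A k `+` A' k) w : R)%:E))).
  apply: ge0_le_integral_nomeas => w _; first by rewrite lee_fin.
  rewrite sumEFin -EFinM -EFinD lee_fin.
  have /ler_normlP[YM1 YM2] := YM w.
  have y0 : (0 <= Y w + M <= K%:R * eta)%R by apply/andP; split; [lra|apply: le_trans KM; lra].
  have := level_sum eta0 y0.
  rewrite (eq_bigr (fun k : 'I_K => (\1_(A k) w : R))); last first.
    move=> k _; rewrite indicE /A; congr (nat_of_bool _)%:R.
    by apply/idP/idP; rewrite inE.
  set y' := (Y w + M - _)%R => /andP[y'0 y'1].
  have -> : (Y w - Y' w = y' + eta * \sum_(k < K) (\1_(A k) w - \1_(A' k) w))%R.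
    by rewrite sumrB /y' /Y'; ring.
  apply: le_trans (ler_normD _ _) _; rewrite (ger0_norm y'0); apply: lerD => //.
  rewrite normrM (gtr0_norm eta0) ler_pM2l//; apply: le_trans (ler_norm_sum _ _ _) _.
  apply: ler_sum => k _; rewrite !indicE.
  have [Aw|Aw] := boolP (w \in A k); have [A'w|A'w] := boolP (w \in A' k).
  - by rewrite subrr normr0.
  - by rewrite subr0 normr1 mem_set//; left; split; [exact: set_mem|by rewrite notin_setE in A'w].
  - by rewrite sub0r normrN normr1 mem_set//; right; split; [exact: set_mem|by rewrite notin_setE in Aw].
  - by rewrite subrr normr0.
rewrite ge0_integralD//; last 3 first.
- by move=> w _; rewrite lee_fin ltW.
- by move=> w _; apply: mule_ge0; [rewrite lee_fin ltW|apply: sume_ge0 => k _; rewrite lee_fin].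
- by apply: emeasurable_funM => //; exact: emeasurable_sum.
rewrite integral_cst//= probability_setT mule1 ge0_integralZl//; last 3 first.
- exact: emeasurable_sum.
- by move=> w _; apply: sume_ge0 => k _; rewrite lee_fin.
- by rewrite lee_fin ltW.
rewrite ge0_integral_sum//.
apply: (@le_trans _ _ (eta%:E + eta%:E * \sum_(k < K) (K.+1%:R^-1)%:E)).
  rewrite leeD2l//; apply: lee_wpmul2l; first by rewrite lee_fin ltW.
  by apply: lee_sum => k _; rewrite integral_indic// setIT; have [] := hA' k (ltn_ord k).
rewrite sumEFin -EFinM -EFinD lee_fin sumr_const card_ord.
have h : (K.+1%:R^-1 *+ K <= 1 :> R)%R.
  by rewrite -[(_ *+ K)%R]mulr_natr mulrC ler_pdivrMr ?ltr0n// mul1r ler_nat.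
have : (eta * (K.+1%:R^-1 *+ K) <= eta * 1)%R by rewrite ler_pM2l.
move=> h2; rewrite [leRHS](_ : e = eta + eta * 1)%R ?lerD2l//.
by rewrite mulr1 /eta -splitr.
Qed.

End filtration_density.

(** * Approximation of the iterated integral by a second chaos *)

Section integral_subset.
Local Open Scope ereal_scope.
Context d (T : measurableType d) (R : realType) (mu : {measure set T -> \bar R}).

Lemma ge0_le_integral_subset_nomeas (A D : set T) (f g : T -> \bar R) :
  A `<=` D -> (forall x, D x -> 0 <= g x) -> (forall x, A x -> 0 <= f x <= g x) ->
  \int[mu]_(x in A) f x <= \int[mu]_(x in D) g x.
Proof.
move=> AD g0 fg; rewrite [leLHS]integral_mkcond [leRHS]integral_mkcond.
apply: ge0_le_integral_nomeas => x _.
  by rewrite patchE; case: ifPn => // /[!inE] /fg /andP[].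
rewrite !patchE; case: ifPn => xA; last first.
  by case: ifPn => // /[!inE]; exact: g0.
have Ax : A x by exact: set_mem.
by rewrite mem_set; [have /andP[] := fg x Ax|exact: AD].
Qed.

End integral_subset.

Section triangle.
Context {R : realType}.

Definition triangle : set (R * R) := [set q | 0 <= q.1 <= q.2 /\ q.2 <= 1].

Lemma measurable_triangle : measurable triangle.
Proof.
rewrite (_ : triangle = setT `&` (fun q : R * R => (0 <= q.1) && (q.1 <= q.2) && (q.2 <= 1)) @^-1` [set true]).
  have m : measurable_fun setT (fun q : R * R => (0 <= q.1) && (q.1 <= q.2) && (q.2 <= 1)).
    by apply: measurable_and; [apply: measurable_and|]; apply: measurable_fun_ler.
  by apply: m.
by rewrite setTI; apply/seteqP; split => q; rewrite /triangle/=; [move=> [-> ->]|move=> /andP[]].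
Qed.

End triangle.

Section extension_law.
Local Open Scope ereal_scope.
Context {R : realType} {d d' : measure_display}.
Context {Omega : measurableType d} {Omega' : measurableType d'}.
Variables (P : probability Omega R) (B : R -> Omega -> R).
Hypotheses (hB : standard_brownian_motion P B) (hOmega : brownian_space P B).
Variables (P' : probability Omega' R) (pr : Omega' -> Omega) (Z : Omega' -> R).
Hypotheses (hext : is_extension P P' pr) (Z_normal : has_normal_law P' Z 0 1)
  (Z_indep : independent_of P' Z (sigma_upto (fun t w' => B t (pr w')) 1)).
Local Notation gamma := (@normal_prob R 0 1).

(** Independence of [Z] is assumed only from the sigma-field of the lifted B. An event of Omega
    differs from one generated by B by a null set, and [pr] preserves measure, so it extends to all
    measurable events. *)
Lemma extension_joint_law (A : set Omega) (C : set R) : measurable A -> measurable C ->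
  P' (pr @^-1` A `&` Z @^-1` C) = P A * gamma (id @^-1` C).
Proof.
move=> mA mC; have [mpr prP] := hext; have [mZ lZ] := Z_normal.
have mpre E : measurable E -> measurable (pr @^-1` E).
  by move=> mE; rewrite -[X in measurable X]setTI; exact: mpr.
have mZC : measurable (Z @^-1` C) by rewrite -[X in measurable X]setTI; exact: mZ.
have : measurable A by [].
rewrite {1}hOmega => -[A' HA' [N [GN N0 AN]]].
have mA' := sigma_upto_measurable hB (lexx 1%R) HA'.
have mN := sigma_upto_measurable hB (lexx 1%R) GN.
have PN0 : P' (pr @^-1` N) = 0 by rewrite prP.
have AN' : pr @^-1` A `+` pr @^-1` A' `<=` pr @^-1` N by move=> w; exact: AN.
rewrite (eq_measure_mod_null (mpre _ mA) (mpre _ mA') (mpre _ mN) mZC PN0 AN').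
have -> : P A = P A'.
  by have := eq_measure_mod_null mA mA' mN measurableT N0 AN; rewrite !setIT.
rewrite setIC Z_indep//; first by rewrite lZ// prP// muleC.
have sS := sigma_algebra_sigma_upto (fun t w' => B t (pr w')) 1.
suff : sigma_upto B 1 `<=` [set E | sigma_upto (fun t w' => B t (pr w')) 1 (pr @^-1` E)] by exact.
apply: smallest_sub => [|E [s /= s01 [C' mC' <-]]].
  have [s0 sC sU] := sS; split => /=.
  - by rewrite preimage_set0.
  - by move=> E hE; rewrite setTD preimage_setC -setTD; exact: sC.
  - by move=> E hE; rewrite preimage_bigcup; exact: sU.
by apply: sub_sigma_algebra; exists s => //; exists C' => //; rewrite !setTI.
Qed.

End extension_law.

(** * Energy and continuity of the process u *)

Section kernel.
Local Open Scope ereal_scope.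
Context {R : realType} {d : measure_display} {Omega : measurableType d}.
Variables (P : probability Omega R) (B : R -> Omega -> R).
Hypotheses (hB : standard_brownian_motion P B) (hOmega : brownian_space P B).
Local Notation Fil := (natural_filtration P B).
Local Notation mu := (@lebesgue_measure R).
Local Notation I01 := (`[0%R, 1%R]%classic : set R).

Variable u : R -> R -> Omega -> R.
Hypotheses (u_meas : measurable_fun
     [set p : R * R * Omega | 0 <= p.1.1 <= p.1.2 /\ p.1.2 <= 1]%R
     (fun p => u p.1.1 p.1.2 p.2))
  (u_adapted : forall s t : R, (0 <= s)%R -> (s <= t)%R -> (t <= 1)%R ->
     measurable_wrt (Fil s) (u s t))
  (u_L2 : \int[mu]_(t in `[0%R, 1%R]) \int[mu]_(s in `[0%R, t])
               'E_P[fun w => ((u s t w) ^+ 2)%R] < +oo)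
  (u_cont :
    (fun p : R * R => 'E_P[fun w => ((u p.1 p.2 w - u 1 1 w) ^+ 2)%R])
      @ within [set p | 0 <= p.1 <= p.2 /\ p.2 <= 1]%R (nbhs ((1, 1) : R * R)%R)
      --> 0).

Definition energy s r : \bar R := \int[P]_w ((u s r w) ^+ 2)%:E.

Definition total_energy : \bar R := \int[mu]_(r in I01) \int[mu]_(s in `[0%R, r]) energy s r.

Lemma total_energy_lty : total_energy < +oo.
Proof. by move: u_L2; rewrite unlock. Qed.

Lemma u_measurable s r : (0 <= s)%R -> (s <= r)%R -> (r <= 1)%R -> measurable_fun setT (u s r).
Proof.
move=> s0 sr r1; have s1 := le_trans sr r1.
exact: (measurable_wrt_measurable (filtration_measurable hOmega s1) (u_adapted s0 sr r1)).
Qed.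

Lemma energy_ge0 s r : 0 <= energy s r.
Proof. by apply: integral_ge0 => w _; rewrite lee_fin sqr_ge0. Qed.

(** The process is controlled only for s <= r; extension by zero puts its energy in the scope of
    Tonelli. *)
Definition triangle_energy : R * R -> \bar R := (fun q => energy q.1 q.2) \_ triangle.

Lemma triangle_energy_ge0 q : 0 <= triangle_energy q.
Proof. by rewrite /triangle_energy patchE; case: ifPn => // _; exact: energy_ge0. Qed.

Lemma measurable_triangle_energy : measurable_fun setT triangle_energy.
Proof.
apply/(measurable_restrictT _ measurable_triangle).
apply: measurable_section_integral; first exact: measurable_triangle.
- by apply/measurable_EFinP/measurable_funX; exact: u_meas.
- by move=> q w _; rewrite lee_fin sqr_ge0.
Qed.

Lemma integral_triangle_energy r : (0 <= r <= 1)%R ->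
  \int[mu]_(s in I01) triangle_energy (s, r) = \int[mu]_(s in `[0%R, r]) energy s r.
Proof.
move=> /andP[r0 r1]; rewrite [LHS]integral_mkcond [RHS]integral_mkcond.
apply: eq_integral => s _; rewrite /triangle_energy !patchE.
have -> : (s \in `[0%R, r]%classic) = ((s, r) \in triangle).
  apply/idP/idP => /set_mem; rewrite /triangle/= ?in_itv/=.
    by move=> h; apply/mem_set; split.
  by move=> [h _]; rewrite mem_set//= in_itv.
case: ifPn => // sI; rewrite ifN//; apply: contra sI => /set_mem [/= /andP[s0 sr] _].
by rewrite mem_set//= in_itv/= s0 (le_trans sr).
Qed.

Lemma measurable_slice_energy :
  measurable_fun I01 (fun r => \int[mu]_(s in `[0%R, r]) energy s r).
Proof.
apply: (eq_measurable_fun (fun r => \int[mu]_s (triangle_energy (s, r)))).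
  move=> r /[!inE]/=; rewrite in_itv/= => r01; rewrite -integral_triangle_energy//.
  rewrite [RHS]integral_mkcond; apply: eq_integral => s _.
  rewrite [RHS]patchE; case: ifPn => // sI; rewrite /triangle_energy patchE ifN//.
  apply: contra sI => /set_mem [/= /andP[s0 sr] r1].
  by rewrite mem_set//= in_itv/= s0 (le_trans sr).
apply: measurable_funTS.
exact: (@measurable_fun_fubini_tonelli_G _ _ (measurableTypeR R) R R mu _
  measurable_triangle_energy triangle_energy_ge0).
Qed.

Lemma u_continuity (e : R) : (0 < e)%R -> exists delta0 : R, (0 <= delta0 < 1)%R /\
  forall s r, (delta0 <= s)%R -> (s <= r)%R -> (r <= 1)%R ->
    \int[P]_w ((u s r w - u 1 1 w) ^+ 2)%:E < e%:E.
Proof.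
move=> e0.
have := u_cont; rewrite unlock => /(_ [set x | x < e%:E]) /=.
move=> /(_ (open_ereal_lt' (y := e%:E) _)); rewrite lte_fin => /(_ e0).
case=> [[U V] /= [[rU /= rU0 hU] [rV /= rV0 hV]]] hUV.
pose r := Num.min (Num.min rU rV) 1%R.
have r0 : (0 < r)%R by rewrite /r !lt_min rU0 rV0 ltr01.
have rUle : (r <= rU)%R by rewrite /r !ge_min lexx.
have rVle : (r <= rV)%R by rewrite /r !ge_min lexx orbT.
have r1 : (r <= 1)%R by rewrite /r ge_min lexx orbT.
exists (1 - r / 2)%R; split; first by apply/andP; split; lra.
move=> s t ds st t1; apply: (hUV (s, t)) => /=.
  split; [apply: hU|apply: hV]; rewrite /ball/= ger0_norm; lra.
by split => //; apply/andP; split => //; lra.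
Qed.

(** Finiteness comes from combining the two hypotheses on u: were E[u_{1,1}^2] infinite,
    L^2-continuity would make the energy infinite near (1, 1) in the triangle, against finite total
    energy. *)
Lemma square_integrable_u11 : square_integrable P (u 1 1).
Proof.
have mu11 : measurable_fun setT (u 1 1) by apply: u_measurable; rewrite ?ler01.
split => //; rewrite ltNge leye_eq; apply/negP => /eqP uoo.
have [d0 [/andP[d00 d01] hd]] := u_continuity ltr01.
have eoo s r : (d0 <= s)%R -> (s <= r)%R -> (r <= 1)%R -> energy s r = +oo.
  move=> ds sr r1; apply/eqP; rewrite -leye_eq leNgt; apply/negP => lt.
  have s0 := le_trans d00 ds.
  have su : square_integrable P (u s r) by split => //; exact: u_measurable.
  have sd : square_integrable P (fun w => u s r w - u 1 1 w)%R.
    split; first by apply: measurable_funB => //; exact: u_measurable.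
    by apply: lt_trans (hd s r ds sr r1) _; rewrite ltry.
  have [_] := square_integrableD su (square_integrableZ (-1) sd).
  rewrite (_ : (fun w => _) = (fun w => (u 1 1 w ^+ 2)%:E)); first by rewrite uoo.
  by apply/funext => w; congr ((_ ^+ 2)%:E); ring.
(* With s in [d0, m] and r in [m, 1] the order s <= r is automatic, and this rectangle has positive
   area. *)
pose m := ((1 + d0) / 2)%R.
have : +oo <= total_energy.
  rewrite /total_energy -[leLHS](_ : \int[mu]_(r in `[m, 1%R]) \int[mu]_(s in `[d0, m]) (cst +oo) s = _).
    apply: ge0_le_integral_subset_nomeas.
    - move=> r /=; rewrite !in_itv/= => /andP[mr ->]; rewrite andbT; apply: le_trans mr.
      by rewrite /m; lra.
    - by move=> r _; apply: integral_ge0 => s _; exact: energy_ge0.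
    - move=> r /=; rewrite in_itv/= => /andP[mr r1]; apply/andP; split.
        by apply: integral_ge0 => s _ /=; rewrite leey.
      apply: ge0_le_integral_subset_nomeas.
      + move=> s /=; rewrite !in_itv/= => /andP[ds sm].
        by rewrite (le_trans d00 ds) (le_trans sm mr).
      + by move=> s _; exact: energy_ge0.
      + move=> s /=; rewrite in_itv/= => /andP[ds sm]; rewrite leey/= eoo//.
        exact: le_trans sm mr.
  have itv_oo (a b : R) : (a < b)%R -> \int[mu]_(s in `[a, b]) (cst +oo) s = +oo.
    move=> ab; rewrite integral_cst//.
    have := @lebesgue_measure_itv R `[a, b]; rewrite /= lte_fin ab => ->.
    by rewrite -EFinB gt0_mulye// lte_fin subr_gt0.
  transitivity (\int[mu]_(r in `[m, 1%R]) (cst +oo) r).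
    by apply: eq_integral => r _; apply: itv_oo; rewrite /m; lra.
  by apply: itv_oo; rewrite /m; lra.
by rewrite leNgt total_energy_lty.
Qed.

End kernel.

(** * Approximation error for one fixed function phi *)

Section chaos_approximation.
Local Open Scope ereal_scope.
Context {R : realType} {d : measure_display} {Omega : measurableType d}.
Variables (P : probability Omega R) (B : R -> Omega -> R).
Hypotheses (hB : standard_brownian_motion P B) (hOmega : brownian_space P B).
Local Notation Fil := (natural_filtration P B).
Local Notation mu := (@lebesgue_measure R).
Local Notation I01 := (`[0%R, 1%R]%classic : set R).

Variable u : R -> R -> Omega -> R.
Hypotheses (u_meas : measurable_fun
     [set p : R * R * Omega | 0 <= p.1.1 <= p.1.2 /\ p.1.2 <= 1]%R
     (fun p => u p.1.1 p.1.2 p.2))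
  (u_adapted : forall s t : R, (0 <= s)%R -> (s <= t)%R -> (t <= 1)%R ->
     measurable_wrt (Fil s) (u s t)).

Variables (delta e1 : R).
Hypotheses (delta01 : (0 <= delta < 1)%R) (e10 : (0 <= e1)%R)
  (u_near : forall s r, (delta <= s)%R -> (s <= r)%R -> (r <= 1)%R ->
    \int[P]_w ((u s r w - u 1 1 w) ^+ 2)%:E <= e1%:E)
  (su : square_integrable P (u delta delta)).

Let ud := u delta delta.
Let Cd := fine (\int[P]_w ((ud w) ^+ 2)%:E).

Let CdE : \int[P]_w ((ud w) ^+ 2)%:E = Cd%:E.
Proof.
rewrite /Cd fineK// ge0_fin_numE; first by case: su.
by apply: integral_ge0 => w _; rewrite lee_fin sqr_ge0.
Qed.

Let Cd0 : (0 <= Cd)%R.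
Proof. by apply: fine_ge0; apply: integral_ge0 => w _; rewrite lee_fin sqr_ge0. Qed.

Let mu_ s r : (0 <= s)%R -> (s <= r)%R -> (r <= 1)%R -> measurable_fun setT (u s r).
Proof. exact: (u_measurable hOmega u_adapted). Qed.

Let d0 : (0 <= delta)%R. Proof. by case/andP: delta01. Qed.
Let d1 : (delta <= 1)%R. Proof. by case/andP: delta01 => _ /ltW. Qed.

Let mud : measurable_fun setT ud. Proof. exact: mu_. Qed.

Lemma u_near_ud s r : (delta <= s)%R -> (s <= r)%R -> (r <= 1)%R ->
  \int[P]_w ((u s r w - ud w) ^+ 2)%:E <= (4 * e1)%:E.
Proof.
move=> ds sr r1.
have msr := mu_ (le_trans d0 ds) sr r1.
have m11 : measurable_fun setT (u 1 1) by apply: mu_; rewrite ?ler01.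
rewrite (_ : (fun w => _) = (fun w => ((u s r w - u 1 1 w + (u 1 1 w - ud w)) ^+ 2)%:E)); last first.
  by apply/funext => w; rewrite subrKA.
apply: le_trans (integral_sqrD_le _ _ _) _; [exact: measurable_funB|exact: measurable_funB|].
under [X in _ + _ * X]eq_integral do rewrite -sqrrN opprB.
rewrite (_ : 4 * e1 = 2 * e1 + 2 * e1)%R; last by ring.
rewrite [leRHS]EFinD !EFinM; apply: leeD; apply: lee_wpmul2l => //; exact: u_near.
Qed.

Variables (phi : R -> R) (M eta : R).
Hypotheses (mphi : measurable_fun I01 phi)
  (phiM : forall s, (0 <= s <= 1)%R -> (0 <= phi s <= M)%R)
  (eta0 : (0 <= eta)%R)
  (phi_eta : forall s r, (0 <= s <= delta)%R -> (0 <= r <= 1)%R -> (phi s * phi r <= eta)%R).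

Let q := tail_part delta phi.

Let mq : measurable_fun setT q. Proof. exact: measurable_tail_part. Qed.

Definition tail_mass : R := fine (\int[mu]_(s in I01) (tail_part delta phi s ^+ 2)%:E).

Let hq : has_integral mu I01 (fun s => q s ^+ 2)%R tail_mass.
Proof.
have M0 : (0 <= M)%R.
  by have := @phiM 0%R; rewrite lexx ler01 => /(_ isT)/andP[]; exact: le_trans.
apply: (@measurable_bounded_has_integral _ _ (M ^+ 2)%R).
  by apply: measurable_funTS; exact: measurable_funX.
move=> s /phiM /andP[h1 h2]; rewrite ger0_norm ?sqr_ge0// ler_sqr ?nnegrE//.
  by rewrite /q /tail_part indicE; case: (_ \in _); rewrite ?mulr1 ?mulr0.
by rewrite /q /tail_part indicE; case: (_ \in _); rewrite ?mulr1 ?mulr0.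
Qed.

(** Three sources of error: for s <= delta the tail vanishes and phi(s) phi(r) <= eta leaves the
    energy term; for delta < s <= r, replacing u_{s,r} by u_{delta,delta} costs 4 e1 in squared L^2
    norm; and a - b is the error of the step kernel. For s > r only the last one remains. *)
Let kernel_estimate s r (a b : R) : (0 <= s <= 1)%R -> (0 <= r <= 1)%R ->
  a = (q s * q r * \1_(`[0%R, r]) s)%R ->
  \int[P]_w ((phi s * phi r * u s r w * \1_(`[0%R, r]) s - b * ud w) ^+ 2)%:E <=
  2%:E * ((eta ^+ 2)%:E * triangle_energy P u (s, r)) +
  (8 * e1 * q r ^+ 2 * q s ^+ 2 + 2 * Cd * (a - b) ^+ 2)%:E.
Proof.
move=> /andP[s0 s1] /andP[r0 r1] aE.
have h2 : \int[P]_w (((a - b) * ud w) ^+ 2)%:E = ((a - b) ^+ 2 * Cd)%:E.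
  under eq_integral do rewrite exprMn EFinM.
  rewrite ge0_integralZl//.
  - by rewrite CdE -EFinM.
  - by apply/measurable_EFinP; exact: measurable_funX.
  - by move=> w _; rewrite lee_fin sqr_ge0.
  - by rewrite lee_fin sqr_ge0.
rewrite (_ : (fun w => _) = (fun w => (((phi s * phi r * u s r w * \1_(`[0%R, r]) s - a * ud w) +
   (a - b) * ud w) ^+ 2)%:E)); last first.
  by apply/funext => w; congr ((_ ^+ 2)%:E); ring.
have ab0 : 0 <= ((2 * Cd * (a - b) ^+ 2)%R)%:E.
  by rewrite lee_fin; apply: mulr_ge0; [exact: mulr_ge0|exact: sqr_ge0].
have te0 : 0 <= 2%:E * ((eta ^+ 2)%:E * triangle_energy P u (s, r)).
  by apply: mule_ge0 => //; apply: mule_ge0; [rewrite lee_fin sqr_ge0|exact: triangle_energy_ge0].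
have e1q : 0 <= ((8 * e1 * q r ^+ 2 * q s ^+ 2)%R)%:E.
  rewrite lee_fin; apply: mulr_ge0; last exact: sqr_ge0.
  by apply: mulr_ge0; [exact: mulr_ge0|exact: sqr_ge0].
have [sr|rs] := leP s r; last first.
  have I0 : \1_(`[0%R, r]) s = 0%R :> R.
    by rewrite indicE mem_setE in_itv/= [(s <= r)%R]leNgt rs andbF.
  have a0 : a = 0%R by rewrite aE I0 mulr0.
  rewrite (_ : (fun w => _) = (fun w => (((a - b) * ud w) ^+ 2)%:E)); last first.
    by apply/funext => w; rewrite I0 a0 mul0r mulr0 subr0 add0r.
  rewrite h2; apply: (@le_trans _ _ ((2 * Cd * (a - b) ^+ 2)%R)%:E).
    rewrite lee_fin; have : (0 <= Cd * (a - b) ^+ 2)%R.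
      by apply: mulr_ge0 => //; exact: sqr_ge0.
    by rewrite -mulrA (mulrC _ Cd); set z := (Cd * _)%R; lra.
  by rewrite [X in _ <= _ + X]EFinD addeA leeDr// adde_ge0.
have msr := mu_ s0 sr r1.
have I1 : \1_(`[0%R, r]) s = 1%R :> R by rewrite indicE mem_setE in_itv/= s0 sr.
rewrite I1 mulr1 in aE *.
apply: le_trans (integral_sqrD_le _ _ _) _.
- by apply: measurable_funB; apply: measurable_funM => //; apply: measurable_funM.
- exact: measurable_funM.
rewrite h2 [X in _ <= _ + X]EFinD addeA; apply: leeD; last by rewrite -EFinM lee_fin mulrA (mulrC _ Cd) mulrA (mulrC Cd).
have te : triangle_energy P u (s, r) = energy P u s r.
  by rewrite /triangle_energy patchE mem_set//; split => //=; rewrite s0.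
have [ds|sd] := ltP delta s.
  have qs : q s = phi s by rewrite /q /tail_part indicE mem_setE in_itv/= ds s1 mulr1.
  have qr : q r = phi r by rewrite /q /tail_part indicE mem_setE in_itv/= (lt_le_trans ds sr) r1 mulr1.
  apply: (@le_trans _ _ (8 * e1 * q r ^+ 2 * q s ^+ 2)%:E); last first.
    by rewrite leeDr.
  rewrite (_ : (fun w => _) = (fun w => ((phi s * phi r) ^+ 2)%:E * ((u s r w - ud w) ^+ 2)%:E)); last first.
    by apply/funext => w; rewrite -EFinM; congr (_%:E); rewrite aE qs qr; ring.
  rewrite ge0_integralZl//; last 3 first.
  - by apply/measurable_EFinP/measurable_funX/measurable_funB.
  - by move=> w _; rewrite lee_fin sqr_ge0.
  - by rewrite lee_fin sqr_ge0.
  apply: (@le_trans _ _ (2%:E * (((phi s * phi r) ^+ 2)%:E * (4 * e1)%:E))).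
    apply: lee_wpmul2l => //; apply: lee_wpmul2l; first by rewrite lee_fin sqr_ge0.
    exact: u_near_ud (ltW ds) sr r1.
  by rewrite -!EFinM lee_fin qs qr le_eqVlt; apply/orP; left; apply/eqP; ring.
have qs : q s = 0%R by rewrite /q /tail_part indicE mem_setE in_itv/= ltNge sd/= mulr0.
rewrite te [leRHS](_ : _ = 2%:E * ((eta ^+ 2)%:E * energy P u s r)); last first.
  by rewrite qs expr0n mulr0 adde0.
apply: lee_wpmul2l => //; rewrite /energy -ge0_integralZl//; last 3 first.
- by apply/measurable_EFinP; exact: measurable_funX.
- by move=> w _; rewrite lee_fin sqr_ge0.
- by rewrite lee_fin sqr_ge0.
apply: ge0_le_integral_nomeas => w _; first by rewrite lee_fin sqr_ge0.
rewrite aE qs !mul0r subr0 -EFinM lee_fin mulr1 exprMn.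
apply: ler_wpM2r; first exact: sqr_ge0.
have := phi_eta (s := s) (r := r); rewrite s0 sd r0 r1 => /(_ isT isT) h.
have /andP[ps _] : (0 <= phi s <= M)%R by apply: phiM; rewrite s0.
have /andP[prr _] : (0 <= phi r <= M)%R by apply: phiM; rewrite r0.
by rewrite ler_sqr ?nnegrE// mulr_ge0.
Qed.

Let mass0 : (0 <= tail_mass)%R.
Proof. by apply: fine_ge0; apply: integral_ge0 => s _; rewrite lee_fin sqr_ge0. Qed.

Let slice_estimate N (t c : nat -> R) (bnd : R -> R) r : (0 <= r <= 1)%R ->
  \int[mu]_(s in I01) ((q s * q r * \1_(`[0%R, r]) s - step2 N t c s r) ^+ 2)%:E
    <= (bnd r)%:E ->
  \int[mu]_(s in I01) \int[P]_w
    ((phi s * phi r * u s r w * \1_(`[0%R, r]) s - step2 N t c s r * ud w) ^+ 2)%:E <=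
  2%:E * ((eta ^+ 2)%:E * \int[mu]_(s in `[0%R, r]) energy P u s r) +
  (8 * e1 * tail_mass * q r ^+ 2 + 2 * Cd * bnd r)%:E.
Proof.
move=> r01 hbnd.
have mI' : @measurable _ (measurableTypeR R) I01 by [].
pose g s := ((q s * q r * \1_(`[0%R, r]) s - step2 N t c s r) ^+ 2)%R.
have mg : measurable_fun setT g.
  apply/measurable_funX/measurable_funB; first by apply: measurable_funM => //; exact: measurable_funM.
  apply: measurable_sum => j; rewrite (_ : (fun s => _) = (fun s => \sum_(i < N)
      if (i < j)%N then c i * c j * cell t i s * cell t j r else 0)%R); last first.
    by apply/funext => s; rewrite big_mkcond.
  apply: measurable_sum => i; case: (i < j)%N => //.
  by apply: measurable_funM => //; apply: measurable_funM => //; exact: measurable_indic.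
have mte : measurable_fun setT (fun s => triangle_energy P u (s, r)).
  exact: (measurableT_comp (measurable_triangle_energy P u_meas)
    (@pair2_measurable _ _ (measurableTypeR R) (measurableTypeR R) r)).
have A0 : (0 <= 8 * e1 * q r ^+ 2)%R by apply: mulr_ge0; [exact: mulr_ge0|exact: sqr_ge0].
apply: (@le_trans _ _ (\int[mu]_(s in I01)
   (2%:E * ((eta ^+ 2)%:E * triangle_energy P u (s, r)) +
    ((8 * e1 * q r ^+ 2)%:E * (q s ^+ 2)%:E + (2 * Cd)%:E * (g s)%:E)))).
  apply: ge0_le_integral_nomeas => s.
    by move=> _; apply: integral_ge0 => w _; rewrite lee_fin sqr_ge0.
  by rewrite /= in_itv/= => s01; rewrite -!EFinM -EFinD; exact: kernel_estimate.
have te0 s : 0 <= triangle_energy P u (s, r) by exact: triangle_energy_ge0.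
have eta20 : 0 <= (eta ^+ 2)%:E by rewrite lee_fin sqr_ge0.
have Cd20 : 0 <= (2 * Cd)%:E by rewrite lee_fin mulr_ge0.
have A0' : 0 <= (8 * e1 * q r ^+ 2)%:E by rewrite lee_fin.
have q20 s : 0 <= (q s ^+ 2)%:E by rewrite lee_fin sqr_ge0.
have g0 s : 0 <= (g s)%:E by rewrite lee_fin sqr_ge0.
have mte' : measurable_fun I01 (fun s => triangle_energy P u (s, r)) by exact: measurable_funTS.
have mq' : measurable_fun I01 (fun s => (q s ^+ 2)%:E).
  by apply: measurable_funTS; apply/measurable_EFinP/measurable_funX.
have mg' : measurable_fun I01 (fun s => (g s)%:E).
  by apply: measurable_funTS; apply/measurable_EFinP.
have A1 : measurable_fun I01 (fun s => (eta ^+ 2)%:E * triangle_energy P u (s, r)).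
  exact: emeasurable_funM.
have A2 : measurable_fun I01 (fun s => (8 * e1 * q r ^+ 2)%:E * (q s ^+ 2)%:E).
  exact: emeasurable_funM.
have A3 : measurable_fun I01 (fun s => (2 * Cd)%:E * (g s)%:E).
  exact: emeasurable_funM.
rewrite (ge0_integralD mu mI'); first last.
- exact: emeasurable_funD.
- by move=> s _; apply: adde_ge0; apply: mule_ge0.
- exact: emeasurable_funM.
- by move=> s _; apply: mule_ge0 => //; apply: mule_ge0.
rewrite (ge0_integralD mu mI')//; first last.
- by move=> s _; apply: mule_ge0.
- by move=> s _; apply: mule_ge0.
rewrite !(ge0_integralZl mu mI')//; last by move=> s _; apply: mule_ge0.
rewrite integral_triangle_energy//; apply: leeD => //.
have [_ ->] := hq.
rewrite [leRHS]EFinD; apply: leeD.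
  by rewrite -EFinM lee_fin le_eqVlt; apply/orP; left; apply/eqP; ring.
by rewrite [leRHS]EFinM; apply: lee_wpmul2l.
Qed.

(** The bound keeps the errors apart because they are made small by different means: eta and the
    mass by taking n large, e1 by moving delta to 1, and k by refining the subdivision once n and
    delta are fixed. *)
Theorem chaos_approximation (F : Omega -> R) (k : R) :
  is_iterated_ito_integral P B (fun s t w => phi s * phi t * u s t w)%R F ->
  (0 < k)%R ->
  exists (v : R) (G D : Omega -> R), [/\ (0 <= v)%R, (`|v - tail_mass| <= k)%R,
    gaussian_indep P (Fil delta) G (Num.sqrt v),
    measurable_fun setT D /\ \int[P]_w ((D w) ^+ 2)%:E <= k%:E &
    \int[P]_w ((F w - 2^-1 * u delta delta w * (G w ^+ 2 - v - D w)) ^+ 2)%:E <=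
    16%:E * (2%:E * ((eta ^+ 2)%:E * total_energy P u) +
      (8 * e1 * tail_mass ^+ 2 + k)%:E)].
Proof.
move=> hF k0.
have kurt0 : (0 <= @kurtosis R)%R.
  by apply: fine_ge0; apply: integral_ge0 => w _; rewrite lee_fin sqr_ge0.
(* With step accuracy k / C, the variance, the quadratic error and the kernel error, of weights 1,
   [kurtosis] and 2 Cd, are each at most k. *)
pose C := (1 + @kurtosis R + 2 * Cd)%R.
have C1 : (1 <= C)%R by rewrite /C; have := Cd0; lra.
have e0 : (0 < k / C)%R by rewrite divr_gt0//; lra.
have eC : (C * (k / C) = k)%R by rewrite mulrCA divff ?mulr1// gt_eqF//; lra.
have [N [t [c [bnd [t0 tN t_homo c0 [hv [mbnd bnd0] hbnd ibnd hc]]]]]] :=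
  step_approximation mphi phiM delta01 e0.
have Fu : measurable_wrt (Fil delta) ud by exact: u_adapted.
exists (step_variance t c N), (chaos1 B t c N), (quadratic_error B N t c); split.
- exact: step_variance_ge0.
- apply: le_trans hv _; rewrite ler_pdivrMr; last by lra.
  by rewrite ler_peMr // ltW.
- exact: (gaussian_indep_chaos1 hB hOmega d0 t0 tN t_homo c0).
- have hD := quadratic_error_variance hB hOmega c d0 t0 tN t_homo.
  have [_ ->] := hD; split.
    apply: measurable_sum => i; apply: measurable_funM => //; apply: measurable_funB => //.
    have ti0 (j : nat) : (0 <= t j)%R by apply: le_trans d0 (le_trans t0 _); exact: t_homo.
    have ti1 (j : nat) : (j <= N)%N -> (t j <= 1)%R by move=> jN; apply: le_trans tN; exact: t_homo.
    apply: measurable_funX; apply: measurable_funB; apply: (brownian_measurable hB).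
      by rewrite ti0 ti1.
    by rewrite ti0 ti1// ltnW.
  rewrite lee_fin -eC; apply: (@le_trans _ _ (@kurtosis R * (k / C))%R).
    exact: ler_wpM2l.
  by apply: ler_wpM2r; [exact: ltW|rewrite /C; have := Cd0; lra].
have mI' : @measurable _ (measurableTypeR R) I01 by [].
pose E r := \int[mu]_(s in `[0%R, r]) energy P u s r.
have E0 r : 0 <= E r by apply: integral_ge0 => s _; exact: energy_ge0.
have mE : measurable_fun I01 E by exact: measurable_slice_energy.
pose G r := 2%:E * ((eta ^+ 2)%:E * E r) +
  ((8 * e1 * tail_mass)%:E * (q r ^+ 2)%:E + (2 * Cd)%:E * (bnd r)%:E).
have mq' : measurable_fun I01 (fun s => (q s ^+ 2)%:E).
  by apply: measurable_funTS; apply/measurable_EFinP/measurable_funX.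
have mb' : measurable_fun I01 (fun s => (bnd s)%:E).
  by apply: measurable_funTS; apply/measurable_EFinP.
have A1 : measurable_fun I01 (fun r => (eta ^+ 2)%:E * E r) by exact: emeasurable_funM.
have A1' : measurable_fun I01 (fun r => 2%:E * ((eta ^+ 2)%:E * E r)) by exact: emeasurable_funM.
have A2 : measurable_fun I01 (fun r => (8 * e1 * tail_mass)%:E * (q r ^+ 2)%:E).
  exact: emeasurable_funM.
have A3 : measurable_fun I01 (fun r => (2 * Cd)%:E * (bnd r)%:E) by exact: emeasurable_funM.
have A23 : measurable_fun I01
    (fun r => (8 * e1 * tail_mass)%:E * (q r ^+ 2)%:E + (2 * Cd)%:E * (bnd r)%:E).
  exact: emeasurable_funD.
have mG : measurable_fun I01 G by exact: emeasurable_funD.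
have := @iterated_ito_integral_le _ _ _ _ _ hB hOmega _ _ N t c d0 t0 tN t_homo Fu su _ _ G hF mG.
have hG r : (0 <= r <= 1)%R -> \int[mu]_(s in I01) \int[P]_w
    ((phi s * phi r * u s r w * \1_(`[0%R, r]) s - step2 N t c s r * ud w) ^+ 2)%:E <= G r.
  move=> r01; apply: le_trans (slice_estimate r01 (hbnd r r01)) _.
  by rewrite [X in _ + X <= _]EFinD !EFinM.
move=> /(_ hG) hle.
rewrite (_ : (fun w => _) = (fun w => ((F w - ud w * chaos2 B N t c w) ^+ 2)%:E)); last first.
  by apply/funext => w; congr ((_ ^+ 2)%:E); rewrite chaos2E /ud; ring.
apply: le_trans hle _; apply: lee_wpmul2l => //.
have eta20 : 0 <= (eta ^+ 2)%:E by rewrite lee_fin sqr_ge0.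
have Cd20 : 0 <= (2 * Cd)%:E by rewrite lee_fin mulr_ge0.
have A0' : 0 <= (8 * e1 * tail_mass)%:E by rewrite lee_fin; apply: mulr_ge0 => //; exact: mulr_ge0.
have q20 s : 0 <= (q s ^+ 2)%:E by rewrite lee_fin sqr_ge0.
have b0 s : 0 <= (bnd s)%:E by rewrite lee_fin.
rewrite (ge0_integralD mu mI')//; first last.
- by move=> s _; apply: adde_ge0; apply: mule_ge0.
- by move=> s _; apply: mule_ge0 => //; apply: mule_ge0.
rewrite (ge0_integralD mu mI')//; first last.
- by move=> s _; apply: mule_ge0.
- by move=> s _; apply: mule_ge0.
rewrite !(ge0_integralZl mu mI')//; last by move=> s _; apply: mule_ge0.
apply: leeD => //; have [_ ->] := hq.
rewrite [leRHS]EFinD; apply: leeD.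
  by rewrite -EFinM lee_fin le_eqVlt; apply/orP; left; apply/eqP; ring.
apply: (@le_trans _ _ ((2 * Cd)%:E * (k / C)%:E)); first exact: lee_wpmul2l.
rewrite -EFinM lee_fin -[leRHS]eC; apply: ler_wpM2r; first exact: ltW.
by rewrite /C; have := kurt0; lra.
Qed.

End chaos_approximation.

(** * Stable convergence *)

Section comparison.
Context {R : realType} {d : measure_display} {T : measurableType d}.
Variable P : probability T R.

Lemma bounded_integrable (f : T -> R) (M : R) : measurable_fun setT f ->
  (forall w, `|f w| <= M) -> P.-integrable setT (EFin \o f).
Proof.
move=> mf fM; apply: measurable_bounded_integrable => //.
  by apply: le_lt_trans (probability_le1 P measurableT) _; rewrite ltry.
exists M; split; first exact: num_real.
by move=> x Mx w _; exact: le_trans (fM w) (ltW Mx).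
Qed.

Lemma expectation_diff_le (f g k : T -> R) (r : R) :
  P.-integrable setT (EFin \o f) -> P.-integrable setT (EFin \o g) ->
  (forall w, `|f w - g w| <= k w) -> (\int[P]_w (k w)%:E <= r%:E)%E ->
  `|fine 'E_P[f] - fine 'E_P[g]| <= r.
Proof.
move=> intf intg fgk kr; rewrite unlock -fineB; [|exact: integrable_fin_num..].
have intfg : P.-integrable setT (EFin \o (fun w => f w - g w)).
  exact: (integrableB measurableT intf intg).
rewrite -integralB_EFin// -fine_abse; last exact: (integrable_fin_num _ intfg).
rewrite -lee_fin fineK ?abse_fin_num; last exact: (integrable_fin_num _ intfg).
apply: le_trans kr; apply: le_trans (le_abse_integral _ _ _) _ => //.
  by case/integrableP : intfg.
by apply: ge0_le_integral_nomeas => w _; rewrite -?EFinB ?lee_fin.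
Qed.

(** The weight balances a factor of order 1 against one of order k; it stands in for the
    Cauchy-Schwarz inequality. *)
Lemma normM_le_sqr (k x y : R) : 0 < k -> `|x * y| <= (k * x ^+ 2 + k^-1 * y ^+ 2) / 2.
Proof.
move=> k0; rewrite normrM -(real_normK (num_real x)) -(real_normK (num_real y)).
have := sqr_ge0 (k * `|x| - `|y|).
rewrite -(pmulr_rge0 _ (_ : 0 < k^-1)) ?invr_gt0// => h.
rewrite -subr_ge0 (_ : _ - _ = 2^-1 * (k^-1 * (k * `|x| - `|y|) ^+ 2)).
  by rewrite mulr_ge0.
by field; rewrite gt_eqF.
Qed.

Variables (h : R -> R).
Hypotheses (mh : measurable_fun setT h) (h1 : forall x, `|h x| <= 1)
  (h_lip : forall x y, `|h x - h y| <= `|x - y|).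

Lemma measurable_bounded_test (Y V : T -> R) (l : R) : measurable_fun setT Y -> measurable_fun setT V ->
  measurable_fun setT (fun w => Y w * h (l * V w)).
Proof.
move=> mY mV; apply: measurable_funM => //; apply: measurableT_comp => //.
exact: measurable_funM.
Qed.

Lemma integrable_test (Y V : T -> R) (l M : R) : measurable_fun setT Y -> measurable_fun setT V ->
  (forall w, `|Y w| <= M) -> P.-integrable setT (EFin \o (fun w => Y w * h (l * V w))).
Proof.
move=> mY mV YM; apply: (@bounded_integrable _ M) => [|w]; first exact: measurable_bounded_test.
by rewrite normrM -[leRHS]mulr1 ler_pM.
Qed.

Lemma expectation_weight_le (Y Y' V : T -> R) (l M M' r : R) :
  measurable_fun setT Y -> measurable_fun setT Y' -> measurable_fun setT V ->
  (forall w, `|Y w| <= M) -> (forall w, `|Y' w| <= M') ->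
  (\int[P]_w `|Y w - Y' w|%:E <= r%:E)%E ->
  `|fine 'E_P[fun w => Y w * h (l * V w)] - fine 'E_P[fun w => Y' w * h (l * V w)]| <= r.
Proof.
move=> mY mY' mV YM YM' hr; apply: expectation_diff_le hr.
- exact: integrable_test YM.
- exact: integrable_test YM'.
- by move=> w; rewrite -mulrBl normrM -[leRHS]mulr1 ler_wpM2l.
Qed.

(** With second moments r for a and s k^2 for b, the weighted inequality bounds E|ab| by k (r + s) /
    2. The remaining half in the constant is the 2^-1 of the chaos. *)
Lemma expectation_lipschitz_le (Y V W a b : T -> R) (l M k r s : R) :
  measurable_fun setT Y -> measurable_fun setT V -> measurable_fun setT W ->
  measurable_fun setT a -> measurable_fun setT b -> 0 < k -> (forall w, `|Y w| <= M) ->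
  (forall w, V w - W w = 2^-1 * (a w * b w)) ->
  (\int[P]_w ((a w) ^+ 2)%:E <= r%:E)%E -> (\int[P]_w ((b w) ^+ 2)%:E <= (s * k ^+ 2)%:E)%E ->
  `|fine 'E_P[fun w => Y w * h (l * V w)] - fine 'E_P[fun w => Y w * h (l * W w)]|
    <= M * `|l| * (r + s) / 4 * k.
Proof.
move=> mY mV mW ma mb k0 YM VW ar bs.
have M0 : 0 <= M by exact: le_trans (YM point).
have c0 : 0 <= M * `|l| / 4 by rewrite divr_ge0// mulr_ge0.
apply: (@expectation_diff_le _ _ (fun w => M * `|l| / 4 * k * a w ^+ 2 + M * `|l| / 4 * k^-1 * b w ^+ 2)).
- exact: integrable_test YM.
- exact: integrable_test YM.
- move=> w; rewrite -mulrBr normrM.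
  apply: (@le_trans _ _ (M * (`|l| * (2^-1 * ((k * a w ^+ 2 + k^-1 * b w ^+ 2) / 2))))).
    apply: ler_pM => //; apply: le_trans (h_lip _ _) _.
    rewrite -mulrBr normrM VW normrM (ger0_norm (x := 2^-1))// ler_wpM2l// ler_wpM2l//.
    exact: normM_le_sqr.
  by rewrite le_eqVlt; apply/orP; left; apply/eqP; field; rewrite gt_eqF.
under eq_integral do rewrite EFinD EFinM [X in (_ + X)%E]EFinM.
have c1 : 0 <= M * `|l| / 4 * k by rewrite mulr_ge0// ltW.
have c2 : 0 <= M * `|l| / 4 * k^-1 by rewrite mulr_ge0// invr_ge0 ltW.
have ma2 : measurable_fun setT (fun w => ((a w) ^+ 2)%:E) by apply/measurable_EFinP/measurable_funX.
have mb2 : measurable_fun setT (fun w => ((b w) ^+ 2)%:E) by apply/measurable_EFinP/measurable_funX.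
have a0 w : (0 <= ((a w) ^+ 2)%:E)%E by rewrite lee_fin sqr_ge0.
have b0 w : (0 <= ((b w) ^+ 2)%:E)%E by rewrite lee_fin sqr_ge0.
rewrite ge0_integralD//; first last.
- exact: emeasurable_funM.
- by move=> w _; apply: mule_ge0 => //; rewrite lee_fin.
- exact: emeasurable_funM.
- by move=> w _; apply: mule_ge0 => //; rewrite lee_fin.
rewrite !ge0_integralZl ?lee_fin//.
rewrite (_ : M * `|l| * (r + s) / 4 * k =
  M * `|l| / 4 * k * r + M * `|l| / 4 * k^-1 * (s * k ^+ 2)); last first.
  by field; rewrite gt_eqF.
by rewrite EFinD !EFinM -!EFinM; apply: leeD; rewrite [leRHS]EFinM; apply: lee_wpmul2l; rewrite ?lee_fin.
Qed.

End comparison.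

Section limit_law.
Local Open Scope ereal_scope.
Context {R : realType} {d d' : measure_display} {Omega : measurableType d}
  {Omega' : measurableType d'}.
Variables (P : probability Omega R) (P' : probability Omega' R) (pr : Omega' -> Omega).
Local Notation gamma := (@normal_prob R 0 1).
Hypothesis hext : is_extension P P' pr.

Lemma ge0_integral_extension (f : Omega -> \bar R) : measurable_fun setT f ->
  (forall w, 0 <= f w) -> \int[P']_w' f (pr w') = \int[P]_w f w.
Proof.
move=> mf f0; have [mpr hpr] := hext.
transitivity (\int[pushforward P' (pr : Omega' -> Omega)]_w f w).
  by rewrite ge0_integral_pushforward.
by apply: eq_measure_integral => A mA _; exact: hpr.
Qed.

Variable Z : Omega' -> R.
Hypotheses (Z_normal : has_normal_law P' Z 0 1)
  (Z_law : forall A C, measurable A -> measurable C ->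
    P' (pr @^-1` A `&` Z @^-1` C) = P A * gamma (id @^-1` C)).

Lemma hermite2_sqr : \int[P']_w' ((hermite2 (Z w')) ^+ 2)%:E = (@kurtosis R)%:E.
Proof.
have [mZ _] := Z_normal; have [mpr _] := hext.
have [_ <-] := @has_integral_kurtosis R.
pose f (p : Omega * measurableTypeR R) := ((p.2 ^+ 2 - 1) ^+ 2)%:E.
rewrite (@ge0_integral_joint_law R _ _ _ _ Omega' Omega (measurableTypeR R) (measurableTypeR R)
  P' P gamma pr Z id mpr mZ (@measurable_id _ _ setT) Z_law f).
- rewrite /f/= (_ : (fun=> _) = cst (\int[gamma]_z ((z ^+ 2 - 1) ^+ 2)%:E))//.
  by rewrite integral_cst//= probability_setT mule1.
- apply/measurable_EFinP; apply: measurable_funX; apply: measurable_funB => //.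
  by apply: measurable_funX; exact: measurable_snd.
- by move=> p; rewrite lee_fin sqr_ge0.
Qed.

Variables (G : set_system Omega) (sG : sigma_algebra setT G) (Gm : G `<=` measurable).

(** Both sides are the same double integral over P and N(0, 1): freezing replaces X by sqrt(v) z,
    for which X^2 - v = v (z^2 - 1), and (pr, Z) has the product law. This exact identity is the
    only place where the limit law arises. *)
Lemma expectation_gaussian_limit (h : R -> R) (Y xi X : Omega -> R) (v l M : R) :
  measurable_fun setT h -> (forall x, `|h x| <= 1)%R ->
  measurable_wrt G Y -> measurable_wrt G xi -> (forall w, `|Y w| <= M)%R ->
  (0 <= v)%R -> gaussian_indep P G X (Num.sqrt v) ->
  'E_P[fun w => (Y w * h (l * (2^-1 * xi w * (X w ^+ 2 - v))))%R] =
  'E_P'[fun w' => (Y (pr w') * h (l * (2^-1 * (v * xi (pr w')) * hermite2 (Z w'))))%R].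
Proof.
move=> mh h1 GY Gxi YM v0 GX; rewrite unlock.
have [mZ _] := Z_normal; have [mpr _] := hext.
have mY := measurable_wrt_measurable Gm GY; have mxi := measurable_wrt_measurable Gm Gxi.
pose f (p : Omega * R) := (Y p.1 * h (l * (2^-1 * xi p.1 * (p.2 ^+ 2 - v))))%R%:E.
pose g (p : Omega * R) := (Y p.1 * h (l * (2^-1 * (v * xi p.1) * hermite2 p.2)))%R%:E.
have fE w z : f (w, (Num.sqrt v * z)%R) = g (w, z).
  rewrite /f/g/=/hermite2; congr ((_ * h (l * _))%:E).
  by rewrite exprMn sqr_sqrtr//; ring.
have gM w z : `|g (w, z)| <= M%:E.
  by rewrite lee_fin normrM -[leRHS]mulr1 ler_pM.
have goo : \int[P]_w \int[gamma]_z `|g (w, z)| < +oo.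
  apply: (@le_lt_trans _ _ (\int[P]_w \int[gamma]_z M%:E)).
    apply: ge0_le_integral_nomeas => w _; first by apply: integral_ge0.
    by apply: ge0_le_integral_nomeas.
  under eq_integral do rewrite integral_cst//= probability_setT mule1.
  by rewrite integral_cst//= probability_setT mule1 ltry.
rewrite (_ : \int[P']_w' _ = \int[P]_w \int[gamma]_z g (w, z)); last first.
  rewrite -(@integral_joint_law R _ _ _ _ Omega' Omega (measurableTypeR R) (measurableTypeR R)
    P' P gamma pr Z id mpr mZ (@measurable_id _ _ setT) Z_law g)//.
  apply/measurable_EFinP; apply: measurable_funM.
    exact: (measurableT_comp mY (@measurable_fst _ _ Omega (measurableTypeR R))).
  apply: measurableT_comp => //; apply: measurable_funM => //; apply: measurable_funM.
    apply: measurable_funM => //; apply: measurable_funM => //.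
    exact: (measurableT_comp mxi (@measurable_fst _ _ Omega (measurableTypeR R))).
  by apply: measurable_funB => //; apply: measurable_funX; exact: measurable_snd.
have foo : \int[P]_w \int[gamma]_z `|f (w, (Num.sqrt v * z)%R)| < +oo.
  by under eq_integral => w _ do under eq_integral => z _ do rewrite fE.
have mf : measurable_fun setT (f : g_sigma_algebraType G * R -> \bar R).
  have m1 := @measurable_fst _ _ (g_sigma_algebraType G) (measurableTypeR R).
  have m2 := @measurable_snd _ _ (g_sigma_algebraType G) (measurableTypeR R).
  have mY' := iffLR (measurable_wrtP sG _) GY.
  have mxi' := iffLR (measurable_wrtP sG _) Gxi.
  apply/measurable_EFinP; apply: measurable_funM; first exact: (measurableT_comp mY' m1).
  apply: measurableT_comp => //; apply: measurable_funM => //; apply: measurable_funM.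
    by apply: measurable_funM => //; exact: (measurableT_comp mxi' m1).
  by apply: measurable_funB => //; apply: measurable_funX; exact: m2.
have [_ fint] := integral_gaussian_indep sG Gm GX mf foo.
rewrite (_ : \int[P]_w _ = \int[P]_w f (w, X w))// fint.
by apply: eq_integral => w _; apply: eq_integral => z _; rewrite fE.
Qed.

End limit_law.

Section fixed_index.
Context {R : realType} {d d' : measure_display} {Omega : measurableType d}
  {Omega' : measurableType d'}.
Variables (P : probability Omega R) (P' : probability Omega' R) (pr : Omega' -> Omega) (Z : Omega' -> R).
Hypotheses (hext : is_extension P P' pr) (Z_normal : has_normal_law P' Z 0 1)
  (Z_law : forall A C, measurable A -> measurable C ->
    (P' (pr @^-1` A `&` Z @^-1` C) = P A * normal_prob 0 1 (id @^-1` C))%E).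
Variables (h : R -> R).
Hypotheses (mh : measurable_fun setT h) (h1 : forall x, `|h x| <= 1)
  (h_lip : forall x y, `|h x - h y| <= `|x - y|).
Variables (G : set_system Omega) (sG : sigma_algebra setT G) (Gm : G `<=` measurable).

(** In order: replacing F by its chaos; dropping the quadratic error D, with 2 C + 2 bounding
    E[xi^2]; exchanging Y and Y' on either side of the identity in law; passing from v xi to L
    zeta. *)
Definition comparison_constant (M l A C L : R) : R :=
  M * `|l| * (4 + A) / 4 + M * `|l| * (2 * C + 2 + 1) / 4 + 2 +
  M * `|l| * (kurtosis + (2 * (L + 2) ^+ 2 + 8 * C)) / 4.

Variables (F Y Y' xi zeta X D : Omega -> R) (l M M' A C L k v : R).
Hypotheses (mF : measurable_fun setT F) (mY : measurable_fun setT Y) (mzeta : measurable_fun setT zeta)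
  (mD : measurable_fun setT D) (GY' : measurable_wrt G Y') (Gxi : measurable_wrt G xi)
  (YM : forall w, `|Y w| <= M) (YM' : forall w, `|Y' w| <= M')
  (k0 : 0 < k) (k1 : k <= 1) (L0 : 0 <= L) (v0 : 0 <= v) (vL : `|v - L| <= 2 * k)
  (GX : gaussian_indep P G X (Num.sqrt v))
  (zetaC : (\int[P]_w ((zeta w) ^+ 2)%:E <= C%:E)%E)
  (xi_zeta : (\int[P]_w ((xi w - zeta w) ^+ 2)%:E <= (k ^+ 2)%:E)%E)
  (Dk : (\int[P]_w ((D w) ^+ 2)%:E <= (k ^+ 2)%:E)%E)
  (FA : (\int[P]_w ((F w - 2^-1 * xi w * (X w ^+ 2 - v - D w)) ^+ 2)%:E <= (A * k ^+ 2)%:E)%E)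
  (YY' : (\int[P]_w `|Y w - Y' w|%:E <= k%:E)%E).

Let mxi : measurable_fun setT xi. Proof. exact: (measurable_wrt_measurable Gm Gxi). Qed.
Let mY' : measurable_fun setT Y'. Proof. exact: (measurable_wrt_measurable Gm GY'). Qed.
Let k2le1 : k ^+ 2 <= 1. Proof. by rewrite expr_le1// ltW. Qed.

Let xi2 : (\int[P]_w ((xi w) ^+ 2)%:E <= (2 * C + 2)%:E)%E.
Proof.
rewrite (_ : (fun w => _) = (fun w => ((zeta w + (xi w - zeta w)) ^+ 2)%:E)); last first.
  by apply/funext => w; congr ((_ ^+ 2)%:E); ring.
apply: le_trans (integral_sqrD_le _ mzeta (measurable_funB mxi mzeta)) _.
rewrite [leRHS]EFinD; apply: leeD; first by rewrite EFinM; exact: lee_wpmul2l.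
rewrite -[leRHS]mule1; apply: lee_wpmul2l => //.
by apply: le_trans xi_zeta _; rewrite lee_fin.
Qed.

Let C0 : 0 <= C.
Proof.
by rewrite -lee_fin; apply: le_trans zetaC; apply: integral_ge0 => w _; rewrite lee_fin sqr_ge0.
Qed.

(** From v xi - L zeta = v (xi - zeta) + (v - L) zeta, where v <= L + 2 because k <= 1. *)
Let coef : (\int[P]_w ((v * xi w - L * zeta w) ^+ 2)%:E <= ((2 * (L + 2) ^+ 2 + 8 * C) * k ^+ 2)%:E)%E.
Proof.
rewrite (_ : (fun w => _) = (fun w => ((v * (xi w - zeta w) + (v - L) * zeta w) ^+ 2)%:E)); last first.
  by apply/funext => w; congr ((_ ^+ 2)%:E); ring.
apply: le_trans (integral_sqrD_le _ _ _) _.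
- by apply: measurable_funM => //; exact: measurable_funB.
- exact: measurable_funM.
have sqrM (c : R) (f : Omega -> R) : measurable_fun setT f ->
    (\int[P]_w ((c * f w) ^+ 2)%:E = (c ^+ 2)%:E * \int[P]_w ((f w) ^+ 2)%:E)%E.
  move=> mf; rewrite -ge0_integralZl//.
  - by apply: eq_integral => w _; rewrite -EFinM exprMn.
  - by apply/measurable_EFinP; exact: measurable_funX.
  - by move=> w _; rewrite lee_fin sqr_ge0.
  - by rewrite lee_fin sqr_ge0.
rewrite !sqrM//; last exact: measurable_funB.
have vL2 : (v - L) ^+ 2 <= 4 * k ^+ 2.
  rewrite -(real_normK (num_real (v - L))) (_ : 4 * k ^+ 2 = (2 * k) ^+ 2); last by ring.
  by rewrite ler_sqr ?nnegrE// mulr_ge0// ltW.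
have v2 : v ^+ 2 <= (L + 2) ^+ 2.
  rewrite ler_sqr ?nnegrE ?addr_ge0//.
  by move: vL; rewrite ler_norml => /andP[_ ?]; have := k1; lra.
rewrite (_ : (2 * (L + 2) ^+ 2 + 8 * C) * k ^+ 2 =
    2 * ((L + 2) ^+ 2 * k ^+ 2) + 2 * ((4 * k ^+ 2) * C)); last by ring.
rewrite [leRHS]EFinD; apply: leeD.
  rewrite [leRHS]EFinM; apply: lee_wpmul2l => //; rewrite [leRHS]EFinM.
  by apply: lee_pmul => //; rewrite ?lee_fin ?sqr_ge0//; apply: integral_ge0 => w _; rewrite lee_fin sqr_ge0.
rewrite [leRHS]EFinM; apply: lee_wpmul2l => //; rewrite [leRHS]EFinM.
by apply: lee_pmul => //; rewrite ?lee_fin ?sqr_ge0//; apply: integral_ge0 => w _; rewrite lee_fin sqr_ge0.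
Qed.

(** A chain of replacements: F by [W1], then by [W] without D; Y by Y', since the identity in law
    requires a [G]-measurable weight; across to the extension; back to Y; finally [V'] by [V]. *)
Lemma fixed_index_comparison :
  `|fine 'E_P[fun w => Y w * h (l * F w)] -
    fine 'E_P'[fun w' => Y (pr w') * h (l * (2^-1 * L * zeta (pr w') * hermite2 (Z w')))]|
  <= comparison_constant M l A C L * k.
Proof.
have [mX _] := GX; have [mZ _] := Z_normal; have [mpr _] := hext.
pose W1 w := 2^-1 * xi w * (X w ^+ 2 - v - D w).
pose W w := 2^-1 * xi w * (X w ^+ 2 - v).
pose V' w' := 2^-1 * (v * xi (pr w')) * hermite2 (Z w').
pose V w' := 2^-1 * L * zeta (pr w') * hermite2 (Z w').
have mW1 : measurable_fun setT W1.
  apply: measurable_funM; first exact: measurable_funM.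
  by apply: measurable_funB => //; apply: measurable_funB => //; exact: measurable_funX.
have mW : measurable_fun setT W.
  apply: measurable_funM; first exact: measurable_funM.
  by apply: measurable_funB => //; exact: measurable_funX.
have mH : measurable_fun setT (fun w' => hermite2 (Z w')).
  by apply: measurable_funB => //; exact: measurable_funX.
have mxip : measurable_fun setT (fun w' => xi (pr w')) by exact: measurableT_comp.
have mzetap : measurable_fun setT (fun w' => zeta (pr w')) by exact: measurableT_comp.
have mV' : measurable_fun setT V'.
  by apply: measurable_funM => //; apply: measurable_funM => //; exact: measurable_funM.
have mV : measurable_fun setT V.
  by apply: measurable_funM => //; apply: measurable_funM.
(* The bounded factor is the constant 2, which cancels 2^-1; its second moment is the 4 of the
   bound. *)
have b1 := @expectation_lipschitz_le _ _ _ P _ mh h1 h_lip Y F W1 (cst 2) (fun w => F w - W1 w)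
  l M k 4 A mY mF mW1 (measurable_cst _) (measurable_funB mF mW1) k0 YM.
have b2 := @expectation_lipschitz_le _ _ _ P _ mh h1 h_lip Y W W1 xi D
  l M k (2 * C + 2) 1 mY mW mW1 mxi mD k0 YM.
have b3 := @expectation_weight_le _ _ _ P _ mh h1 Y Y' W l M M' k mY mY' mW YM YM' YY'.
have b4 := @expectation_weight_le _ _ _ P' _ mh h1 (fun w' => Y (pr w')) (fun w' => Y' (pr w')) V' l M M' k
  (measurableT_comp mY mpr) (measurableT_comp mY' mpr) mV' (fun w' => YM (pr w')) (fun w' => YM' (pr w')).
have b5 := @expectation_lipschitz_le _ _ _ P' _ mh h1 h_lip (fun w' => Y (pr w')) V' V
  (fun w' => hermite2 (Z w')) (fun w' => v * xi (pr w') - L * zeta (pr w'))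
  l M k kurtosis (2 * (L + 2) ^+ 2 + 8 * C) (measurableT_comp mY mpr) mV' mV mH.
have E34 := expectation_gaussian_limit hext Z_normal Z_law sG Gm l mh h1 GY' Gxi YM' v0 GX.
have {}b1 : `|fine 'E_P[fun w => Y w * h (l * F w)] - fine 'E_P[fun w => Y w * h (l * W1 w)]| <=
    M * `|l| * (4 + A) / 4 * k.
  apply: b1 => //; first by move=> w; rewrite mulKf.
  rewrite (_ : (fun w => _) = cst 4%:E); last by apply/funext => w /=; congr (_%:E); ring.
  by rewrite integral_cst//= probability_setT mule1.
have {}b2 : `|fine 'E_P[fun w => Y w * h (l * W w)] - fine 'E_P[fun w => Y w * h (l * W1 w)]| <=
    M * `|l| * (2 * C + 2 + 1) / 4 * k.
  apply: b2 => //; last by rewrite mul1r.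
  by move=> w; rewrite /W/W1; ring.
have {}b4 : `|fine 'E_P'[fun w => Y (pr w) * h (l * V' w)] - fine 'E_P'[fun w => Y' (pr w) * h (l * V' w)]| <= k.
  apply: b4; rewrite (ge0_integral_extension hext (f := fun w => `|Y w - Y' w|%:E))//.
  by apply/measurable_EFinP; apply: measurableT_comp => //; exact: measurable_funB.
have {}b5 : `|fine 'E_P'[fun w => Y (pr w) * h (l * V' w)] - fine 'E_P'[fun w => Y (pr w) * h (l * V w)]| <=
    M * `|l| * (kurtosis + (2 * (L + 2) ^+ 2 + 8 * C)) / 4 * k.
  apply: b5 => //.
  - by apply: measurable_funB; apply: measurable_funM.
  - by move=> w; rewrite /V/V'; ring.
  - by rewrite (hermite2_sqr hext Z_normal Z_law).
  - rewrite (ge0_integral_extension hext (f := fun w => ((v * xi w - L * zeta w) ^+ 2)%:E))//.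
    + by apply/measurable_EFinP/measurable_funX/measurable_funB; apply: measurable_funM.
    + by move=> w; rewrite lee_fin sqr_ge0.
rewrite E34 in b3.
move: b1 b2 b3 b4 b5; rewrite !ler_norml /comparison_constant => /andP[? ?] /andP[? ?].
by move=> /andP[? ?] /andP[? ?] /andP[? ?]; apply/andP; split; lra.
Qed.

End fixed_index.

(** * Passage to the limit in n *)

Section limit.
Local Open Scope ereal_scope.
Context {R : realType} {d : measure_display} {Omega : measurableType d}.
Variables (P : probability Omega R) (B : R -> Omega -> R).
Hypotheses (hB : standard_brownian_motion P B) (hOmega : brownian_space P B).
Local Notation Fil := (natural_filtration P B).
Local Notation mu := (@lebesgue_measure R).
Local Notation I01 := (`[0%R, 1%R]%classic : set R).

Variables (phi : nat -> R -> R) (alpha : nat -> R) (L : R).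
Hypotheses (phi_meas : forall n, measurable_fun I01 (phi n))
  (phi_bounded : forall n, exists M : R, forall t : R, (0 <= t <= 1)%R -> (phi n t <= M)%R)
  (phi_ge0 : forall (n : nat) (t : R), (0 <= t <= 1)%R -> (0 <= phi n t)%R)
  (L_gt0 : (0 < L)%R) (alpha01 : forall n, (0 <= alpha n <= 1)%R)
  (alpha_cvg : alpha @ \oo --> (1%R : R))
  (phi_tail : (fun n => \int[mu]_(t in `[alpha n, 1%R]) ((phi n t) ^+ 2)%:E) @ \oo --> L%:E)
  (phi_total : (fun n => \int[mu]_(t in `[0%R, 1%R]) ((phi n t) ^+ 2)%:E) @ \oo --> L%:E)
  (phi_sup : forall delta : R, (0 <= delta < 1)%R ->
    (fun n => sup [set phi n t | t in `[0%R, delta]] * sup [set phi n t | t in `[0%R, 1%R]])%R @ \oo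
      --> (0%R : R)).

(** Once [alpha n] exceeds delta, the mass of ]delta, 1] lies between those of [alpha n, 1] and
    [0, 1], which have the same limit. *)
Lemma near_tail_mass (delta k : R) : (0 <= delta < 1)%R -> (0 < k)%R ->
  \forall n \near \oo, (`|tail_mass delta (phi n) - L| <= k)%R.
Proof.
move=> /andP[d0 d1] k0.
have h1 : \forall n \near \oo, (L - k)%:E < \int[mu]_(t in `[alpha n, 1%R]) ((phi n t) ^+ 2)%:E.
  have := phi_tail => /(_ [set x | (L - k)%:E < x]) /=; apply.
  by apply: open_ereal_gt'; rewrite lte_fin; lra.
have h2 : \forall n \near \oo, \int[mu]_(t in `[0%R, 1%R]) ((phi n t) ^+ 2)%:E < (L + k)%:E.
  have := phi_total => /(_ [set x | x < (L + k)%:E]) /=; apply.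
  by apply: open_ereal_lt'; rewrite lte_fin; lra.
have h3 : \forall n \near \oo, (delta < alpha n)%R.
  by apply: (cvgr_gt _ alpha_cvg).
near=> n.
have lt1 : (L - k)%:E < \int[mu]_(t in `[alpha n, 1%R]) ((phi n t) ^+ 2)%:E by near: n.
have lt2 : \int[mu]_(t in `[0%R, 1%R]) ((phi n t) ^+ 2)%:E < (L + k)%:E by near: n.
have da : (delta < alpha n)%R by near: n.
have tE s : (0 <= s <= 1)%R -> (delta < s)%R -> tail_part delta (phi n) s = phi n s.
  by move=> /andP[_ s1] ds; rewrite /tail_part indicE mem_setE in_itv/= ds s1 mulr1.
have le1 : \int[mu]_(t in `[alpha n, 1%R]) ((phi n t) ^+ 2)%:E <=
    \int[mu]_(t in I01) ((tail_part delta (phi n) t) ^+ 2)%:E.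
  have [a0 a1] := andP (alpha01 n).
  apply: ge0_le_integral_subset_nomeas.
  - by move=> s /=; rewrite !in_itv/= => /andP[as1 ->]; rewrite (le_trans a0 as1).
  - by move=> s _; rewrite lee_fin sqr_ge0.
  - move=> s /=; rewrite in_itv/= => /andP[as1 s1]; rewrite lee_fin sqr_ge0/=.
    by rewrite tE ?(le_trans a0 as1) ?s1// (lt_le_trans da as1).
have le2 : \int[mu]_(t in I01) ((tail_part delta (phi n) t) ^+ 2)%:E <=
    \int[mu]_(t in I01) ((phi n t) ^+ 2)%:E.
  apply: ge0_le_integral_nomeas => s /=; first by rewrite lee_fin sqr_ge0.
  rewrite in_itv/= => s01; rewrite lee_fin /tail_part exprMn indicE.
  by case: (_ \in _); rewrite ?expr1n ?mulr1// expr0n/= mulr0 sqr_ge0.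
rewrite /tail_mass.
have := lt_le_trans lt1 le1; have := le_lt_trans le2 lt2.
case: (\int[mu]_(t in I01) _) => [r| |] //=; rewrite !lte_fin => ? ?.
by rewrite ler_norml; apply/andP; split; lra.
Unshelve. all: end_near.
Qed.

Lemma near_phi_product (delta eta : R) : (0 <= delta < 1)%R -> (0 < eta)%R ->
  \forall n \near \oo, forall s r, (0 <= s <= delta)%R -> (0 <= r <= 1)%R ->
    (phi n s * phi n r <= eta)%R.
Proof.
move=> hd eta0; have /andP[d0 d1] := hd.
have h : \forall n \near \oo,
    (sup [set phi n t | t in `[0%R, delta]] * sup [set phi n t | t in `[0%R, 1%R]] <= eta)%R.
  exact: (cvgr_le _ (phi_sup hd) _ eta0).
near=> n => s r s0d r01.
have hn : (sup [set phi n t | t in `[0%R, delta]] * sup [set phi n t | t in `[0%R, 1%R]] <= eta)%R.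
  by near: n.
apply: le_trans hn; have [M hM] := phi_bounded n.
have s01 : (0 <= s <= 1)%R by case/andP: s0d => -> sd /=; exact: le_trans sd (ltW d1).
apply: ler_pM; [exact: phi_ge0|exact: phi_ge0|apply: ub_le_sup|apply: ub_le_sup].
- exists M => y [t /=]; rewrite in_itv/= => /andP[t0 td] <-; apply: hM.
  by rewrite t0 (le_trans td (ltW d1)).
- by exists s => //=; rewrite in_itv.
- by exists M => y [t /=]; rewrite in_itv/= => t01 <-; exact: hM.
- by exists r => //=; rewrite in_itv.
Unshelve. all: end_near.
Qed.

Variables (u : R -> R -> Omega -> R) (F : nat -> Omega -> R).
Hypotheses (u_meas : measurable_fun
     [set p : R * R * Omega | 0 <= p.1.1 <= p.1.2 /\ p.1.2 <= 1]%R
     (fun p => u p.1.1 p.1.2 p.2))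
  (u_adapted : forall s t : R, (0 <= s)%R -> (s <= t)%R -> (t <= 1)%R ->
     measurable_wrt (Fil s) (u s t))
  (u_L2 : \int[mu]_(t in `[0%R, 1%R]) \int[mu]_(s in `[0%R, t])
               'E_P[fun w => ((u s t w) ^+ 2)%R] < +oo)
  (u_cont :
    (fun p : R * R => 'E_P[fun w => ((u p.1 p.2 w - u 1 1 w) ^+ 2)%R])
      @ within [set p | 0 <= p.1 <= p.2 /\ p.2 <= 1]%R (nbhs ((1, 1) : R * R)%R)
      --> 0)
  (hF : forall n, is_iterated_ito_integral P B
          (fun s t w => phi n s * phi n t * u s t w)%R (F n)).
Context {d' : measure_display} {Omega' : measurableType d'}.
Variables (P' : probability Omega' R) (pr : Omega' -> Omega) (Z : Omega' -> R).
Hypotheses (hext : is_extension P P' pr) (Z_normal : has_normal_law P' Z 0 1)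
  (Z_indep : independent_of P' Z (sigma_upto (fun t w' => B t (pr w')) 1)).
Variable (h : R -> R).
Hypotheses (mh : measurable_fun setT h) (h1 : forall x, (`|h x| <= 1)%R)
  (h_lip : forall x y, (`|h x - h y| <= `|x - y|)%R).

(** The choices are made in the order k, delta, eta, n, then the subdivision. This is sound because
    the constant [K] depends on none of them. *)
Lemma expectation_cvg (l M : R) (Y : Omega -> R) : measurable_fun setT Y ->
  (forall w, `|Y w| <= M)%R ->
  (fun n => fine 'E_P[fun w => Y w * h (l * F n w)]%R) @ \oo -->
  (fine 'E_P'[fun w' => Y (pr w') * h (l * (2^-1 * L * u 1 1 (pr w') * hermite2 (Z w')))]%R : R).
Proof.
move=> mY YM.
have su11 := square_integrable_u11 hOmega u_adapted u_L2 u_cont.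
pose C := fine (\int[P]_w ((u 1 1 w) ^+ 2)%:E).
have CE : \int[P]_w ((u 1 1 w) ^+ 2)%:E = C%:E.
  rewrite /C fineK// ge0_fin_numE; first by case: su11.
  by apply: integral_ge0 => w _; rewrite lee_fin sqr_ge0.
have C0 : (0 <= C)%R by apply: fine_ge0; apply: integral_ge0 => w _; rewrite lee_fin sqr_ge0.
pose T := fine (total_energy P u).
have TE : total_energy P u = T%:E.
  rewrite /T fineK// ge0_fin_numE ?(total_energy_lty u_L2)//.
  by apply: integral_ge0 => r _; apply: integral_ge0 => s _; exact: energy_ge0.
have T0 : (0 <= T)%R.
  by apply: fine_ge0; apply: integral_ge0 => r _; apply: integral_ge0 => s _; exact: energy_ge0.
(* The bound of [chaos_approximation] in units of k^2, when its e1 and k are both k^2, eta^2 T <=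
   k^2, and the tail mass is at most L + 1. *)
pose A := (16 * (2 + (8 * (L + 1) ^+ 2 + 1)))%R.
pose K := comparison_constant M l A C L.
have M0 : (0 <= M)%R by exact: le_trans (YM point).
have kurt0 : (0 <= @kurtosis R)%R.
  by apply: fine_ge0; apply: integral_ge0 => w _; rewrite lee_fin sqr_ge0.
have A0 : (0 <= A)%R.
  by apply: mulr_ge0 => //; have := sqr_ge0 (L + 1)%R; set z := (_ ^+ 2)%R; lra.
have K0 : (0 <= K)%R.
  have Ml : (0 <= M * `|l|)%R by exact: mulr_ge0.
  have L2 := sqr_ge0 (L + 2)%R.
  rewrite /K /comparison_constant; apply: addr_ge0.
    apply: addr_ge0 => //; apply: addr_ge0; apply: divr_ge0 => //; apply: mulr_ge0 => //; lra.
  by apply: divr_ge0 => //; apply: mulr_ge0 => //; lra.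
apply/cvgrPdist_le => eps eps0.
(* The denominator K + 1 allows for K = 0. *)
pose k := Num.min 1%R (eps / (K + 1))%R.
have k0 : (0 < k)%R by rewrite lt_min ltr01 divr_gt0//; lra.
have k1 : (k <= 1)%R by rewrite ge_min lexx.
have Kk : (K * k <= eps)%R.
  have : (k <= eps / (K + 1))%R by rewrite ge_min lexx orbT.
  by rewrite ler_pdivlMr; [have := k0; set z := k; set y := K => ? ?; nra|lra].
have k20 : (0 < k ^+ 2)%R by exact: exprn_gt0.
have k2k : (k ^+ 2 <= k)%R by rewrite expr2 ler_piMl// ltW.
have [delta1 [/andP[d10 d11] hd1]] := u_continuity u_cont k20.
have [delta2 [Y' [M' [/andP[d20 d21] FY' YM' YY']]]] := filtration_dense hB hOmega mY YM k0.
(* Late enough both for u to be close to u_{1,1} and for Y' to be known. *)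
pose delta := Num.max delta1 delta2.
have hd : (0 <= delta < 1)%R by rewrite le_max d10/= gt_max d11.
have /andP[de0 de1] := hd.
have FY : measurable_wrt (Fil delta) Y'.
  by move=> S mS; apply: (@sub_filtration _ _ _ P B delta2); [rewrite le_max lexx orbT|exact: FY'].
have u_near s r : (delta <= s)%R -> (s <= r)%R -> (r <= 1)%R ->
    \int[P]_w ((u s r w - u 1 1 w) ^+ 2)%:E <= (k ^+ 2)%:E.
  by move=> ds sr r1; apply/ltW/hd1 => //; apply: le_trans ds; rewrite le_max lexx.
have Fud : measurable_wrt (Fil delta) (u delta delta) by apply: u_adapted => //; exact: ltW.
have mud : measurable_fun setT (u delta delta).
  by apply: (u_measurable hOmega u_adapted) => //; exact: ltW.
have [mu11 _] := su11.
have su : square_integrable P (u delta delta).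
  have sd : square_integrable P (fun w => u delta delta w - u 1 1 w)%R.
    split; first exact: measurable_funB.
    by apply: le_lt_trans (u_near _ _ (lexx _) (lexx _) (ltW de1)) _; rewrite ltry.
  rewrite (_ : u delta delta = (fun w => u 1 1 w + (u delta delta w - u 1 1 w))%R).
    exact: square_integrableD.
  by apply/funext => w; ring.
(* Then eta^2 T <= k^2, whatever T >= 0. *)
pose eta := (k / (T + 1))%R.
have eta0 : (0 < eta)%R by rewrite divr_gt0//; lra.
near=> n.
have hmass : (`|tail_mass delta (phi n) - L| <= k)%R.
  by near: n; exact: near_tail_mass.
have hprod : forall s r, (0 <= s <= delta)%R -> (0 <= r <= 1)%R -> (phi n s * phi n r <= eta)%R.
  by near: n; exact: near_phi_product.
have [Mp hMp] := phi_bounded n.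
have phiM s : (0 <= s <= 1)%R -> (0 <= phi n s <= Mp)%R.
  by move=> s01; rewrite phi_ge0// hMp.
have [v [X [D [v0 vm GX [mD hD] hFX]]]] := chaos_approximation hB hOmega u_meas u_adapted hd
  (ltW k20) u_near su (phi_meas n) phiM (ltW eta0) hprod (hF n) k20.
have mF : measurable_fun setT (F n) by have [V [_ []]] := hF n.
rewrite distrC; apply: le_trans Kk.
apply: (@fixed_index_comparison R _ _ _ _ P P' pr Z hext Z_normal
  (extension_joint_law hB hOmega hext Z_normal Z_indep) h mh h1 h_lip _
  (sigma_algebra_filtration hB delta) (filtration_measurable hOmega (ltW de1))
  (F n) Y Y' (u delta delta) (u 1 1) X D l M M' A C L k v) => //.
- exact: ltW.
- move: vm hmass; rewrite !ler_norml => /andP[? ?] /andP[? ?].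
  by apply/andP; split; have := k2k; lra.
- by rewrite CE.
- by apply: u_near => //; exact: ltW.
- apply: le_trans hFX _.
  rewrite TE -!EFinM lee_fin.
  have etaT : (eta ^+ 2 * T <= k ^+ 2)%R.
    rewrite /eta exprMn exprVn -mulrA ler_piMr ?sqr_ge0// mulrC ler_pdivrMr; last by rewrite exprn_gt0//; lra.
    by have := T0; nra.
  have tm0 : (0 <= tail_mass delta (phi n))%R.
    by apply: fine_ge0; apply: integral_ge0 => s _; rewrite lee_fin sqr_ge0.
  have tm2 : (tail_mass delta (phi n) ^+ 2 <= (L + 1) ^+ 2)%R.
    rewrite ler_sqr ?nnegrE//; last by have := L_gt0; lra.
    by move: hmass; rewrite ler_norml => /andP[_ ?]; have := k1; lra.
  have km : (k ^+ 2 * tail_mass delta (phi n) ^+ 2 <= k ^+ 2 * (L + 1) ^+ 2)%R.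
    by apply: ler_wpM2l => //; exact: ltW.
  rewrite /A; move: etaT km.
  set x := (eta ^+ 2 * T)%R; set y := (k ^+ 2 * _)%R; set z := (k ^+ 2 * (L + 1) ^+ 2)%R => etaT km.
  rewrite (_ : (8 * k ^+ 2 * tail_mass delta (phi n) ^+ 2 = 8 * y)%R); last by rewrite /y mulrA.
  rewrite (_ : (16 * (2 + (8 * (L + 1) ^+ 2 + 1)) * k ^+ 2 = 16 * (3 * k ^+ 2 + 8 * z))%R); last by rewrite /z; ring.
  lra.
Unshelve. all: end_near.
Qed.

End limit.

Lemma derive_lipschitz (R : realType) (f df : R -> R) :
  (forall x : R, is_derive x 1 f (df x)) -> (forall x, `|df x| <= 1) ->
  forall x y, `|f x - f y| <= `|x - y|.
Proof.
move=> fdf df1 x y; wlog yx : x y / y <= x.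
  by move=> hw; have [|/ltW] := leP y x; [exact: hw|rewrite distrC (distrC x); exact: hw].
have cf : {within `[y, x], continuous f}.
  apply: continuous_subspaceT => z; apply: differentiable_continuous.
  by apply/derivable1_diffP; case: (fdf z).
have [c _ ->] := MVT_segment yx (fun z _ => fdf z) cf.
by rewrite normrM ler_piMl.
Qed.

Lemma cvg_complex (R : realType) (a b : nat -> R) (x y : R) :
  a @ \oo --> x -> b @ \oo --> y ->
  (fun n => (a n +i* b n)%C : R[i]^o) @ \oo --> ((x +i* y)%C : R[i]^o).
Proof.
move=> /cvgrPdist_le ax /cvgrPdist_le by_; apply/cvgrPdist_le => -[e1 e2].
(* In the order on complex numbers, a positive epsilon has zero imaginary part. *)
rewrite ltcE/= => /andP[/eqP -> e10].
have e20 : 0 < e1 / 2 by rewrite divr_gt0.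
have {}ax := ax _ e20; have {}by_ := by_ _ e20.
near=> n.
have h1 : `|x - a n| <= e1 / 2 by near: n.
have h2 : `|y - b n| <= e1 / 2 by near: n.
rewrite normc_def/= lecE/= eqxx/=.
rewrite (_ : e1 = Num.sqrt (e1 ^+ 2)); last by rewrite sqrtr_sqr gtr0_norm.
apply: ler_wsqrtr.
rewrite -(real_normK (num_real (x - a n))) -(real_normK (num_real (y - b n))).
have n1 := normr_ge0 (x - a n); have n2 := normr_ge0 (y - b n).
move: n1 n2 h1 h2; set p := `|_|; set q := `|_| => *; nra.
Unshelve. all: end_near.
Qed.

Theorem theorem3p3 (R : realType)
  (d : measure_display) (Omega : measurableType d) (P : probability Omega R)
  (B : R -> Omega -> R)
  (hB : standard_brownian_motion P B)
  (hOmega : brownian_space P B)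
  (phi : nat -> R -> R)
  (phi_meas : forall n, measurable_fun (`[0, 1] : set R) (phi n))
  (phi_bounded : forall n, exists M : R, forall t : R,
     0 <= t <= 1 -> phi n t <= M)
  (phi_ge0 : forall (n : nat) (t : R), 0 <= t <= 1 -> 0 <= phi n t)
  (alpha : nat -> R) (L : R)
  (L_gt0 : 0 < L)
  (alpha01 : forall n, 0 <= alpha n <= 1)
  (alpha_homo : {homo alpha : m n / (m <= n)%N >-> m <= n})
  (alpha_cvg : alpha @ \oo --> (1 : R))
  (phi_tail :
    (fun n => \int[lebesgue_measure]_(t in `[alpha n, 1%R])
                ((phi n t) ^+ 2)%R%:E)%E @ \oo --> L%:E)
  (phi_total :
    (fun n => \int[lebesgue_measure]_(t in `[0%R, 1%R])
                ((phi n t) ^+ 2)%R%:E)%E @ \oo --> L%:E)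
  (phi_sup : forall delta : R, 0 <= delta < 1 ->
    (fun n => sup [set phi n t | t in `[0, delta]] *
              sup [set phi n t | t in `[0, 1]]) @ \oo --> (0 : R))
  (u : R -> R -> Omega -> R)
  (u_meas : measurable_fun
     [set p : R * R * Omega | 0 <= p.1.1 <= p.1.2 /\ p.1.2 <= 1]
     (fun p => u p.1.1 p.1.2 p.2))
  (u_adapted : forall s t : R, 0 <= s -> s <= t -> t <= 1 ->
     measurable_wrt (natural_filtration P B s) (u s t))
  (u_L2 : (\int[lebesgue_measure]_(t in `[0%R, 1%R])
             \int[lebesgue_measure]_(s in `[0%R, t])
               'E_P[fun w => ((u s t w) ^+ 2)%R] < +oo)%E)
  (u_cont :
    (fun p : R * R => 'E_P[fun w => ((u p.1 p.2 w - u 1 1 w) ^+ 2)%R])%E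
      @ within [set p | 0 <= p.1 <= p.2 /\ p.2 <= 1] (nbhs ((1, 1) : R * R))
      --> 0%E)
  (F : nat -> Omega -> R)
  (hF : forall n, is_iterated_ito_integral P B
          (fun s t w => phi n s * phi n t * u s t w) (F n))
  (d' : measure_display) (Omega' : measurableType d')
  (P' : probability Omega' R) (pr : Omega' -> Omega)
  (hext : is_extension P P' pr)
  (Z : Omega' -> R)
  (Z_normal : has_normal_law P' Z 0 1)
  (Z_indep : independent_of P' Z (sigma_upto (fun t w' => B t (pr w')) 1)) :
  stable_cvg P F P' pr
    (fun w' => 2^-1 * L * u 1 1 (pr w') * hermite2 (Z w')).
Proof.
move=> lambda Y mY [M YM].
have cosL : forall x y : R, `|cos x - cos y| <= `|x - y|.
  by apply: (derive_lipschitz (df := fun x => - sin x)) => x; rewrite ?normrN ?sin_max.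
have sinL : forall x y : R, `|sin x - sin y| <= `|x - y|.
  by apply: (derive_lipschitz (df := fun x => cos x)) => x; rewrite ?cos_max.
have key h mh h1 hL := expectation_cvg hB hOmega phi_meas phi_bounded phi_ge0 L_gt0 alpha01
  alpha_cvg phi_tail phi_total phi_sup u_meas u_adapted u_L2 u_cont hF hext Z_normal Z_indep
  (h := h) mh h1 hL (l := lambda) mY YM.
have Ccos := key cos (continuous_measurable_fun (@continuous_cos R)) (@cos_max R) cosL.
have Csin := key sin (continuous_measurable_fun (@continuous_sin R)) (@sin_max R) sinL.
have expiE (y x : R) : y%:C%C * expi x = (y * cos x +i* (y * sin x))%C.
  by apply/eqP; rewrite eq_complex/= !mul0r subr0 addr0 !eqxx.
have reE (y x : R) : complex.Re (y%:C%C * expi x) = y * cos x by rewrite expiE.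
have imE (y x : R) : complex.Im (y%:C%C * expi x) = y * sin x by rewrite expiE.
rewrite /cexpectation [X in _ --> X](_ : _ = (fine 'E_P'[fun w' => Y (pr w') *
      cos (lambda * (2^-1 * L * u 1 1 (pr w') * hermite2 (Z w')))] +i*
    fine 'E_P'[fun w' => Y (pr w') *
      sin (lambda * (2^-1 * L * u 1 1 (pr w') * hermite2 (Z w')))])%C); last first.
  by congr (fine 'E_P'[_] +i* fine 'E_P'[_])%C; apply/funext => w'; rewrite ?reE ?imE.
rewrite (_ : (fun n => _) = (fun n =>
    (fine 'E_P[fun w => Y w * cos (lambda * F n w)] +i*
     fine 'E_P[fun w => Y w * sin (lambda * F n w)])%C : R[i]^o)).
  exact: cvg_complex Ccos Csin.
by apply/funext => n; congr (fine 'E_P[_] +i* fine 'E_P[_])%C; apply/funext => w; rewrite ?reE ?imE.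
Qed.
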